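(* Let $H:\mathbb{R}^N\times[0,T]\times\mathbb{R}^N\to\mathbb{R}$ satisfy $(\mathbf{H0})$, $(\mathbf{H1})$ and the coercivity condition $(\mathbf{H2})$ (all stated in the context), and let $t_*$ be defined as in the context. Let $u$ be a continuous, bounded from below viscosity solution of $u_t+H(x,t,Du)=0$ in $\mathbb{R}^N\times(0,T)$. Then $u$ is locally Lipschitz continuous in space and time, i.e. in $(x,t)$, in $\mathbb{R}^N\times(0,\min(t_*,T))$.
   Context: Here $N\ge1$ and $T\in(0,+\infty]$; if $T=+\infty$, read $[0,T]$ as $[0,\infty)$ and $(0,T]$ as $(0,\infty)$. Subscripts of $H$ denote partial derivatives, which exist almost everywhere where $H$ is locally Lipschitz in the corresponding variable. $(\mathbf{H0})$: $H$ is continuous on $\mathbb{R}^N\times[0,T]\times\mathbb{R}^N$ and there exists $c_0\ge0$ such that: (i) $H$ is locally Lipschitz in the $p$-variable in a neighborhood of $\{(x,t,p): H(x,t,p)\ge c_0\}$; (ii) there exists a continuous, increasing function $\phi:[c_0,\infty)\to[0,\infty)$ such that, for some $A>c_0$, $\int_A^{+\infty}\frac{ds}{s\phi(s)}<+\infty$, and $(H_p\cdot p-H)(x,t,p)\ge\phi(H(x,t,p))$ a.e. in $\{(x,t,p): H(x,t,p)\ge c_0\}$; (iii) there exists $\kappa>0$ such that $|H_p(x,t,p)|\le\kappa\,(H_p\cdot p-H)(x,t,p)$ a.e. in $\{(x,t,p): H(x,t,p)\ge c_0\}$. Function $F$: for $\tau\in(c_0,\infty)$, $F(\tau):=2\int_\tau^\infty\frac{d\sigma}{\sigma\phi(\sigma)}$,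 and $F(c_0):=\lim_{\tau\to c_0^+}F(\tau)\in(0,+\infty]$. Function $\psi$: the map $r\mapsto 2r+\phi(2r)$ is increasing from $(c_0,\infty)$ onto $(2c_0+\phi(2c_0),\infty)$; its inverse is denoted $\psi:(2c_0+\phi(2c_0),\infty)\to(c_0,\infty)$, extended by continuity to the left endpoint. $(\mathbf{H1})$: there exists $c_1\ge0$ (with $[c_1,\infty)$ contained in the domain of $\psi$, so that $\psi(H)$ below is defined) such that $H$ is locally Lipschitz in $t$ in a neighborhood of $\{(x,t,p): H(x,t,p)\ge c_1\}$ and $|H_t(x,t,p)|\le\psi(H(x,t,p))\,(H_p\cdot p-H)(x,t,p)$ a.e. in $\{(x,t,p): H(x,t,p)\ge c_1\}$. $(\mathbf{H2})$ (coercivity): $H(x,t,p)\to+\infty$ as $|p|\to+\infty$, uniformly for $(x,t)$ in compact subsets of $\mathbb{R}^N\times(0,T]$. Constants: $c_*:=\max(c_0,c_1)$; $t_*:=F(c_* )$ if $c_*>0$, and $t_*:=+\infty$ if $c_*=0$. *)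

(* Defs.v *)
From HB Require Import structures.
From mathcomp Require Import all_boot all_order all_algebra.
From mathcomp Require Import all_classical all_reals all_analysis.

Set Implicit Arguments.
Unset Strict Implicit.
Unset Printing Implicit Defensive.

Import Order.TTheory GRing.Theory Num.Theory.
Import numFieldNormedType.Exports.

Local Open Scope classical_set_scope.
Local Open Scope ring_scope.

(* The library norm on 'rV[R]_N is the sup norm; it is used only where the choice
   of an equivalent norm is immaterial (topology, Lipschitz continuity). *)

Section euclidean.
Context {R : realType} {N : nat}.

Definition dotv (a b : 'rV[R]_N) : R := \sum_(j < N) a 0 j * b 0 j.

Definition enorm (a : 'rV[R]_N) : R := Num.sqrt (dotv a a).

Definition has_partials (f : 'rV[R]_N -> R) (x : 'rV[R]_N) : Prop :=
  forall j : 'I_N, derivable f x (delta_mx 0 j).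

Definition grad (f : 'rV[R]_N -> R) (x : 'rV[R]_N) : 'rV[R]_N :=
  \row_(j < N) 'D_(delta_mx 0 j) f x.

(* Lebesgue-negligible subsets of R^N: zero outer measure, i.e. countable covers
   by boxes of arbitrarily small total volume. *)
Definition lebesgue_null (A : set 'rV[R]_N) : Prop :=
  forall e : R, 0 < e -> exists a b : nat -> 'rV[R]_N,
    [/\ forall k j, a k 0 j <= b k 0 j,
        A `<=` \bigcup_k [set x | forall j, a k 0 j <= x 0 j <= b k 0 j] &
        (\sum_(0 <= k <oo) (\prod_(j < N) (b k 0 j - a k 0 j))%:E <= e%:E)%E].

End euclidean.

Section hamiltonian.
Context {R : realType} {N : nat}.

Definition flat (z : 'rV[R]_N * R * 'rV[R]_N) : 'rV[R]_(N + (1 + N)) :=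
  row_mx z.1.1 (row_mx (z.1.2)%:M z.2).

Definition ae_in (S P : set ('rV[R]_N * R * 'rV[R]_N)) : Prop :=
  lebesgue_null (flat @` (S `\` P)).

(* [0, T], which is [0, oo) when T = +oo since t is real. *)
Definition dom_H (T : \bar R) : set ('rV[R]_N * R * 'rV[R]_N) :=
  [set z | 0 <= z.1.2 /\ (z.1.2%:E <= T)%E].

(* The Hamiltonian is a total function whose values outside [dom_H T] are
   irrelevant. *)
Variables (T : \bar R) (H : 'rV[R]_N -> R -> 'rV[R]_N -> R).

Definition superlevel (c : R) : set ('rV[R]_N * R * 'rV[R]_N) :=
  [set z | dom_H T z /\ c <= H z.1.1 z.1.2 z.2].

(* Neighbourhoods are relative to [dom_H T]; the Lipschitz constant in one
   variable is locally uniform in the other ones. *)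
Definition locally_lipschitz_p_near (S : set ('rV[R]_N * R * 'rV[R]_N)) :=
  exists U, [/\ open U, S `<=` U &
    forall z, U z -> dom_H T z -> exists W (L : R), nbhs z W /\
      forall x t,
        L.-lipschitz_[set p | W (x, t, p) /\ dom_H T (x, t, p)] (H x t)].

Definition locally_lipschitz_t_near (S : set ('rV[R]_N * R * 'rV[R]_N)) :=
  exists U, [/\ open U, S `<=` U &
    forall z, U z -> dom_H T z -> exists W (L : R), nbhs z W /\
      forall x p,
        L.-lipschitz_[set t | W (x, t, p) /\ dom_H T (x, t, p)]
          (fun t => H x t p)].

(* H_p . p - H *)
Definition HpH (x : 'rV[R]_N) (t : R) (p : 'rV[R]_N) : R :=
  dotv (grad (H x t) p) p - H x t p.

Definition Ht (x : 'rV[R]_N) (t : R) (p : 'rV[R]_N) : R :=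
  derive1 (fun s => H x s p) t.

End hamiltonian.

Section assumptions.
Context {R : realType} {N : nat}.
Variables (T : \bar R) (H : 'rV[R]_N -> R -> 'rV[R]_N -> R).
Variables (c0 : R) (phi : R -> R) (c1 : R).

Definition admissible_phi : Prop :=
  [/\ {within `[c0, +oo[, continuous phi},
      {in `[c0, +oo[ &, {homo phi : r s / r < s}},
      forall s, c0 <= s -> 0 <= phi s &
      exists2 A, c0 < A &
        (\int[lebesgue_measure]_(s in `]A, +oo[) ((s * phi s)^-1)%:E < +oo)%E].

(* The existence of the partial derivatives is part of each a.e. requirement; for
   a locally Lipschitz H it holds a.e. anyway. *)
Definition H0 : Prop :=
  [/\ {within dom_H T, continuous
        (fun z : 'rV[R]_N * R * 'rV[R]_N => H z.1.1 z.1.2 z.2)},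
      0 <= c0,
      locally_lipschitz_p_near T H (superlevel T H c0),
      admissible_phi /\
      ae_in (superlevel T H c0)
        [set z | has_partials (H z.1.1 z.1.2) z.2 /\
          phi (H z.1.1 z.1.2 z.2) <= HpH H z.1.1 z.1.2 z.2] &
      exists2 kappa : R, 0 < kappa &
      ae_in (superlevel T H c0)
        [set z | has_partials (H z.1.1 z.1.2) z.2 /\
          enorm (grad (H z.1.1 z.1.2) z.2)
            <= kappa * HpH H z.1.1 z.1.2 z.2]].

Definition F_integral (tau : R) : \bar R :=
  (2%:E * \int[lebesgue_measure]_(s in `]tau, +oo[) ((s * phi s)^-1)%:E)%E.

Definition F (tau : R) : \bar R :=
  if tau == c0 then lim (F_integral s @[s --> c0^'+]) else F_integral tau.

Definition psi_inv (r : R) : R := 2 * r + phi (2 * r).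

Definition psi_open : R -> R := 'pinv_(fun=> 0) `]c0, +oo[ psi_inv.

Definition psi (r : R) : R :=
  if r == psi_inv c0 then lim (psi_open s @[s --> r^'+]) else psi_open r.

(* [psi_inv c0] is the left endpoint of the domain of [psi]. *)
Definition H1 : Prop :=
  [/\ 0 <= c1,
      psi_inv c0 <= c1,
      locally_lipschitz_t_near T H (superlevel T H c1) &
      ae_in (superlevel T H c1)
        [set z | [/\ has_partials (H z.1.1 z.1.2) z.2,
          derivable (fun s => H z.1.1 s z.2) z.1.2 1 &
          `|Ht H z.1.1 z.1.2 z.2|
            <= psi (H z.1.1 z.1.2 z.2) * HpH H z.1.1 z.1.2 z.2]]].

Definition H2 : Prop :=
  forall K : set ('rV[R]_N * R), compact K ->
    K `<=` [set y | 0 < y.2 /\ (y.2%:E <= T)%E] ->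
    forall M : R, exists r : R,
      forall y p, K y -> r <= enorm p -> M <= H y.1 y.2 p.

Definition c_star : R := Num.max c0 c1.

Definition t_star : \bar R := (if (0 < c_star)%R then F c_star else +oo)%E.

End assumptions.

Section viscosity.
Context {R : realType} {N : nat}.

(* R^N x (0, T) *)
Definition cylinder (T : \bar R) : set ('rV[R]_N * R) :=
  [set y | 0 < y.2 /\ (y.2%:E < T)%E].

(* For an open set Q. *)
Definition C1_on (Q : set ('rV[R]_N * R)) (g : 'rV[R]_N * R -> R) : Prop :=
  forall y, Q y -> differentiable g y /\
    forall v, {for y, continuous (fun w => 'D_v g w)}.

Variables (T : \bar R) (H : 'rV[R]_N -> R -> 'rV[R]_N -> R).

(* g_t + H(x, t, Dg) at y = (x, t) *)
Definition HJ (g : 'rV[R]_N * R -> R) (y : 'rV[R]_N * R) : R :=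
  derive1 (fun s => g (y.1, s)) y.2
  + H y.1 y.2 (grad (fun x => g (x, y.2)) y.1).

Definition viscosity_subsolution (u : 'rV[R]_N * R -> R) : Prop :=
  forall g, C1_on (cylinder T) g -> forall y, cylinder T y ->
    (\forall w \near y, u w - g w <= u y - g y) -> HJ g y <= 0.

Definition viscosity_supersolution (u : 'rV[R]_N * R -> R) : Prop :=
  forall g, C1_on (cylinder T) g -> forall y, cylinder T y ->
    (\forall w \near y, u y - g y <= u w - g w) -> 0 <= HJ g y.

(* No semicontinuous envelopes: only used for continuous u. *)
Definition viscosity_solution (u : 'rV[R]_N * R -> R) : Prop :=
  viscosity_subsolution u /\ viscosity_supersolution u.

Definition locally_lipschitz_on
    (Q : set ('rV[R]_N * R)) (u : 'rV[R]_N * R -> R) : Prop :=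
  forall y, Q y -> exists2 W, nbhs y W & [lipschitz u w | w in W `&` Q].

End viscosity.

(* Main.v *)
Require Import Defs.
From HB Require Import structures.
From mathcomp Require Import all_boot all_order all_algebra.
From mathcomp Require Import all_classical all_reals all_analysis.
From mathcomp Require Import measurable_realfun ring lra.

(** Why [u] is locally Lipschitz.

    The hypotheses say that [H] grows superlinearly in [p] along rays:
    where [H] is large, almost everywhere [H_p . p - H >= phi (H)], where [phi] is
    unbounded ([phi_unbounded]), and [H_p] and [H_t] are controlled by
    [H_p . p - H]. Consequently, where [H] is large, replacing the momentum by
    [(p + d) / mu - d] with [mu > 1], which corresponds to multiplying the solution
    by [1 / mu], gains more than is lost by a shift in time of order [(mu - 1) / H] or by
    the vector [d]. This is [hamiltonian_decrease], and in integrated form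
    [scaled_hamiltonian_lt]. The hypotheses hold almost everywhere only, and the
    segment along which they are integrated may lie in the exceptional set; the
    passage from almost everywhere to everywhere is [ae_directional_bound], by
    averaging over small cubes.

    The comparison of [mu * H] with [H] enters through the time estimate
    ([time_estimate]), whose form is chosen to create the factor [mu]: one bounds
    [u (x, s) - u (x, t)] for [s <= t] by
    [(t - s) * L * exp (16 V)], where [V] measures the height of [u (x, t)] above its
    lower bound, and localizes by a cutoff in [V]. At a maximum after doubling the
    space variable, the dependence of the weight on [u] produces a factor
    [mu = 1 + D] in the supersolution inequality ([penalized_subjet]), with [D] large
    compared with [(t - s) * E], where [E] bounds [H] in the subsolution inequality.
    This is the regime of [scaled_hamiltonian_lt], and the two viscosity
    inequalities become incompatible when [L] is large.

    The estimate so obtained says that [u] does not decrease in time faster than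
    linearly, so every superjet [(q, tau)] has [tau >= - L]. The equation gives
    [H (x, t, q) <= L], coercivity bounds [q], and the equation once more bounds
    [tau] from above ([superjet_bound]). A continuous function with bounded
    superjets is locally Lipschitz, by comparison with cones ([cone_bound]). *)

Set Implicit Arguments.
Unset Strict Implicit.
Unset Printing Implicit Defensive.

Import Order.TTheory GRing.Theory Num.Theory.
Import numFieldNormedType.Exports.

Local Open Scope classical_set_scope.
Local Open Scope ring_scope.

(** * Null sets and their slices *)

Section null_sets.
Context {R : realType}.
Notation leb := (@lebesgue_measure R).

Definition consr n (x : R) (w : 'rV[R]_n) : 'rV[R]_n.+1 :=
  \row_j if unlift ord0 j is Some i then w 0 i else x.

Lemma consr0 n x (w : 'rV[R]_n) : consr x w 0 ord0 = x.
Proof. by rewrite mxE unlift_none. Qed.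

Lemma consrS n x (w : 'rV[R]_n) i : consr x w 0 (lift ord0 i) = w 0 i.
Proof. by rewrite mxE liftK. Qed.

(** Null sets by countable covers, as in [lebesgue_null], except that the mask [s]
    discards boxes: slicing a cover then yields a cover, the boxes that miss the
    slice being masked out, whatever their remaining side lengths are. *)
Definition cover_null n (A : set 'rV[R]_n) : Prop :=
  forall e : R, 0 < e -> exists a b : nat -> 'rV[R]_n, exists s : nat -> bool,
    [/\ forall k j, a k 0 j <= b k 0 j,
        A `<=` \bigcup_(k in [set k | s k])
                 [set x | forall j, a k 0 j <= x 0 j <= b k 0 j] &
        (\sum_(0 <= k <oo)
           ((s k)%:R * \prod_(j < n) (b k 0 j - a k 0 j))%:E <= e%:E)%E].

Lemma lebesgue_null_cover_null n (A : set 'rV[R]_n) :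
  lebesgue_null A -> cover_null A.
Proof.
move=> An e e0; have [a [b [ab Aab le_e]]] := An _ e0.
exists a, b, xpredT; split => //.
  by move=> x /Aab[k _ xk]; exists k.
apply: le_trans le_e; rewrite le_eqVlt; apply/orP; left; apply/eqP.
by apply: eq_eseriesr => k _; rewrite mul1r.
Qed.

Lemma integral_indic_segment (a b : R) : a <= b ->
  (\int[leb]_x (\1_(`[a, b]%classic : set R) x)%:E = (b - a)%:E)%E.
Proof.
move=> ab; rewrite integral_indic//.
rewrite setIT; apply: (etrans (lebesgue_measure_itv `[a, b])) => /=.
rewrite lte_fin; move: ab; rewrite le_eqVlt => /predU1P[->|->//].
by rewrite ltxx subrr.
Qed.

(** Fubini for null sets, without product measures: for a cover of volume at most
    [1 / (m + 1)] the volume [S m x] of the induced cover of the slice at [x] has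
    integral at most [1 / (m + 1)], hence [inf_m S m x = 0] for almost every [x]. *)
Lemma cover_null_slice n (A : set 'rV[R]_n.+1) : cover_null A ->
  {ae leb, forall x, cover_null [set w | A (consr x w)]}.
Proof.
move=> An.
have An' (m : nat) := An m.+1%:R^-1 (ltac:(by rewrite invr_gt0)).
have [a /choice [b /choice [s abs]]] := choice An'.
pose vol m k := \prod_(j < n) (b m k 0 (lift ord0 j) - a m k 0 (lift ord0 j)).
have vol0 m k : 0 <= vol m k.
  by apply: prodr_ge0 => j _; rewrite subr_ge0; have [] := abs m.
pose I m k := `[a m k 0 ord0, b m k 0 ord0]%classic.
pose term m k x : \bar R := ((s m k)%:R * vol m k * \1_(I m k) x)%:E.
have term0 m k x : (0 <= term m k x)%E.
  by rewrite lee_fin !mulr_ge0.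
have mterm m k : measurable_fun [set: R] (term m k).
  apply/measurable_EFinP; apply: measurable_funM => //; apply: measurable_indic; exact: measurable_itv.
pose S (m : nat) (x : R) : \bar R := (\sum_(0 <= k <oo) term m k x)%E.
have S0 m x : (0 <= S m x)%E by apply: nneseries_ge0 => k _ _.
have mS m : measurable_fun [set: R] (S m).
  by apply: ge0_emeasurable_sum.
have intS m : (\int[leb]_x S m x <= m.+1%:R^-1%:E)%E.
  have [ab _ le_e] := abs m.
  rewrite integral_nneseries//; last by move=> k; exact: mterm.
  apply: le_trans le_e; apply: lee_nneseries => k _.
    by move=> _; apply: integral_ge0 => x _; apply: term0.
  rewrite /term; under eq_integral do rewrite EFinM.
  rewrite ge0_integralZl_EFin//; last 2 first.
  - by apply/measurable_EFinP; apply: measurable_indic; exact: measurable_itv.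
  - by rewrite mulr_ge0.
  rewrite integral_indic_segment; last exact: ab.
  by rewrite -EFinM lee_fin big_ord_recl -mulrA (mulrC (_ - _)) /vol.
pose J x := einfs (S ^~ x) 0%N.
have mJ : measurable_fun [set: R] J by apply: measurable_fun_einfs.
have J0 x : (0 <= J x)%E by apply: le_ereal_inf_tmp => _ [m _ <-].
have leJ m x : (J x <= S m x)%E by apply: ge_ereal_inf; exists (S m x) => //; exists m.
have intJ : (\int[leb]_x `|J x| = 0)%E.
  apply/eqP; rewrite eq_le; apply/andP; split; last exact: integral_ge0.
  apply/lee_addgt0Pr => e e0; rewrite add0e.
  have [m me] : exists m : nat, m.+1%:R^-1 <= e.
    have := near_infty_natSinv_lt (PosNum e0) => /= -[m _ mP].
    by exists m; apply/ltW/mP => /=.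
  apply: (@le_trans _ _ (m.+1%:R^-1%:E)); last by rewrite lee_fin.
  apply: le_trans (intS m).
  apply: ge0_le_integral => //=.
  - exact: measurableT_comp.
  - exact: mS.
  - by move=> x _; rewrite gee0_abs.
have Jae := (ae_eq_integral_abs leb measurableT mJ).1 intJ.
apply: filterS Jae => x /(_ Logic.I) /= Jx0.
move=> e e0.
have : (J x < e%:E)%E by rewrite Jx0 ?lte_fin.
move=> /ereal_inf_lt [_ [m _ <-]] Se.
exists (fun k => \row_j a m k 0 (lift ord0 j)),
       (fun k => \row_j b m k 0 (lift ord0 j)),
       (fun k => s m k && (x \in I m k)).
have [ab Aab _] := abs m; split.
- by move=> k j; rewrite !mxE.
- move=> w /Aab [k /= sk xk]; exists k => /=.
    rewrite sk /=; rewrite inE /I /= in_itv/=.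
    by have := xk ord0; rewrite consr0.
  by move=> j; rewrite !mxE; have := xk (lift ord0 j); rewrite consrS.
- apply: le_trans (ltW Se); rewrite /S le_eqVlt; apply/orP; left; apply/eqP.
  apply: eq_eseriesr => k _; rewrite /term indicE.
  congr EFin; rewrite mulrAC -natrM mulnb; congr (_ * _).
  by apply: eq_bigr => j _; rewrite !mxE.
Qed.

Lemma cover_null_scale n (A : set 'rV[R]_n) (z : 'rV[R]_n) (rho : R) :
  0 < rho -> cover_null A -> cover_null [set w | A (z + rho *: w)].
Proof.
move=> rho0 An e e0.
have [|a [b [s [ab Aab le_e]]]] := An (e * rho ^+ n).
  by rewrite mulr_gt0// exprn_gt0.
exists (fun k => rho^-1 *: (a k - z)), (fun k => rho^-1 *: (b k - z)), s.
split.
- by move=> k j; rewrite !mxE ler_pM2l ?invr_gt0// lerD2r.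
- move=> w /Aab[k sk abk]; exists k => // j; have := abk j.
  by rewrite !mxE ![rho^-1 * _]mulrC ler_pdivrMr// ler_pdivlMr//
    lerBlDl lerBrDl (mulrC rho).
- have rhon : 0 < rho ^- n by rewrite invr_gt0 exprn_gt0.
  have -> : (e = rho ^- n * (e * rho ^+ n))%R.
    by rewrite mulrCA mulVf ?mulr1// gt_eqF// exprn_gt0.
  rewrite EFinM; apply: le_trans (lee_wpmul2l _ le_e); last first.
    by rewrite lee_fin ltW.
  rewrite -nneseriesZl//; last first.
    move=> k _; rewrite lee_fin mulr_ge0// prodr_ge0// => j _.
    by rewrite subr_ge0.
  rewrite le_eqVlt; apply/orP; left; apply/eqP.
  apply: eq_eseriesr => k _; rewrite -EFinM; congr EFin.
  rewrite mulrCA; congr (_ * _).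
  rewrite -exprVn -[X in rho^-1 ^+ X](card_ord n) -prodr_const -big_split/=.
  by apply: eq_bigr => j _; rewrite !mxE; ring.
Qed.

Lemma ae_imply (P Q : R -> Prop) : (forall x, P x -> Q x) ->
  {ae leb, forall x, P x} -> {ae leb, forall x, Q x}.
Proof.
by move=> PQ; exact: (@filterS _ _ (ae_filter_ringOfSetsType leb) P Q).
Qed.

Lemma ae_imply2 (P Q S : R -> Prop) : (forall x, P x -> Q x -> S x) ->
  {ae leb, forall x, P x} -> {ae leb, forall x, Q x} ->
  {ae leb, forall x, S x}.
Proof.
by move=> PQ; exact: (@filterS2 _ _ (ae_filter_ringOfSetsType leb) P Q S).
Qed.

(** Nullity read off one coordinate at a time, the form that matches the iterated
    integral [cube_mean] below. *)
Fixpoint iter_null n : set 'rV[R]_n -> Prop :=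
  match n with
  | 0 => fun A => ~ A 0
  | n.+1 => fun A => {ae leb, forall x, iter_null [set w | A (consr x w)]}
  end.

Lemma iter_null_slices n (A : set 'rV[R]_n.+1) :
  iter_null A = {ae leb, forall x, iter_null [set w | A (consr x w)]}.
Proof. by []. Qed.

Lemma iter_nullU n (A B : set 'rV[R]_n) :
  iter_null A -> iter_null B -> iter_null (A `|` B).
Proof.
elim: n A B => [A B /= nA nB []//|n IH A B].
rewrite !iter_null_slices => nA nB.
by apply: ae_imply2 nA nB => x; apply: IH.
Qed.

Lemma cover_null_iter_null n (A : set 'rV[R]_n) : cover_null A -> iter_null A.
Proof.
elim: n A => [A An A0|n IH A /cover_null_slice]; last first.
  by rewrite iter_null_slices; apply: ae_imply => x; apply: IH.
have [a [b [s [_ Aab le_e]]]] := An 2^-1 (ltac:(by rewrite invr_gt0)).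
have [k sk _] := Aab _ A0.
have : (1%:E <= (2^-1 : R)%:E)%E.
  apply: le_trans le_e.
  apply: le_trans (nneseries_lim_ge k.+1 _); last first.
    by move=> i _ _; rewrite big_ord0 mulr1.
  rewrite big_nat_recr//= big_ord0 mulr1 sk.
  rewrite -[leLHS]add0e leeD2r// sume_ge0// => i _.
  by rewrite big_ord0 mulr1.
by rewrite lee_fin; lra.
Qed.

(** [iter_null] is used inside small cubes [z + rho * [0, 1]^n], which are all brought
    back to the unit cube. *)
Definition affine_null n (A : set 'rV[R]_n) : Prop :=
  forall (z : 'rV[R]_n) (rho : R), 0 < rho ->
    iter_null [set w | A (z + rho *: w)].

Lemma lebesgue_null_affine_null n (A : set 'rV[R]_n) :
  lebesgue_null A -> affine_null A.
Proof.
move=> nA z rho rho0; apply: cover_null_iter_null; apply: cover_null_scale => //.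
exact: lebesgue_null_cover_null.
Qed.

Lemma affine_nullU n (A B : set 'rV[R]_n) :
  affine_null A -> affine_null B -> affine_null (A `|` B).
Proof. by move=> nA nB z rho rho0; apply: iter_nullU; [exact: nA|exact: nB]. Qed.

End null_sets.

(** * Means over cubes *)

Section cube_mean.
Context {R : realType}.
Notation leb := (@lebesgue_measure R).

Lemma fun_continuous_cst (T : topologicalType) (c : R) :
  continuous (fun _ : T => c).
Proof. by move=> x; exact: cvg_cst. Qed.

Lemma fun_continuousD (T : topologicalType) (f g : T -> R) :
  continuous f -> continuous g -> continuous (fun x => f x + g x).
Proof. by move=> fc gc x; apply: cvgD; [exact: fc|exact: gc]. Qed.

Lemma fun_continuousB (T : topologicalType) (f g : T -> R) :
  continuous f -> continuous g -> continuous (fun x => f x - g x).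
Proof. by move=> fc gc x; apply: cvgB; [exact: fc|exact: gc]. Qed.

Lemma fun_continuousZ (T : topologicalType) (c : R) (f : T -> R) :
  continuous f -> continuous (fun x => c * f x).
Proof. by move=> fc x; apply: cvgM; [exact: cvg_cst|exact: fc]. Qed.

Lemma fun_continuous_max (T : topologicalType) (f g : T -> R) :
  continuous f -> continuous g -> continuous (fun x => Num.max (f x) (g x)).
Proof. by move=> fc gc x; apply: continuous_max; [exact: fc|exact: gc]. Qed.

Lemma fun_continuous_min (T : topologicalType) (f g : T -> R) :
  continuous f -> continuous g -> continuous (fun x => Num.min (f x) (g x)).
Proof. by move=> fc gc x; apply: continuous_min; [exact: fc|exact: gc]. Qed.

Lemma fun_continuous_translate (V : normedModType R) (f : V -> R) (a : V) :
  continuous f -> continuous (fun x => f (x + a)).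
Proof.
move=> fc x; apply: (@continuous_comp _ _ _ (fun x => x + a) f).
  by apply: cvgD; [exact: cvg_id|exact: cvg_cst].
exact: fc.
Qed.

Lemma rv_cvg (T : Type) (F : set_system T) {FF : Filter F} n (f : T -> 'rV[R]_n) (l : 'rV[R]_n) :
  (forall j, f t 0 j @[t --> F] --> l 0 j) -> f t @[t --> F] --> l.
Proof.
move=> fl; apply/cvg_ballP => e e0.
have : \forall t \near F, forall j, ball (l 0 j) e (f t 0 j).
  apply: filter_forall => j; exact: (cvg_ball (fl j) e0).
apply: filterS => t tP; split => // i j; rewrite ord1; exact: tP.
Qed.

Lemma consr_continuous n : continuous (fun p : R * 'rV[R]_n => consr p.1 p.2).
Proof.
move=> p; apply: rv_cvg => j; case: (unliftP ord0 j) => [i|] ->.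
  under eq_fun do rewrite consrS.
  rewrite consrS.
  apply: (@cvg_comp _ _ _ snd (fun w : 'rV[R]_n => w 0 i) _ (nbhs p.2)).
    exact: cvg_snd.
  exact: coord_continuous.
under eq_fun do rewrite consr0.
by rewrite consr0; exact: cvg_fst.
Qed.

Definition cube n : set 'rV[R]_n := [set w | forall j, 0 <= w 0 j <= 1].

Lemma cube_compact n : compact (@cube n).
Proof.
have := @rV_compact R n (fun=> `[0, 1]%classic) (fun=> @segment_compact R 0 1).
rewrite /cube; congr compact; apply/seteqP; split => w /= h j; have := h j;
  by rewrite in_itv.
Qed.

(** Compactness of the cube makes the continuity in the parameter uniform. *)
Lemma continuous_near_cube n (f : R -> 'rV[R]_n -> R) (x0 e : R) : 0 < e ->
  continuous (fun p : R * 'rV[R]_n => f p.1 p.2) ->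
  \forall x \near x0, forall w, cube w -> `|f x w - f x0 w| < e.
Proof.
move=> e0 fc.
have /compact_near_coveringP := @cube_compact n.
move=> /(_ _ (nbhs x0) (fun x w => `|f x w - f x0 w| < e) _); apply => w0 _.
have e20 : 0 < e / 2 by rewrite divr_gt0.
have := @cvgr_dist_lt _ _ _ (nbhs (x0, w0)) _ _ _ (fc (x0, w0)) _ e20.
case=> -[A B] /= [A0 B0] AB.
exists (B, A) => //= -[w x] /= [Bw Ax].
have h1 := AB (x, w) (conj Ax Bw).
have h2 := AB (x0, w) (conj (nbhs_singleton A0) Bw).
rewrite /= in h1 h2.
move: h1 h2; rewrite !ltr_norml => /andP[? ?] /andP[? ?].
apply/andP; split; lra.
Qed.

Definition seg_int (h : R -> R) : R := \int[leb]_(x in `[0, 1]) h x.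

Lemma continuous_seg_integrable (h : R -> R) (a b : R) : continuous h ->
  leb.-integrable `[a, b] (EFin \o h).
Proof.
move=> hc; apply: continuous_compact_integrable; first exact: segment_compact.
exact: continuous_subspaceT.
Qed.

Lemma seg_int_cst (c : R) : seg_int (fun=> c) = c.
Proof.
rewrite /seg_int Rintegral_cst//.
have leb1 : leb `[0, 1]%classic = 1%:E.
  apply: (etrans (lebesgue_measure_itv `[0, 1])) => /=.
  by rewrite lte_fin ltr01 oppr0 adde0.
by rewrite -[RHS]mulr1; congr (_ * _); exact: (congr1 fine leb1).
Qed.

Lemma seg_intD (h1 h2 : R -> R) : continuous h1 -> continuous h2 ->
  seg_int (fun x => h1 x + h2 x) = seg_int h1 + seg_int h2.
Proof.
move=> c1 c2; rewrite /seg_int RintegralD//; exact: continuous_seg_integrable.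
Qed.

Lemma seg_intZ c (h : R -> R) : continuous h ->
  seg_int (fun x => c * h x) = c * seg_int h.
Proof. by move=> c1; rewrite /seg_int RintegralZl//; exact: continuous_seg_integrable. Qed.

Lemma le_seg_int (h1 h2 : R -> R) : continuous h1 -> continuous h2 ->
  (forall x, 0 <= x <= 1 -> h1 x <= h2 x) -> seg_int h1 <= seg_int h2.
Proof.
move=> c1 c2 le12; by apply: le_Rintegral => //; exact: continuous_seg_integrable.
Qed.

Lemma segment_int_bound (h : R -> R) (B c d : R) : continuous h ->
  (forall x, `|h x| <= B) -> c <= d ->
  `|\int[leb]_(x in `[c, d]) h x| <= B * (d - c).
Proof.
move=> hc hB cd; apply: (@le_trans _ _ (\int[leb]_(x in `[c, d]) B)).
  apply: le_trans (le_normr_Rintegral _ _) _ => //.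
    exact: continuous_seg_integrable.
  apply: le_Rintegral => //.
  - apply: (@continuous_seg_integrable (fun x => `|h x|)) => x.
    by apply: continuous_comp; [exact: hc|exact: norm_continuous].
  - exact: (@continuous_seg_integrable (fun=> B) c d (@cst_continuous _ _ _)).
rewrite Rintegral_cst//.
have lebcd : leb `[c, d]%classic = (d - c)%:E.
  apply: (etrans (lebesgue_measure_itv `[c, d])) => /=.
  rewrite lte_fin; move: cd; rewrite le_eqVlt => /predU1P[->|->//].
  by rewrite ltxx subrr.
by rewrite le_eqVlt; apply/orP; left; apply/eqP; congr (_ * _);
  exact: (congr1 fine lebcd).
Qed.

Lemma seg_int_translate (h : R -> R) (a : R) : continuous h ->
  seg_int (fun x => h (x + a)) = \int[leb]_(x in `[a, 1 + a]) h x.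
Proof.
move=> hc.
pose F (x : R) := x + a.
have F' : F^`()%classic = cst 1.
  apply/funext => x; rewrite derive1E /F deriveD// derive_id derive_cst.
  by rewrite addr0.
have Fc : continuous F by move=> x; apply: cvgD; [exact: cvg_id|exact: cvg_cst].
have := @integration_by_substitution_increasing R F h 0 1 ler01.
rewrite F' /F add0r => subst; rewrite /seg_int /Rintegral subst.
- by congr fine; apply: eq_integral => x _ /=; rewrite mulr1.
- by move=> x y _ _; rewrite ltrD2r.
- by move=> x _; exact: cvg_cst.
- exact: is_cvg_cst.
- exact: is_cvg_cst.
- split=> //.
  + by apply: cvg_at_right_filter; exact: Fc.
  + by apply: cvg_at_left_filter; exact: Fc.
- exact: continuous_subspaceT.
Qed.

(** The two segments of integration differ by two segments of length [`|a|]. This is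
    what makes the cube mean of a bounded continuous function Lipschitz in its
    position. *)
Lemma seg_int_shift (h : R -> R) (B a : R) : continuous h ->
  (forall x, `|h x| <= B) ->
  `|seg_int (fun x => h (x + a)) - seg_int h| <= 2 * B * `|a|.
Proof.
suff pos (g : R -> R) (b : R) : 0 <= b -> continuous g -> (forall x, `|g x| <= B) ->
    `|seg_int (fun x => g (x + b)) - seg_int g| <= 2 * B * b.
  move=> hc hB; have [a0|a0] := leP 0 a.
    by rewrite (ger0_norm a0); exact: pos.
  rewrite (ltr0_norm a0).
  have hE : (fun x => h (x - a + a)) = h by apply/funext => x; rewrite subrK.
  have := pos (fun x => h (x + a)) (- a).
  rewrite hE oppr_ge0 (ltW a0) distrC; apply => // x.
  apply: continuous_comp; last exact: hc.
  by apply: cvgD; [exact: cvg_id|exact: cvg_cst].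
move=> b0 gc gB; rewrite seg_int_translate//.
have int01 c d := @continuous_seg_integrable g c d gc.
have b1 : b <= 1 + b by rewrite lerDr.
have l1 := @Rintegral_itvB R g (BLeft 0) (BRight (1 + b)) b (int01 _ _).
have l2 := @Rintegral_itvB R g (BLeft 0) (BRight (1 + b)) 1 (int01 _ _).
have bd1 := segment_int_bound gc gB b0.
have bd2 := segment_int_bound gc gB (ltac:(by rewrite lerDl) : 1 <= 1 + b).
move: l1 l2; rewrite !bnd_simp b0 b1 ler01 lerDl b0 => l1 l2.
have {}l1 := l1 isT isT; have {}l2 := l2 isT isT.
have intoc c d : leb.-integrable `]c, d] (EFin \o g).
  apply: integrableS (int01 c d) => //.
  by apply: subset_itvr; rewrite bnd_simp.
rewrite !Rintegral_itv_obnd_cbnd// in l1 l2.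
have -> : \int[leb]_(x in `[b, 1 + b]) g x - seg_int g =
    \int[leb]_(x in `[1, 1 + b]) g x - \int[leb]_(x in `[0, b]) g x.
  by rewrite -l1 -l2 /seg_int; ring.
by apply: le_trans (ler_normB _ _) _; lra.
Qed.

Lemma seg_int_dist (h1 h2 : R -> R) (e : R) :
  continuous h1 -> continuous h2 -> (forall x, `|h1 x - h2 x| <= e) ->
  `|seg_int h1 - seg_int h2| <= e.
Proof.
move=> c1 c2 h12.
have le1 (h h' : R -> R) : continuous h -> continuous h' ->
    (forall x, h x <= h' x + e) -> seg_int h <= seg_int h' + e.
  move=> hc hc' hh'; rewrite -[X in _ + X]seg_int_cst -seg_intD//; last first.
    exact: fun_continuous_cst.
  apply: le_seg_int => //.
  by apply: fun_continuousD => //; exact: fun_continuous_cst.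
have l1 : seg_int h1 <= seg_int h2 + e.
  by apply: le1 => // x; have := h12 x; rewrite ler_norml => /andP[? ?]; lra.
have l2 : seg_int h2 <= seg_int h1 + e.
  by apply: le1 => // x; have := h12 x; rewrite ler_norml => /andP[? ?]; lra.
by rewrite ler_norml; apply/andP; split; lra.
Qed.

(** The mean over [0, 1]^n as an iterated integral; for continuous integrands the one
    dimensional theory is then all that is needed. *)
Fixpoint cube_mean n : ('rV[R]_n -> R) -> R :=
  match n with
  | 0 => fun f => f 0
  | n.+1 => fun f => seg_int (fun x => cube_mean (fun w => f (consr x w)))
  end.

Lemma cube_meanS n (f : 'rV[R]_n.+1 -> R) :
  cube_mean f = seg_int (fun x => cube_mean (fun w => f (consr x w))).
Proof. by []. Qed.

Lemma cube_consr n x (w : 'rV[R]_n) :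
  0 <= x <= 1 -> cube w -> cube (consr x w).
Proof.
move=> x01 cw j; case: (unliftP ord0 j) => [i|] ->; first by rewrite consrS.
by rewrite consr0.
Qed.

Lemma consr_slice_continuous n (f : 'rV[R]_n.+1 -> R) x : continuous f ->
  continuous (fun w => f (consr x w)).
Proof.
move=> fc w; apply: (@continuous_comp _ _ _ (fun w => consr x w) f).
  apply: (@rv_cvg _ (nbhs w) _) => j; case: (unliftP ord0 j) => [i|] ->.
    by under eq_fun do rewrite consrS; rewrite consrS; exact: coord_continuous.
  by under eq_fun do rewrite consr0; rewrite consr0; exact: cvg_cst.
exact: fc.
Qed.

(** The induction step behind [cube_mean_linear]: additivity in dimension [n.+1] needs
    the inner means to be integrable, and continuity of these follows from
    linearity and monotonicity in dimension [n]. *)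
Lemma cube_mean_slice_continuous_step n :
  [/\ forall c : R, cube_mean (fun _ : 'rV[R]_n => c) = c,
      forall f g : 'rV[R]_n -> R, continuous f -> continuous g ->
        cube_mean (fun w => f w + g w) = cube_mean f + cube_mean g,
      forall c (f : 'rV[R]_n -> R), continuous f ->
        cube_mean (fun w => c * f w) = c * cube_mean f &
      forall f g : 'rV[R]_n -> R, continuous f -> continuous g ->
        (forall w, cube w -> f w <= g w) -> cube_mean f <= cube_mean g] ->
  forall f : 'rV[R]_n.+1 -> R, continuous f ->
    continuous (fun x => cube_mean (fun w => f (consr x w))).
Proof.
move=> [mc mD mZ mle] f fc x0; apply/cvgrPdist_le => e e0.
have fcc : continuous (fun p : R * 'rV[R]_n => f (consr p.1 p.2)).
  move=> p; apply: (@continuous_comp _ _ _ (fun p : R * 'rV[R]_n => consr p.1 p.2) f).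
    exact: consr_continuous.
  exact: fc.
have := @continuous_near_cube n (fun x w => f (consr x w)) x0 e e0 fcc.
apply: filterS => x xP.
have sc y := @consr_slice_continuous n f y fc.
have cadd (c : R) y : continuous (fun w => f (consr y w) + c).
  by apply: fun_continuousD; [exact: sc|exact: fun_continuous_cst].
have le1 y y' : (forall w, cube w -> f (consr y w) <= f (consr y' w) + e) ->
    cube_mean (fun w => f (consr y w)) <= cube_mean (fun w => f (consr y' w)) + e.
  by move=> /(mle _ _ (sc y) (cadd e y')); rewrite mD ?mc//; exact: fun_continuous_cst.
have l1 : cube_mean (fun w => f (consr x0 w)) <=
    cube_mean (fun w => f (consr x w)) + e.
  by apply: le1 => w /xP; rewrite ltr_norml => /andP[? ?]; lra.
have l2 : cube_mean (fun w => f (consr x w)) <=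
    cube_mean (fun w => f (consr x0 w)) + e.
  by apply: le1 => w /xP; rewrite ltr_norml => /andP[? ?]; lra.
by rewrite ler_norml; apply/andP; split; lra.
Qed.

Lemma cube_mean_linear n :
  [/\ forall c : R, cube_mean (fun _ : 'rV[R]_n => c) = c,
      forall f g : 'rV[R]_n -> R, continuous f -> continuous g ->
        cube_mean (fun w => f w + g w) = cube_mean f + cube_mean g,
      forall c (f : 'rV[R]_n -> R), continuous f ->
        cube_mean (fun w => c * f w) = c * cube_mean f &
      forall f g : 'rV[R]_n -> R, continuous f -> continuous g ->
        (forall w, cube w -> f w <= g w) -> cube_mean f <= cube_mean g].
Proof.
elim: n => [|n IH].
  by split=> // f g _ _; apply => -[].
have pc := cube_mean_slice_continuous_step IH.
have [mc mD mZ mle] := IH.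
have sc f y := @consr_slice_continuous n f y.
split.
- by move=> c /=; rewrite mc seg_int_cst.
- move=> f g fc gc; rewrite !cube_meanS -seg_intD; [|exact: pc|exact: pc].
  by congr seg_int; apply/funext => x; rewrite mD//; exact: sc.
- move=> c f fc; rewrite !cube_meanS -seg_intZ; last exact: pc.
  by congr seg_int; apply/funext => x; rewrite mZ//; exact: sc.
- move=> f g fc gc fg; rewrite !cube_meanS; apply: le_seg_int.
  + exact: pc.
  + exact: pc.
  + move=> x x01; apply: mle; [exact: sc|exact: sc|].
    by move=> w cw; apply: fg; exact: cube_consr.
Qed.

Lemma cube_mean_cst n (c : R) : cube_mean (fun _ : 'rV[R]_n => c) = c.
Proof. by have [mc _ _ _] := cube_mean_linear n. Qed.

Lemma cube_meanD n (f g : 'rV[R]_n -> R) : continuous f -> continuous g ->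
  cube_mean (fun w => f w + g w) = cube_mean f + cube_mean g.
Proof. by have [_ mD _ _] := cube_mean_linear n; exact: mD. Qed.

Lemma cube_meanZ n c (f : 'rV[R]_n -> R) : continuous f ->
  cube_mean (fun w => c * f w) = c * cube_mean f.
Proof. by have [_ _ mZ _] := cube_mean_linear n; exact: mZ. Qed.

Lemma cube_meanB n (f g : 'rV[R]_n -> R) : continuous f -> continuous g ->
  cube_mean (fun w => f w - g w) = cube_mean f - cube_mean g.
Proof.
move=> fc gc; rewrite -[X in _ = _ + X]mulN1r -cube_meanZ// -cube_meanD//.
  by congr cube_mean; apply/funext => w; rewrite mulN1r.
exact: fun_continuousZ.
Qed.

Lemma le_cube_mean n (f g : 'rV[R]_n -> R) : continuous f -> continuous g ->
  (forall w, cube w -> f w <= g w) -> cube_mean f <= cube_mean g.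
Proof. by have [_ _ _ mle] := cube_mean_linear n; exact: mle. Qed.

Lemma cube_mean_slice_continuous n (f : 'rV[R]_n.+1 -> R) : continuous f ->
  continuous (fun x => cube_mean (fun w => f (consr x w))).
Proof. exact: (cube_mean_slice_continuous_step (cube_mean_linear n)). Qed.

Lemma cube_mean_dist n (f g : 'rV[R]_n -> R) (e : R) :
  continuous f -> continuous g ->
  (forall w, cube w -> `|f w - g w| <= e) ->
  `|cube_mean f - cube_mean g| <= e.
Proof.
move=> fc gc fge.
have cadd (h : 'rV[R]_n -> R) : continuous h -> continuous (fun w => h w + e).
  by move=> hc; apply: fun_continuousD => //; exact: fun_continuous_cst.
have le1 (h h' : 'rV[R]_n -> R) : continuous h -> continuous h' ->
    (forall w, cube w -> h w <= h' w + e) -> cube_mean h <= cube_mean h' + e.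
  move=> hc hc' /(le_cube_mean hc (cadd _ hc')).
  by rewrite cube_meanD// ?cube_mean_cst//; exact: fun_continuous_cst.
have l1 : cube_mean f <= cube_mean g + e.
  by apply: le1 => // w /fge; rewrite ler_norml => /andP[? ?]; lra.
have l2 : cube_mean g <= cube_mean f + e.
  by apply: le1 => // w /fge; rewrite ler_norml => /andP[? ?]; lra.
by rewrite ler_norml; apply/andP; split; lra.
Qed.

Lemma consrD n x y (v w : 'rV[R]_n) :
  consr x v + consr y w = consr (x + y) (v + w).
Proof.
by apply/rowP => j; case: (unliftP ord0 j) => [i|] ->;
  rewrite mxE ?consrS ?consr0// mxE.
Qed.

Lemma consr_surj n (v : 'rV[R]_n.+1) :
  v = consr (v 0 ord0) (\row_j v 0 (lift ord0 j)).
Proof.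
by apply/rowP => j; case: (unliftP ord0 j) => [i|] ->;
  rewrite ?consrS ?consr0// mxE.
Qed.

Lemma cube_mean_shift n (g : 'rV[R]_n -> R) (B : R) (a : 'rV[R]_n) :
  continuous g -> (forall w, `|g w| <= B) ->
  `|cube_mean (fun w => g (w + a)) - cube_mean g| <= 2 * B * \sum_j `|a 0 j|.
Proof.
elim: n g a => [g a gc gB|n IH g a gc gB].
  by rewrite /= big_ord0 mulr0 [a]thinmx0 addr0 subrr normr0.
have B0 : 0 <= B by apply: le_trans (gB 0).
pose a' := (\row_j a 0 (lift ord0 j)) : 'rV[R]_n.
pose k x := cube_mean (fun w => g (consr x w)).
have kc : continuous k := cube_mean_slice_continuous gc.
have gac : continuous (fun w : 'rV[R]_n.+1 => g (w + a)).
  exact: fun_continuous_translate.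
have kB x : `|k x| <= B.
  have := @cube_mean_dist n (fun w => g (consr x w)) (fun=> 0) B.
  rewrite cube_mean_cst subr0; apply.
  - exact: consr_slice_continuous.
  - exact: fun_continuous_cst.
  - by move=> w _; rewrite subr0.
rewrite !cube_meanS -/(seg_int k).
rewrite big_ord_recl mulrDr [leRHS]addrC.
apply: le_trans (ler_distD (seg_int (fun x => k (x + a 0 ord0))) _ _) _.
apply: lerD; last exact: seg_int_shift.
have kac : continuous (fun x : R => k (x + a 0 ord0)).
  exact: fun_continuous_translate.
have -> : \sum_(i < n) `|a 0 (lift ord0 i)| = \sum_i `|a' 0 i|.
  by apply: eq_bigr => i _; rewrite mxE.
apply: seg_int_dist => [||x].
- exact: (cube_mean_slice_continuous gac).
- exact: kac.
- have -> : (fun w => g (consr x w + a)) =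
      (fun w => g (consr (x + a 0 ord0) (w + a'))).
    by apply/funext => w; rewrite [in LHS](consr_surj a) consrD.
  apply: (IH (fun w => g (consr (x + a 0 ord0) w)) a') => //.
  exact: consr_slice_continuous.
Qed.

(** Dominated convergence, applied coordinate by coordinate: for almost every first
    coordinate the slice of [A] is again null, so the inner means tend to 0. *)
Lemma cube_mean_cvg0 n (f : nat -> 'rV[R]_n -> R) (B : R) (A : set 'rV[R]_n) :
  (forall m, continuous (f m)) -> (forall m w, 0 <= f m w <= B) ->
  iter_null A -> (forall w, cube w -> ~ A w -> f m w @[m --> \oo] --> (0 : R)) ->
  cube_mean (f m) @[m --> \oo] --> (0 : R).
Proof.
elim: n f A => [f A fc fB nA fA|n IH f A fc fB]; first by apply: fA => // -[].
rewrite iter_null_slices => nA fA.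
pose k m x := cube_mean (fun w => f m (consr x w)).
have kc m : continuous (k m) := cube_mean_slice_continuous (fc m).
have k0 m x : 0 <= k m x <= B.
  have sc := @consr_slice_continuous n _ x (fc m).
  apply/andP; split.
    rewrite -(cube_mean_cst n 0); apply: le_cube_mean => //.
      exact: fun_continuous_cst.
    by move=> w _; have /andP[] := fB m (consr x w).
  rewrite -(cube_mean_cst n B); apply: le_cube_mean => //.
    exact: fun_continuous_cst.
  by move=> w _; have /andP[] := fB m (consr x w).
have := @dominated_convergence _ _ R leb `[0, 1]%classic (measurable_itv _)
  (fun m x => (k m x)%:E) (cst 0%E) (cst B%:E).
case.
- move=> m; apply/measurable_EFinP; apply: measurable_funTS.
  exact: continuous_measurable_fun.
- exact: measurable_cst.
- apply: ae_imply nA => x nA /=; rewrite in_itv/= => x01.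
  apply: cvg_EFin; first by apply: nearW.
  apply: (IH (fun m w => f m (consr x w)) _ _ _ nA) => //.
  + by move=> m; exact: consr_slice_continuous.
  + by move=> w cw nAw; apply: fA => //; exact: cube_consr.
- exact: (@continuous_seg_integrable (fun=> B) 0 1 (@fun_continuous_cst _ B)).
- apply: aeW => x m _ /=; rewrite lee_fin.
  by have /andP[? ?] := k0 m x; rewrite ger0_norm.
- rewrite integral0 => _ _ cvgk.
  by apply: fine_cvg; exact: cvgk.
Qed.

End cube_mean.

(** * From almost everywhere derivatives to increments *)

Section directional.
Context {R : realType}.

(** Mean value inequality for a one-sided Dini derivative: it is enough to have, from
    every point and for every [e], a single step forward of slope at most [r + e].
    The supremum of the points where the chord estimate holds is attained by
    continuity and cannot be less than 1. *)
Lemma dini_le (k : R -> R) (r : R) : continuous k ->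
  (forall x, 0 <= x < 1 -> forall e, 0 < e ->
     exists h, [/\ 0 < h, x + h <= 1 & k (x + h) - k x <= (r + e) * h]) ->
  k 1 - k 0 <= r.
Proof.
move=> kc kh; apply/ler_addgt0Pr => e e0.
pose S : set R := [set x | 0 <= x <= 1 /\ k x - k 0 <= (r + e) * x].
have S0 : S 0 by split; rewrite ?lexx ?ler01// subrr mulr0.
have Sub : has_ubound S by exists 1 => x [/andP[]].
have hS : has_sup S by split => //; exists 0.
pose s := sup S.
have s01 : 0 <= s <= 1.
  apply/andP; split; first exact: ub_le_sup.
  by apply: ge_sup; [exists 0|move=> x [/andP[]]].
have Ss : S s.
  split => //; rewrite leNgt; apply/negP => ks.
  have gc : continuous (fun x => k x - k 0 - (r + e) * x).
    move=> x; apply: cvgB; last by apply: cvgM; [exact: cvg_cst|exact: cvg_id].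
    by apply: cvgB; [exact: kc|exact: cvg_cst].
  have : \forall x \near s, 0 < k x - k 0 - (r + e) * x.
    by apply: (cvgr_gt _ (gc s)); rewrite subr_gt0.
  case/nbhs_ballP => d /= d0 dP.
  have [x Sx sx] := sup_adherent d0 hS.
  have xs : x <= s by exact: ub_le_sup.
  have := dP x; rewrite /ball/= ger0_norm ?subr_ge0// => /(_ _).
  rewrite ltrBlDl -ltrBlDr => /(_ sx).
  by have [_] := Sx; lra.
have [s1|s1] := ltP s 1; last first.
  have [_] := Ss; have -> : s = 1 by apply/le_anti; rewrite s1 andbT; case/andP: s01.
  by rewrite mulr1 addrC.
have [/andP[s0 _] ks] := Ss.
have [h [h0 sh1 kh1]] := kh s (ltac:(by rewrite s0)) e e0.
have : s + h <= s.
  apply: ub_le_sup => //; split; first by rewrite sh1 andbT addr_ge0// ltW.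
  by rewrite mulrDr; lra.
by lra.
Qed.

Lemma cube_norm_le n (w : 'rV[R]_n) : cube w -> `|w| <= 1.
Proof.
move=> cw; rewrite [leLHS]/Num.norm/= mx_normrE; apply/bigmax_leP; split => // -[i j] _ /=.
by rewrite ord1; have /andP[w0 w1] := cw j; rewrite ger0_norm.
Qed.

Lemma coord_norm_le n (w : 'rV[R]_n) j : `|w 0 j| <= `|w|.
Proof.
rewrite [leRHS]/Num.norm/= mx_normrE.
by apply: le_trans (le_bigmax _ _ (ord0, j)).
Qed.

Lemma fun_continuous_sum (T : topologicalType) (I : Type) (s : seq I)
  (f : I -> T -> R) :
  (forall i, continuous (f i)) -> continuous (fun w => \sum_(i <- s) f i w).
Proof.
move=> fc; elim: s => [|i s IH].
  by under eq_fun do rewrite big_nil; exact: fun_continuous_cst.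
by under eq_fun do rewrite big_cons; apply: fun_continuousD.
Qed.

Lemma fun_continuous_affine (V : normedModType R) (f : V -> R) (y : V)
  (rho : R) : continuous f -> continuous (fun w => f (y + rho *: w)).
Proof.
move=> fc w; apply: (@continuous_comp _ _ _ (fun w => y + rho *: w) f).
  by apply: cvgD; [exact: cvg_cst|apply: cvgZl_tmp; exact: cvg_id].
exact: fc.
Qed.

Lemma cube_mean_sum n (I : Type) (s : seq I) (f : I -> 'rV[R]_n -> R) :
  (forall i, continuous (f i)) ->
  cube_mean (fun w => \sum_(i <- s) f i w) = \sum_(i <- s) cube_mean (f i).
Proof.
move=> fc; elim: s => [|i s IH].
  rewrite big_nil -[RHS](cube_mean_cst n); congr cube_mean.
  by apply/funext => w; rewrite big_nil.
rewrite big_cons -IH -cube_meanD//.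
  by congr cube_mean; apply/funext => w; rewrite big_cons.
by apply: fun_continuous_sum.
Qed.

Lemma lipschitz_along_sum n (f : 'rV[R]_n -> R) (s : seq 'rV[R]_n) (L : R) :
  (forall a, a \in s -> forall z t, `|f (z + t *: a) - f z| <= L * `|t|) ->
  forall z t, `|f (z + t *: \sum_(a <- s) a) - f z| <= (size s)%:R * L * `|t|.
Proof.
elim: s => [_ z t|a s IH fL z t].
  by rewrite big_nil scaler0 addr0 subrr normr0 !mul0r.
rewrite big_cons scalerDr [t *: a + _]addrC addrA.
apply: le_trans (ler_distD (f (z + t *: \sum_(b <- s) b)) _ _) _.
have -> : (size (a :: s))%:R * L * `|t| = L * `|t| + (size s)%:R * L * `|t|.
  by rewrite /= -natr1; ring.
apply: lerD.
  by apply: fL; rewrite mem_head.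
by apply: IH => b bs; apply: fL; rewrite in_cons bs orbT.
Qed.

(** The increment of the mean of [f] along the sum of the steps splits into increments
    along the single steps, all issued from the same point: moving the base point
    of the increment along [a] by [h] times the other steps costs a shift of the
    cube by [O(h)], and the increment is itself [O(h)]. *)
Lemma cube_mean_telescope n (f : 'rV[R]_n -> R) (s : seq 'rV[R]_n) (L rho : R) :
  0 < rho -> continuous f ->
  (forall a, a \in s -> forall z t, `|f (z + t *: a) - f z| <= L * `|t|) ->
  exists C, forall y h, 0 < h ->
    cube_mean (fun w => f (y + h *: (\sum_(a <- s) a) + rho *: w))
      - cube_mean (fun w => f (y + rho *: w)) <=
    \sum_(a <- s) cube_mean (fun w => f (y + rho *: w + h *: a)
                                      - f (y + rho *: w)) + C * h ^+ 2.
Proof.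
move=> rho0 fc; elim: s => [_|a s IH fL].
  by exists 0 => y h h0; rewrite !big_nil scaler0 addr0 subrr mul0r addr0.
have [|C CP] := IH; first by move=> b bs; apply: fL; rewrite in_cons bs orbT.
pose v := \sum_(a <- s) a.
pose C' := 2 * L * \sum_j `|(rho^-1 *: v) 0 j|.
exists (C' + C) => y h h0; rewrite !big_cons.
pose g (w : 'rV[R]_n) := f (y + rho *: w + h *: a) - f (y + rho *: w).
have gc1 : continuous (fun w : 'rV[R]_n => f (y + rho *: w + h *: a)).
  have := @fun_continuous_affine _ f (y + h *: a) rho fc.
  by under eq_fun do rewrite addrAC.
have gc2 : continuous (fun w : 'rV[R]_n => f (y + rho *: w)).
  exact: fun_continuous_affine.
have gc : continuous g.
  exact: fun_continuousB.
have gB w : `|g w| <= L * h.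
  by have := fL a (mem_head _ _) (y + rho *: w) h; rewrite (gtr0_norm h0).
have := cube_mean_shift (h *: (rho^-1 *: v)) gc gB.
have -> : \sum_j `|(h *: (rho^-1 *: v)) 0 j| = h * \sum_j `|(rho^-1 *: v) 0 j|.
  by rewrite mulr_sumr; apply: eq_bigr => j _; rewrite [in LHS]mxE normrM gtr0_norm.
have -> : (fun w => g (w + h *: (rho^-1 *: v))) =
    (fun w => f (y + h *: (a + v) + rho *: w) - f (y + h *: v + rho *: w)).
  apply/funext => w; rewrite /g scalerDr.
  have -> : rho *: (h *: (rho^-1 *: v)) = h *: v.
    by rewrite !scalerA; congr (_ *: _); field; rewrite gt_eqF.
  rewrite scalerDr; congr (f _ - f _); last by rewrite addrA addrAC.
  by apply/rowP => j; rewrite !mxE; ring.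
have sc1 := @fun_continuous_affine _ f (y + h *: (a + v)) rho fc.
have sc2 := @fun_continuous_affine _ f (y + h *: v) rho fc.
rewrite (_ : cube_mean (fun w => f (y + h *: (a + v) + rho *: w)
                                 - f (y + h *: v + rho *: w)) =
    cube_mean (fun w => f (y + h *: (a + v) + rho *: w)) -
    cube_mean (fun w => f (y + h *: v + rho *: w))); last exact: cube_meanB.
rewrite ler_norml => /andP[_ le1].
have := CP y h h0; rewrite -/v -/g.
have -> : (C' + C) * h ^+ 2 = C * h ^+ 2 + 2 * (L * h) * (h * \sum_j `|(rho^-1 *: v) 0 j|).
  by rewrite /C'; ring.
by lra.
Qed.

Lemma cube_mean_near n (f : 'rV[R]_n -> R) (z : 'rV[R]_n) (e : R) : 0 < e ->
  continuous f ->
  exists2 d, 0 < d & forall rho, 0 < rho < d ->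
    `|cube_mean (fun w => f (z + rho *: w)) - f z| <= e.
Proof.
move=> e0 fc.
have /nbhs_ballP[d /= d0 dP] : \forall y \near z, `|f z - f y| < e.
  exact: (@cvgr_dist_lt _ _ _ (nbhs z) _ f (f z) (fc z) e e0).
exists d => // rho /andP[rho0 rhod].
rewrite -[X in _ - X](cube_mean_cst n); apply: cube_mean_dist.
- exact: fun_continuous_affine.
- exact: fun_continuous_cst.
- move=> w cw; rewrite distrC ltW//; apply: dP.
  rewrite -ball_normE /= opprD addrA subrr sub0r normrN normrZ gtr0_norm//.
  by apply: le_lt_trans rhod; rewrite ler_piMr ?cube_norm_le// ltW.
Qed.

(** A bound on the increment of [f] along [v], the sum of the steps [a] in [s], from
    a bound on the sum of the derivatives of [f] along the steps that holds only
    outside a null set. A segment may lie entirely in the null set, so [f] is first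
    averaged over cubes of side [rho]: by dominated convergence the mean [k] has
    Dini derivative at most [r] along [v], [dini_le] integrates this, and [rho]
    tends to 0. The steps are kept separate because the hypotheses that are applied
    later provide partial derivatives and not a differential. *)
Lemma ae_directional_bound n (f : 'rV[R]_n -> R) (s : seq 'rV[R]_n)
    (L r d : R) (A : set 'rV[R]_n) (z1 : 'rV[R]_n) :
  continuous f ->
  (forall a, a \in s -> forall z t, `|f (z + t *: a) - f z| <= L * `|t|) ->
  affine_null A -> 0 < d ->
  (forall z, ball z1 d z -> ~ A z -> forall e, 0 < e -> \forall m \near \oo,
    \sum_(a <- s) m.+1%:R * (f (z + m.+1%:R^-1 *: a) - f z) <= r + e) ->
  forall z, (forall x, 0 <= x <= 1 ->
              ball z1 (d / 2) (z + x *: \sum_(a <- s) a)) ->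
  f (z + \sum_(a <- s) a) - f z <= r.
Proof.
move=> fc fL nA d0 dirA z zv; set v := \sum_(a <- s) a.
have sL0 : 0 <= (size s)%:R * L.
  have := lipschitz_along_sum fL 0 1; rewrite normr1 mulr1.
  by apply: le_trans.
suff mollified rho : 0 < rho < d / 2 ->
    cube_mean (fun w => f (z + v + rho *: w)) -
    cube_mean (fun w => f (z + rho *: w)) <= r.
  apply/ler_addgt0Pr => e e0.
  have e20 : 0 < e / 2 by rewrite divr_gt0.
  have [d1 d10 d1P] := cube_mean_near (z + v) e20 fc.
  have [d2 d20 d2P] := cube_mean_near z e20 fc.
  pose rho := Num.min (d / 2) (Num.min d1 d2) / 2.
  have m0 : 0 < Num.min (d / 2) (Num.min d1 d2).
    by rewrite !lt_min d10 d20 divr_gt0.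
  have [rho0 rhom] : 0 < rho /\ rho < Num.min (d / 2) (Num.min d1 d2).
    by rewrite /rho; split; lra.
  move: rhom; rewrite !lt_min => /and3P[rd rd1 rd2].
  have := mollified rho; rewrite rho0 rd => /(_ isT).
  have := d1P rho; rewrite rho0 rd1 => /(_ isT); rewrite ler_norml => /andP[].
  have := d2P rho; rewrite rho0 rd2 => /(_ isT); rewrite ler_norml => /andP[].
  by lra.
move=> /andP[rho0 rhod].
pose F y := cube_mean (fun w => f (y + rho *: w)).
pose k x := F (z + x *: v).
have kL x y : `|k x - k y| <= (size s)%:R * L * `|x - y|.
  apply: cube_mean_dist; try exact: fun_continuous_affine.
  move=> w _; have := lipschitz_along_sum fL (z + y *: v + rho *: w) (x - y).
  congr (`| f _ - _| <= _).
  by rewrite -/v scalerBl; apply/rowP => j; rewrite !mxE; ring.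
have kc : continuous k.
  move=> x; apply/cvgrPdist_lt => e e0; apply/nbhs_ballP.
  exists (e / ((size s)%:R * L + 1)) => /=; first by rewrite divr_gt0// ltr_wpDl.
  move=> y yx; have xy : `|x - y| < e / ((size s)%:R * L + 1) := yx.
  rewrite ltr_pdivlMr ?ltr_wpDl// in xy.
  apply: le_lt_trans (kL x y) _; apply: le_lt_trans xy.
  by rewrite mulrC ler_wpM2l// lerDl.
have -> : cube_mean (fun w => f (z + v + rho *: w)) = k 1.
  by rewrite /k /F scale1r.
have -> : cube_mean (fun w => f (z + rho *: w)) = k 0.
  by rewrite /k /F scale0r addr0.
apply: dini_le => // x /andP[x0 x1] e e0.
have [C CP] := cube_mean_telescope rho0 fc fL.
pose y := z + x *: v.
pose q m w : R := \sum_(a <- s)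
  (m.+1%:R * (f (y + rho *: w + m.+1%:R^-1 *: a) - f (y + rho *: w))).
pose fm m w := Num.max 0 (q m w - r).
have cf1 m a : continuous (fun w : 'rV[R]_n => f (y + rho *: w + m.+1%:R^-1 *: a)).
  have := @fun_continuous_affine _ f (y + m.+1%:R^-1 *: a) rho fc.
  by under eq_fun do rewrite addrAC.
have cf2 : continuous (fun w : 'rV[R]_n => f (y + rho *: w)).
  exact: fun_continuous_affine.
have qc m : continuous (q m).
  by apply: fun_continuous_sum => a; apply: fun_continuousZ; exact: fun_continuousB.
have fmc m : continuous (fm m).
  apply: fun_continuous_max; first exact: fun_continuous_cst.
  by apply: fun_continuousB => //; exact: fun_continuous_cst.
have hm0 m : 0 < m.+1%:R^-1 :> R by rewrite invr_gt0.
have qB m w : q m w <= (size s)%:R * L.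
  apply: (@le_trans _ _ (\sum_(a <- s) L)); last first.
    by rewrite big_const_seq count_predT iter_addr_0 mulr_natl.
  rewrite /q big_seq [leRHS]big_seq; apply: ler_sum => a sa.
  have := fL a sa (y + rho *: w) m.+1%:R^-1; rewrite (gtr0_norm (hm0 m)).
  move=> /(le_trans (ler_norm _)) fLa.
  rewrite -(ler_pM2l (hm0 m)) mulrA mulVf ?pnatr_eq0// mul1r.
  by rewrite [leRHS]mulrC.
have fmB m w : 0 <= fm m w <= (size s)%:R * L + `|r|.
  rewrite /fm le_max lexx /= ge_max addr_ge0//=.
  by apply: lerD (qB m w) _; rewrite -normrN ler_norm.
have fm0 : cube_mean (fm m) @[m --> \oo] --> (0 : R).
  apply: (@cube_mean_cvg0 _ n fm _ [set w | A (y + rho *: w)]) => //.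
  - exact: nA.
  - move=> w cw nAw; apply/cvgrPdist_le => e' e'0.
    have yB : ball z1 d (y + rho *: w).
      apply: (@ball_split _ _ y) => //.
        by apply: zv; rewrite x0 ltW.
      rewrite -ball_normE /= opprD addrA subrr sub0r normrN normrZ gtr0_norm//.
      by apply: le_lt_trans rhod; rewrite ler_piMr ?cube_norm_le// ltW.
    have := dirA _ yB nAw _ e'0; apply: filterS => m mP.
    have /andP[f0 _] := fmB m w.
    by rewrite sub0r normrN ger0_norm// /fm ge_max ltW//= lerBlDl.
have e20 : 0 < e / 2 by rewrite divr_gt0.
have near1 : \forall m \near \oo, cube_mean (fm m) < e / 2.
  by apply: (cvgr_lt _ fm0).
have C10 : 0 < e / 2 / (`|C| + 1) by rewrite divr_gt0// ltr_wpDl.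
have near2 := near_infty_natSinv_lt (PosNum C10).
have x10 : 0 < 1 - x by rewrite subr_gt0.
have near3 := near_infty_natSinv_lt (PosNum x10).
have [m [m1 m2 m3]] : exists m : nat, [/\ cube_mean (fm m) < e / 2,
    m.+1%:R^-1 < e / 2 / (`|C| + 1) & m.+1%:R^-1 < 1 - x].
  have : \forall m \near \oo, [/\ cube_mean (fm m) < e / 2,
    m.+1%:R^-1 < e / 2 / (`|C| + 1) & m.+1%:R^-1 < 1 - x].
    by near=> m; split; near: m.
  by case=> m _ /(_ m (leqnn m)) ?; exists m.
set h := m.+1%:R^-1 in m2 m3 *.
have h0 : 0 < h := hm0 m.
exists h; split => //; first by lra.
have -> : k (x + h) = cube_mean (fun w => f (y + h *: v + rho *: w)).
  by rewrite /k /F /y scalerDl addrA.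
have := CP y h h0; rewrite -/v.
have -> : \sum_(a <- s) cube_mean (fun w => f (y + rho *: w + h *: a)
    - f (y + rho *: w)) = h * cube_mean (q m).
  rewrite /q cube_mean_sum; last first.
    by move=> a; apply: fun_continuousZ; exact: fun_continuousB.
  rewrite mulr_sumr; apply: eq_bigr => a _.
  have cfB : continuous (fun w : 'rV[R]_n => f (y + rho *: w + h *: a) - f (y + rho *: w)).
    exact: (fun_continuousB (cf1 m a) cf2).
  have := cube_meanZ m.+1%:R cfB; rewrite /= => ->.
  by rewrite mulrA mulVf ?mul1r// pnatr_eq0.
have qr : cube_mean (q m) <= r + cube_mean (fm m).
  rewrite -[X in X + _](cube_mean_cst n) -cube_meanD//; last first.
    exact: fun_continuous_cst.
  apply: le_cube_mean => //.
    by apply: fun_continuousD => //; exact: fun_continuous_cst.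
  by move=> w _; rewrite /fm -lerBlDl le_max lexx orbT.
have Ch : C * h <= e / 2.
  rewrite ltr_pdivlMr ?ltr_wpDl// in m2; apply: le_trans (ltW m2).
  rewrite mulrC; apply: ler_wpM2l; first exact: ltW.
  by apply: le_trans (ler_norm _) _; rewrite lerDl.
have : h * cube_mean (q m) + C * h ^+ 2 <= (r + e) * h.
  rewrite expr2 mulrA [h * _]mulrC -mulrDl ler_wpM2r// ?ltW//.
  by move: qr m1 Ch; lra.
move=> le1 le2; exact: le_trans le2 le1.
Unshelve. all: by end_near.
Qed.

End directional.

(** * Euclidean norm *)

Section euclidean_geometry.
Context {R : realType} {N : nat}.
Implicit Types a b c : 'rV[R]_N.

Lemma dotvC a b : dotv a b = dotv b a.
Proof. by apply: eq_bigr => j _; rewrite mulrC. Qed.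

Lemma dotvDl a b c : dotv (a + b) c = dotv a c + dotv b c.
Proof. by rewrite /dotv -big_split; apply: eq_bigr => j _; rewrite mxE mulrDl. Qed.

Lemma dotvDr a b c : dotv a (b + c) = dotv a b + dotv a c.
Proof. by rewrite dotvC dotvDl !(dotvC a). Qed.

Lemma dotvZl k a b : dotv (k *: a) b = k * dotv a b.
Proof. by rewrite /dotv mulr_sumr; apply: eq_bigr => j _; rewrite mxE mulrA. Qed.

Lemma dotvZr k a b : dotv a (k *: b) = k * dotv a b.
Proof. by rewrite dotvC dotvZl dotvC. Qed.

Lemma dotvNl a b : dotv (- a) b = - dotv a b.
Proof. by rewrite -scaleN1r dotvZl mulN1r. Qed.

Lemma dotvNr a b : dotv a (- b) = - dotv a b.
Proof. by rewrite dotvC dotvNl dotvC. Qed.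

Lemma dotvBl a b c : dotv (a - b) c = dotv a c - dotv b c.
Proof. by rewrite dotvDl dotvNl. Qed.

Lemma dotvBr a b c : dotv a (b - c) = dotv a b - dotv a c.
Proof. by rewrite dotvDr dotvNr. Qed.

Lemma dot0v a : dotv 0 a = 0.
Proof. by rewrite -(scale0r a) dotvZl mul0r. Qed.

Lemma dotv0 a : dotv a 0 = 0.
Proof. by rewrite dotvC dot0v. Qed.

Definition dotvE := (dotvDl, dotvDr, dotvBl, dotvBr, dotvZl, dotvZr, dotvNl, dotvNr,
  dot0v, dotv0).

Lemma dotv_ge0 a : 0 <= dotv a a.
Proof. by apply: sumr_ge0 => j _; rewrite -expr2 sqr_ge0. Qed.

Lemma enorm_ge0 a : 0 <= enorm a.
Proof. exact: sqrtr_ge0. Qed.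

Lemma sqr_enorm a : enorm a ^+ 2 = dotv a a.
Proof. by rewrite sqr_sqrtr// dotv_ge0. Qed.

Lemma dotv_eq0 a : dotv a a = 0 -> a = 0.
Proof.
move=> /eqP; rewrite psumr_eq0; last by move=> j _; rewrite -expr2 sqr_ge0.
by move=> /allP a0; apply/rowP => j; apply/eqP; have := a0 j (mem_index_enum _);
  rewrite mxE -expr2 sqrf_eq0.
Qed.

Lemma cauchy_schwarz a b : `|dotv a b| <= enorm a * enorm b.
Proof.
rewrite -ler_sqr ?nnegrE ?mulr_ge0 ?enorm_ge0// exprMn !sqr_enorm real_normK ?num_real//.
have [/dotv_eq0 ->|b0] := eqVneq (dotv b b) 0; first by rewrite !dotv0 expr2 !mulr0.
have bb0 : 0 < dotv b b by rewrite lt_neqAle eq_sym b0 dotv_ge0.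
have := dotv_ge0 (dotv b b *: a - dotv a b *: b).
have -> : dotv (dotv b b *: a - dotv a b *: b) (dotv b b *: a - dotv a b *: b) =
    dotv b b * (dotv a a * dotv b b - dotv a b ^+ 2).
  by rewrite !dotvE (dotvC b a); ring.
by rewrite pmulr_rge0// subr_ge0.
Qed.

Lemma dotv_le a b : dotv a b <= enorm a * enorm b.
Proof. exact: le_trans (ler_norm _) (cauchy_schwarz _ _). Qed.

Lemma enormD a b : enorm (a + b) <= enorm a + enorm b.
Proof.
rewrite -ler_sqr ?nnegrE ?addr_ge0 ?enorm_ge0// sqr_enorm sqrrD !sqr_enorm.
by rewrite !dotvE (dotvC b a); have := dotv_le a b; lra.
Qed.

Lemma enormZ k a : enorm (k *: a) = `|k| * enorm a.
Proof. by rewrite /enorm dotvZl dotvZr mulrA -expr2 sqrtrM ?sqr_ge0// sqrtr_sqr. Qed.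

Lemma enormN a : enorm (- a) = enorm a.
Proof. by rewrite -scaleN1r enormZ normrN1 mul1r. Qed.

Lemma enorm0 : enorm (0 : 'rV[R]_N) = 0.
Proof. by rewrite /enorm dot0v sqrtr0. Qed.

Lemma coord_le_enorm a j : `|a 0 j| <= enorm a.
Proof.
rewrite -ler_sqr ?nnegrE ?enorm_ge0// sqr_enorm real_normK ?num_real//.
rewrite /dotv (bigD1 j)//= -expr2 lerDl sumr_ge0// => i _.
by rewrite -expr2 sqr_ge0.
Qed.

Lemma norm_le_enorm a : `|a| <= enorm a.
Proof.
rewrite [leLHS]/Num.norm/= mx_normrE; apply/bigmax_leP; split; first exact: enorm_ge0.
by move=> [i j] _ /=; rewrite ord1 coord_le_enorm.
Qed.

Lemma dotv_le_norm a : dotv a a <= N%:R * `|a| ^+ 2.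
Proof.
apply: (@le_trans _ _ (\sum_(j < N) `|a| ^+ 2)).
  apply: ler_sum => j _; rewrite -expr2 -real_normK ?num_real//.
  by rewrite lerXn2r ?nnegrE// coord_norm_le.
by rewrite sumr_const card_ord mulr_natl.
Qed.

Lemma enorm_le_norm a : enorm a <= N%:R * `|a|.
Proof.
have N0 : 0 <= N%:R * `|a| by rewrite mulr_ge0.
rewrite -ler_sqr ?nnegrE ?enorm_ge0// sqr_enorm exprMn.
apply: le_trans (dotv_le_norm a) _; rewrite ler_wpM2r ?sqr_ge0//.
by case: N => [|n]; rewrite expr2 ?mulr0// ler_peMl// ler1n.
Qed.

Lemma enorm_continuous : continuous (@enorm R N).
Proof.
move=> a; apply/(@cvgrPdist_lt _ _ _ (nbhs a)) => e e0; apply/nbhs_ballP.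
have N1 : 0 < N%:R + 1 :> R by rewrite ltr_wpDl.
exists (e / (N%:R + 1)) => /=; first by rewrite divr_gt0.
move=> b; rewrite -ball_normE /= ltr_pdivlMr// => ab.
apply: (@le_lt_trans _ _ (enorm (a - b))).
  have h1 := enormD (a - b) b; have h2 := enormD (b - a) a.
  rewrite !subrK -(opprB a b) enormN in h1 h2.
  by rewrite ler_norml; apply/andP; split; lra.
apply: le_lt_trans (enorm_le_norm _) _; apply: le_lt_trans ab.
by rewrite mulrDr mulr1 mulrC lerDl.
Qed.

End euclidean_geometry.

(** * Coordinates on the phase space *)

(** If [psi r = s] then [r = 2 * s + phi (2 * s) >= 2 * s]. *)
Lemma psi_le_half (R : realType) (phi : R -> R) (c0 r : R) :
  {in `[c0, +oo[ &, {homo phi : s t / s < t}} ->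
  (forall s, c0 <= s -> 0 <= phi s) -> 0 <= c0 ->
  psi_inv phi c0 < r -> psi c0 phi r <= r / 2.
Proof.
move=> phim phi0 c00 rc; rewrite /psi gt_eqF// /psi_open.
have inj : {in `]c0, +oo[%classic &, injective (psi_inv phi)}.
  move=> s t; rewrite !inE/= !in_itv/= !andbT => cs ct st.
  have mono s' t' : c0 < s' -> s' < t' -> psi_inv phi s' < psi_inv phi t'.
    move=> cs' st'; rewrite /psi_inv.
    have : phi (2 * s') < phi (2 * t').
      by apply: phim; rewrite ?in_itv/= ?andbT; lra.
    lra.
  by have [/mono|/mono|//] := ltgtP s t; rewrite st ltxx => /(_ _)/=; first [by move=> /(_ cs)|by move=> /(_ ct)].
have [[s cs sr]|nr] := pselect ((psi_inv phi @` `]c0, +oo[%classic) r).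
  rewrite -sr pinvKV//; last by rewrite inE.
  rewrite /= in_itv/= andbT in cs.
  have : 0 <= phi (2 * s) by apply: phi0; lra.
  rewrite /psi_inv; lra.
(* Outside the range of [psi_inv] the pseudo-inverse takes its default value 0. *)
have -> : 'pinv_(fun=> 0) `]c0, +oo[ (psi_inv phi) r = 0.
  rewrite /= /pinv_ splitV /=; rewrite (_ : 'oinv_[fun psi_inv phi in `]c0, +oo[] r = None)//.
  by rewrite oinv_surj; case: pselect.
have : 0 <= phi (2 * c0) by apply: phi0; lra.
by move: rc; rewrite /psi_inv; lra.
Qed.
(** The difference quotients along [1 / (m + 1)], with the step scaled by [c], tend to
    [c] times the derivative; this is how pointwise partial derivatives enter
    [ae_directional_bound]. *)
Lemma derive_seq (R : realType) (V : normedModType R) (g : V -> R) (x v : V) (c : R) :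
  derivable g x v ->
  m.+1%:R * (g (x + m.+1%:R^-1 *: (c *: v)) - g x) @[m --> \oo] --> c * 'D_v g x.
Proof.
move=> gd.
have [->|c0] := eqVneq c 0.
  rewrite mul0r; under eq_fun do rewrite scale0r scaler0 addr0 subrr mulr0.
  exact: cvg_cst.
have hm0 : m.+1%:R^-1 * c @[m --> \oo] --> (0 : R).
  rewrite -[X in _ --> X](mul0r c); apply: cvgMl.
  exact: cvg_harmonic.
have hm : m.+1%:R^-1 * c @[m --> \oo] --> (0 : R)^'.
  move=> A [e /= e0 eA].
  have : \forall m \near \oo, ball (0 : R) e (m.+1%:R^-1 * c).
    by apply: (cvg_ball hm0).
  apply: filterS => m mB; apply: eA => //.
  by rewrite mulf_neq0// invr_neq0.
have := cvg_comp _ _ hm gd.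
move=> /(cvgM (cvg_cst c)) h.
apply: cvg_trans h; apply: near_eq_cvg; apply: nearW => m /=.
rewrite /= (addrC _ x) scalerA.
rewrite [_ *: (g _ - g _)]/GRing.scale/= mulrA invfM invrK (mulrC m.+1%:R).
by rewrite mulrA divff// mul1r.
Qed.

Section phase_space.
Context {R : realType} {N : nat}.
Local Notation phase := ('rV[R]_N * R * 'rV[R]_N)%type.
Local Notation dim := (N + (1 + N))%N.

(** Null sets of the phase space are defined through [flat]; the analysis is carried
    out on flat rows and transported back by this inverse. *)
Definition unflat (w : 'rV[R]_dim) : phase :=
  ((lsubmx w, (lsubmx (rsubmx w)) 0 0), rsubmx (rsubmx w)).

Lemma flatK : cancel (@flat R N) unflat.
Proof.
move=> [[x t] p]; rewrite /unflat /flat /= row_mxKl !row_mxKr row_mxKl.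
by rewrite mxE eqxx mulr1n.
Qed.

Lemma unflatK : cancel unflat (@flat R N).
Proof.
move=> w; rewrite /unflat /flat /=; rewrite -[RHS]hsubmxK; congr row_mx.
rewrite -[RHS]hsubmxK; congr row_mx.
by apply/rowP => j; rewrite !ord1 [LHS]mxE eqxx mulr1n.
Qed.

Lemma unflat_continuous : continuous unflat.
Proof.
have cc (i : 'I_dim) (w : 'rV[R]_dim) : v 0 i @[v --> w] --> w 0 i.
  exact: coord_continuous.
have cx : continuous (fun w : 'rV[R]_dim => lsubmx w : 'rV[R]_N).
  move=> w; apply: (@rv_cvg _ _ (nbhs w)) => j.
  by under eq_fun do rewrite mxE; rewrite mxE; exact: cc.
have cp : continuous (fun w : 'rV[R]_dim => rsubmx (rsubmx w) : 'rV[R]_N).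
  move=> w; apply: (@rv_cvg _ _ (nbhs w)) => j.
  by under eq_fun do rewrite !mxE; rewrite !mxE; exact: cc.
have ct : continuous (fun w : 'rV[R]_dim => (lsubmx (rsubmx w) : 'rV[R]_1) 0 0).
  move=> w; rewrite /continuous_at !mxE.
  by under eq_fun do rewrite !mxE; exact: cc.
by move=> w; exact: (cvg_pair (cvg_pair (cx w) (ct w)) (cp w)).
Qed.

Lemma unflat_ball (z : phase) e w : ball (flat z) e w -> ball z e (unflat w).
Proof.
case: z => [[x t] p] [e0 wP]; split; first split.
- split => // i j; rewrite !ord1; have := wP ord0 (lshift _ j).
  by rewrite /flat /= row_mxEl mxE.
- have := wP ord0 (rshift _ (lshift _ ord0)).
  by rewrite /flat /= row_mxEr row_mxEl !mxE eqxx mulr1n.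
- split => // i j; rewrite !ord1; have := wP ord0 (rshift _ (rshift _ j)).
  by rewrite /flat /= !row_mxEr !mxE.
Qed.

Definition time_index : 'I_dim := rshift N (lshift N ord0).
Definition momentum_index (j : 'I_N) : 'I_dim := rshift N (rshift 1 j).

Lemma unflat_time w (s : R) : unflat (w + s *: delta_mx 0 time_index) =
  (((unflat w).1.1, (unflat w).1.2 + s), (unflat w).2).
Proof.
rewrite /unflat /=; congr (_, _, _).
- by apply/rowP => j; rewrite !mxE /= eq_lrshift mulr0 addr0.
- by rewrite !mxE /= eqxx mulr1.
- by apply/rowP => j; rewrite !mxE /= !eq_shift mulr0 addr0.
Qed.

Lemma unflat_momentum w (s : R) j :
  unflat (w + s *: delta_mx 0 (momentum_index j)) =
  ((unflat w).1, (unflat w).2 + s *: delta_mx 0 j).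
Proof.
rewrite /unflat /=; congr (_, _, _).
- by apply/rowP => i; rewrite !mxE /= eq_lrshift mulr0 addr0.
- by rewrite !mxE /= !eq_shift mulr0 addr0.
- by apply/rowP => i; rewrite !mxE /= !eq_shift.
Qed.

End phase_space.

Lemma clampr_dist (R : realType) (a b d : R) : 0 <= d ->
  `|a - Num.max (a - d) (Num.min (a + d) b)| <= d.
Proof.
move=> d0; rewrite ler_norml.
by case: (leP (a + d) b) => h1;
  [case: (leP (a - d) (a + d))|case: (leP (a - d) b)] => h2;
  apply/andP; split; lra.
Qed.

Lemma clampr_lipschitz (R : realType) (a b b' d : R) : 0 <= d ->
  `|Num.max (a - d) (Num.min (a + d) b) - Num.max (a - d) (Num.min (a + d) b')|
    <= `|b - b'|.
Proof.
move=> d0.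
wlog bb' : b b' / b' <= b.
  move=> h; case: (leP b' b) => [|/ltW] bb'; first exact: h.
  by rewrite distrC (distrC b); exact: h.
rewrite (ger0_norm (_ : 0 <= b - b')) ?subr_ge0// ler_norml.
case: (leP (a + d) b) => h1;
  [case: (leP (a - d) (a + d))|case: (leP (a - d) b)] => h2;
  case: (leP (a + d) b') => h3;
  [case: (leP (a - d) (a + d))|case: (leP (a - d) b')|
   case: (leP (a - d) (a + d))|case: (leP (a - d) b')|
   case: (leP (a - d) (a + d))|case: (leP (a - d) b')|
   case: (leP (a - d) (a + d))|case: (leP (a - d) b')] => h4;
  apply/andP; split; lra.
Qed.

Section clamping.
Context {R : realType} {n : nat}.
Variables (c : 'rV[R]_n) (d : R).

(** The nearest point of the cube with centre [c] and half side [d]. Composing with it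
    extends a function known near [c] to a function with the same continuity and
    coordinatewise Lipschitz bounds on the whole space. *)
Definition clamp (w : 'rV[R]_n) : 'rV[R]_n :=
  \row_j Num.max (c 0 j - d) (Num.min (c 0 j + d) (w 0 j)).

Lemma clamp_continuous : continuous clamp.
Proof.
have cj j : continuous (fun w : 'rV[R]_n =>
    Num.max (c 0 j - d) (Num.min (c 0 j + d) (w 0 j))).
  apply: fun_continuous_max; first exact: fun_continuous_cst.
  apply: fun_continuous_min; first exact: fun_continuous_cst.
  by move=> w; exact: coord_continuous.
move=> w; apply: (@rv_cvg _ _ (nbhs w)) => j.
by under eq_fun do rewrite mxE; rewrite mxE; exact: (cj j w).
Qed.

Lemma clamp_ball e w : 0 <= d -> d < e -> ball c e (clamp w).
Proof.
move=> d0 de; split; first exact: le_lt_trans de.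
move=> i j; rewrite ord1 mxE -ball_normE /=; apply: le_lt_trans de.
exact: clampr_dist.
Qed.

Lemma clamp_id w : ball c d w -> clamp w = w.
Proof.
move=> [d0 wP]; apply/rowP => j; rewrite mxE; have := wP ord0 j.
rewrite -ball_normE /= ltr_norml => /andP[h1 h2].
by rewrite min_r ?max_r//; lra.
Qed.

Lemma clamp_delta w (s : R) i : 0 <= d -> exists2 s', `|s'| <= `|s| &
  clamp (w + s *: delta_mx 0 i) = clamp w + s' *: delta_mx 0 i.
Proof.
move=> d0; exists (clamp (w + s *: delta_mx 0 i) 0 i - clamp w 0 i).
  rewrite !mxE !eqxx mulr1; apply: le_trans (clampr_lipschitz _ _ _ d0) _.
  by rewrite le_eqVlt; apply/orP; left; apply/eqP; congr (`|_|); ring.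
apply/rowP => j; rewrite !mxE; have [->|ji] := eqVneq j i.
  by rewrite !eqxx /= !mulr1; ring.
by rewrite /= !mulr0 !addr0.
Qed.

End clamping.

(** * Regularity of the data *)

Section regularity.
Context {R : realType} {N : nat}.
Local Notation phase := ('rV[R]_N * R * 'rV[R]_N)%type.

Lemma open_lt_ereal (T : \bar R) : open [set t : R | (t%:E < T)%E].
Proof.
case: T => [r| |].
- rewrite (_ : mkset _ = [set t | t < r]); first exact: open_lt.
  by apply/seteqP; split => t; rewrite /= lte_fin.
- rewrite (_ : mkset _ = setT); first exact: openT.
  by apply/seteqP; split => t //= _; rewrite ltry.
- rewrite (_ : mkset _ = set0); first exact: open0.
  by apply/seteqP; split => t.
Qed.

Lemma open_time_slab (T : \bar R) :
  open [set z : phase | 0 < z.1.2 /\ (z.1.2%:E < T)%E].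
Proof.
have ct : continuous (fun z : phase => z.1.2).
  by move=> z; apply: (@continuous_comp _ _ _ fst snd); [exact: cvg_fst|exact: cvg_snd].
rewrite (_ : mkset _ = (fun z : phase => z.1.2) @^-1` [set t | 0 < t] `&`
   (fun z : phase => z.1.2) @^-1` [set t | (t%:E < T)%E])//.
apply: openI; (apply: open_comp; first by move=> *; exact: ct).
  exact: open_gt.
exact: open_lt_ereal.
Qed.

Lemma hamiltonian_continuous (T : \bar R) (H : 'rV[R]_N -> R -> 'rV[R]_N -> R)
    (z : phase) :
  {within dom_H T, continuous (fun z : phase => H z.1.1 z.1.2 z.2)} ->
  0 < z.1.2 -> (z.1.2%:E < T)%E ->
  {for z, continuous (fun z : phase => H z.1.1 z.1.2 z.2)}.
Proof.
move=> Hc z0 zT.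
have sub : [set z : phase | 0 < z.1.2 /\ (z.1.2%:E < T)%E] `<=` dom_H T.
  by move=> y [y0 yT]; split; exact: ltW.
have := continuous_subspaceW sub Hc.
rewrite continuous_open_subspace; last exact: open_time_slab.
by apply; rewrite inE.
Qed.

Lemma phi_continuous_at (phi : R -> R) (c0 s : R) :
  {within `[c0, +oo[, continuous phi} -> c0 < s -> {for s, continuous phi}.
Proof.
move=> phic cs.
have sub : `]c0, +oo[%classic `<=` `[c0, +oo[%classic.
  by move=> y /=; rewrite !in_itv/= !andbT => /ltW.
have := continuous_subspaceW sub phic.
rewrite continuous_open_subspace; last exact: interval_open.
by apply; rewrite inE/= in_itv/= cs.
Qed.

Lemma sum_cvg (I : Type) (s : seq I) (u : I -> nat -> R) (l : I -> R) :
  (forall i, u i m @[m --> \oo] --> l i) ->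
  \sum_(i <- s) u i m @[m --> \oo] --> \sum_(i <- s) l i.
Proof.
move=> ul; elim: s => [|i s IH].
  by under eq_fun do rewrite big_nil; rewrite big_nil; exact: cvg_cst.
by under eq_fun do rewrite big_cons; rewrite big_cons; exact: cvgD.
Qed.

(** The increment [(0, a, q)] as a sum of multiples of coordinate vectors, the
    decomposition into steps required by [ae_directional_bound]. *)
Lemma flat_direction (a : R) (q : 'rV[R]_N) :
  flat (0, a, q) = a *: delta_mx 0 time_index +
    \sum_j q 0 j *: delta_mx 0 (momentum_index j).
Proof.
apply/rowP => i; rewrite [RHS]mxE summxE.
under eq_bigr do rewrite !mxE eqxx eq_sym.
rewrite !mxE eqxx /=; case: split_ordP => k ->.
  rewrite /time_index /momentum_index eq_lrshift mulr0 add0r.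
  by rewrite big1 ?mxE// => j _; rewrite eq_rlshift mulr0.
rewrite !mxE /time_index /momentum_index eq_rshift; case: split_ordP => l ->.
  rewrite ord1 !mxE eqxx mulr1 mulr1n big1 ?addr0// => j _.
  by rewrite !eq_rshift eq_rlshift mulr0.
rewrite eq_rlshift mulr0 add0r (bigD1 l)//= !eq_rshift eqxx mulr1 big1 ?addr0// => j jl.
by rewrite !eq_rshift (negbTE jl) mulr0.
Qed.

Lemma flat_direction_norm (a : R) (q : 'rV[R]_N) : `|flat (0, a, q)| <= `|a| + `|q|.
Proof.
rewrite [leLHS]/Num.norm/= mx_normrE; apply/bigmax_leP; split; first exact: addr_ge0.
move=> [i0 i] _ /=; rewrite ord1 mxE /=; case: split_ordP => k _.
  by rewrite mxE normr0 addr_ge0.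
rewrite mxE; case: split_ordP => l _.
  by rewrite ord1 mxE eqxx mulr1n lerDl.
by apply: le_trans (coord_norm_le q l) _; rewrite lerDr.
Qed.

Lemma flat_translate (x0 : 'rV[R]_N) (t0 : R) (p0 : 'rV[R]_N) (a : R) (q : 'rV[R]_N) :
  flat (x0, t0, p0) + flat (0, a, q) = flat (x0, t0 + a, p0 + q).
Proof.
rewrite /flat /= add_row_mx addr0 add_row_mx; congr (row_mx _ (row_mx _ _)).
by rewrite raddfD.
Qed.

End regularity.

(** * Decrease of the Hamiltonian under simultaneous scaling and time shift *)

Section hamiltonian_decrease.
Context {R : realType} {N : nat}.
Local Notation phase := ('rV[R]_N * R * 'rV[R]_N)%type.
Variables (T : \bar R) (H : 'rV[R]_N -> R -> 'rV[R]_N -> R).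
Variables (c0 : R) (phi : R -> R) (c1 : R).

Definition kappa_bound (kappa : R) : Prop := 0 < kappa /\
  ae_in (superlevel T H c0)
    [set z | has_partials (H z.1.1 z.1.2) z.2 /\
      enorm (grad (H z.1.1 z.1.2) z.2) <= kappa * HpH H z.1.1 z.1.2 z.2].

(** The infinitesimal form of [hamiltonian_decrease]. Here [D] stands for
    [H_p . p - H] at a point where the structural inequalities hold, and
    [G . p = D + h]. The time shift costs [a * psih * D <= C * b * (h / 2) * D], the
    shift by [d] costs [b * kappa * enorm d * D], and the distance of [p] to [p0]
    costs the rest; together they spend at most three quarters of [b * D], so
    [b * (h + D / 4)] remains. *)
Lemma decrease_rate_le (D h c phic b a C kappa eta psih Ht : R)
    (G p d p0 : 'rV[R]_N) :
  D = dotv G p - h -> 0 <= D -> `|Ht| <= psih * D -> enorm G <= kappa * D ->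
  psih <= h / 2 -> 0 <= b -> 0 <= a -> a <= C * b -> 0 <= C -> 0 <= h ->
  0 <= kappa -> kappa * enorm d <= 2^-1 ->
  C * h < (2^-1 + C * c) / 2 -> kappa * enorm (p0 - p) < (2^-1 - C * c) / 4 ->
  0 <= eta -> c - eta / 2 < h -> phic - eta < D ->
  a * Ht + dotv G (- (b *: (d + p0))) <= - b * (c + phic / 4 - eta).
Proof.
move=> DE D0 HtD GD psih2 b0 a0 aC C0 h0 k0 kd Ch kp eta0 ch pD.
have -> : dotv G (- (b *: (d + p0))) = - b * (D + h + dotv G (d + (p0 - p))).
  by rewrite DE !dotvE; ring.
have Gd : `|dotv G (d + (p0 - p))| <= D * (kappa * enorm d + kappa * enorm (p0 - p)).
  apply: le_trans (cauchy_schwarz _ _) _.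
  apply: (@le_trans _ _ (kappa * D * (enorm d + enorm (p0 - p)))).
    by apply: ler_pM => //; rewrite ?enorm_ge0// enormD.
  by rewrite le_eqVlt; apply/orP; left; apply/eqP; ring.
have Gd2 : - dotv G (d + (p0 - p)) <= D * (2^-1 + (2^-1 - C * c) / 4).
  apply: le_trans (ler_norm _) _; rewrite normrN; apply: le_trans Gd _.
  by apply: ler_wpM2l => //; lra.
have aHt : a * Ht <= b * (C * h / 2 * D).
  apply: (@le_trans _ _ (a * (h / 2 * D))).
    apply: ler_wpM2l => //; apply: le_trans (ler_norm _) _.
    by apply: le_trans HtD _; rewrite ler_wpM2r.
  apply: (@le_trans _ _ (C * b * (h / 2 * D))).
    by apply: ler_wpM2r => //; rewrite mulr_ge0// divr_ge0.
  by rewrite le_eqVlt; apply/orP; left; apply/eqP; field.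
have Ch2 : C * h / 2 * D <= (2^-1 + C * c) / 4 * D.
  by apply: ler_wpM2r => //; lra.
have key : C * h / 2 * D - (D + h + dotv G (d + (p0 - p))) <=
    - (c + phic / 4 - eta).
  have : (2^-1 + C * c) / 4 * D + D * (2^-1 + (2^-1 - C * c) / 4) = 3 / 4 * D.
    by field.
  by lra.
have := ler_wpM2l b0 key; move: aHt; lra.
Qed.

(** Where [H > max c0 c1], moving [p] towards [- d] by the fraction [b] decreases [H] by
    at least [b * (H + phi (H) / 4)] up to a small error, even if [t] moves forward
    at the same time by [a <= C * b]. The rate is [decrease_rate_le], available
    almost everywhere; [ae_directional_bound] integrates it, applied to [H] composed
    with a clamp around the base point and to the steps given by
    [flat_direction]. *)
Lemma hamiltonian_decrease (kappa : R) (x0 : 'rV[R]_N) (t0 : R) (p0 d : 'rV[R]_N)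
    (C eta : R) :
  H0 T H c0 phi -> H1 T H c0 phi c1 -> kappa_bound kappa ->
  0 < t0 -> (t0%:E < T)%E ->
  c0 < H x0 t0 p0 -> c1 < H x0 t0 p0 -> kappa * enorm d <= 2^-1 ->
  0 <= C -> C * H x0 t0 p0 < 2^-1 -> 0 < eta ->
  exists2 b0, 0 < b0 & forall a b, 0 < b < b0 -> 0 <= a <= C * b ->
    H x0 (t0 + a) (p0 - b *: (d + p0)) - H x0 t0 p0 <=
    - b * (H x0 t0 p0 + phi (H x0 t0 p0) / 4 - eta).
Proof.
move=> [Hc c00 lipp [[phic phim phi0 _] ae0] _] [_ psic1 lipt ae1] [k0 aek].
move=> t00 t0T; set c := H x0 t0 p0 => cc0 cc1 kd C0 Cc eta0.
pose Hz (z : phase) := H z.1.1 z.1.2 z.2.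
pose z0 : phase := (x0, t0, p0).
have Hcz z : 0 < z.1.2 -> (z.1.2%:E < T)%E -> {for z, continuous Hz}.
  exact: hamiltonian_continuous.
have Hc0 : Hz z @[z --> z0] --> c by exact: (Hcz z0 t00 t0T).
have dom0 : dom_H T z0 by split; exact: ltW.
have [Wp [Lp [Wp0 WpL]]] : exists W (L : R), nbhs z0 W /\
    forall x t, L.-lipschitz_[set p | W (x, t, p) /\ dom_H T (x, t, p)] (H x t).
  by have [U [_ SU]] := lipp; apply => //; apply: SU; split => //=; exact: ltW.
have [Wt [Lt [Wt0 WtL]]] : exists W (L : R), nbhs z0 W /\
    forall x p, L.-lipschitz_[set t | W (x, t, p) /\ dom_H T (x, t, p)]
      (fun t => H x t p).
  by have [U [_ SU]] := lipt; apply => //; apply: SU; split => //=; exact: ltW.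
have near_slab : \forall z \near z0, 0 < z.1.2 /\ (z.1.2%:E < T)%E.
  apply: (@open_nbhs_nbhs _ z0 [set z : phase | 0 < z.1.2 /\ (z.1.2%:E < T)%E]).
  by split; [exact: open_time_slab|exact: (conj t00 t0T)].
have near_c0 : \forall z \near z0, c0 < Hz z by exact: (cvgr_gt _ Hc0).
have near_c1 : \forall z \near z0, c1 < Hz z by exact: (cvgr_gt _ Hc0).
have near_c : \forall z \near z0, c - eta / 2 < Hz z.
  by apply: (cvgr_gt _ Hc0); lra.
have phicont : {for c, continuous phi} by exact: phi_continuous_at phic cc0.
have near_phi : \forall z \near z0, phi c - eta < phi (Hz z).
  have phiH : phi (Hz z) @[z --> z0] --> phi c := cvg_comp _ _ Hc0 phicont.
  by apply: (cvgr_gt _ phiH); lra.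
have near_C : \forall z \near z0, C * Hz z < (2^-1 + C * c) / 2.
  have CH : C * Hz z @[z --> z0] --> C * c by apply: cvgM; [exact: cvg_cst|exact: Hc0].
  by apply: (cvgr_lt _ CH); lra.
have near_p : \forall z \near z0, kappa * enorm (p0 - z.2) < (2^-1 - C * c) / 4.
  have kpc : kappa * enorm (p0 - z.2) @[z --> z0] --> kappa * enorm (p0 - p0).
    apply: cvgM; first exact: cvg_cst.
    apply: continuous_cvg; first exact: enorm_continuous.
    by apply: cvgB; [exact: cvg_cst|exact: cvg_snd].
  by apply: (cvgr_lt _ kpc); rewrite subrr enorm0 mulr0; lra.
have : \forall z \near z0, [/\ 0 < z.1.2 /\ (z.1.2%:E < T)%E,
    c0 < Hz z /\ c1 < Hz z, c - eta / 2 < Hz z /\ phi c - eta < phi (Hz z),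
    C * Hz z < (2^-1 + C * c) / 2 /\ kappa * enorm (p0 - z.2) < (2^-1 - C * c) / 4
    & Wp z /\ Wt z].
  near=> z; split; [by near: z|split; by near: z|split; by near: z|
    split; by near: z|split; by near: z].
case/nbhs_ballP => e /= e0 eP.
pose del := e / 2; have del0 : 0 < del by rewrite divr_gt0.
have dele : del < e by rewrite /del; lra.
(* All the properties near [z0] are collected on a ball; [f] is [H] clamped into it. *)
pose cl := clamp (flat z0) del.
have clB w : ball z0 e (unflat (cl w)).
  by apply: unflat_ball; apply: clamp_ball => //; exact: ltW.
pose f w := Hz (unflat (cl w)).
have fc : continuous f.
  move=> w; apply: (@continuous_comp _ _ _ (fun w => unflat (cl w)) Hz).
    apply: (@continuous_comp _ _ _ cl unflat); first exact: clamp_continuous.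
    exact: unflat_continuous.
  by have [[? ?] _ _ _ _] := eP _ (clB w); exact: Hcz.
have domB z : ball z0 e z -> dom_H T z.
  by move=> /eP[[? ?] _ _ _ _]; split; exact: ltW.
pose Lip := `|Lp| + `|Lt|.
have Lip0 : 0 <= Lip by rewrite addr_ge0.
have f_time w (s : R) : `|f (w + s *: delta_mx 0 time_index) - f w| <= Lip * `|s|.
  have [s' ss' clE] := @clamp_delta _ _ (flat z0) del w s time_index (ltW del0).
  have := clB (w + s *: delta_mx 0 time_index); rewrite /f /cl clE unflat_time => b1.
  have b2 : ball z0 e (unflat (clamp (flat z0) del w)) := clB w.
  apply: (@le_trans _ _ (Lt * `|s'|)); last first.
    apply: (@le_trans _ _ (Lip * `|s'|)); last by rewrite ler_wpM2l.
    rewrite ler_wpM2r//; apply: le_trans (ler_norm _) _.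
    by rewrite /Lip lerDr.
  move: b1 b2; case: (unflat (clamp _ _ _)) => [[y r] q] /= b1 b2.
  have := WtL y q (r + s', r).
  rewrite /Hz /= [r + _ - _]addrAC subrr add0r; apply; split.
  - by split; [have [_ _ _ _ []] := eP _ b1|exact: (domB _ b1)].
  - by split; [have [_ _ _ _ []] := eP _ b2|exact: (domB _ b2)].
have f_mom w (s : R) j :
    `|f (w + s *: delta_mx 0 (momentum_index j)) - f w| <= Lip * `|s|.
  have [s' ss' clE] := @clamp_delta _ _ (flat z0) del w s (momentum_index j) (ltW del0).
  have := clB (w + s *: delta_mx 0 (momentum_index j)).
  rewrite /f /cl clE unflat_momentum => b1.
  have b2 : ball z0 e (unflat (clamp (flat z0) del w)) := clB w.
  apply: (@le_trans _ _ (`|Lp| * `|s'|)); last first.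
    apply: (@le_trans _ _ (Lip * `|s'|)); last by rewrite ler_wpM2l.
    by rewrite ler_wpM2r// /Lip lerDl.
  move: b1 b2; case: (unflat (clamp _ _ _)) => [[y r] q] /= b1 b2.
  have := WpL y r (q + s' *: delta_mx 0 j, q).
  rewrite /Hz /= [q + _ - _]addrAC subrr add0r => /(_ _)/le_trans; apply.
    split; split; [by have [_ _ _ _ []] := eP _ b1|exact: (domB _ b1)
      |by have [_ _ _ _ []] := eP _ b2|exact: (domB _ b2)].
  rewrite normrZ.
  have d1 : `|delta_mx 0 j : 'rV[R]_N| <= 1.
    rewrite [leLHS]/Num.norm/= mx_normrE; apply/bigmax_leP; split => //.
    move=> [i0 i] _ /=; rewrite mxE; case: (_ && _); first by rewrite normr1.
    by rewrite normr0.
  apply: (@le_trans _ _ (`|Lp| * (`|s'| * `|delta_mx 0 j : 'rV[R]_N|))).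
    by rewrite ler_wpM2r ?mulr_ge0// ler_norm.
  by rewrite ler_wpM2l// ler_piMr.
exists (del / 2 / (C + `|d + p0| + 1)).
  by rewrite !divr_gt0// ltr_wpDl// addr_ge0.
move=> a b /andP[b_gt0 bb] /andP[a0 aCb].
pose q := - (b *: (d + p0)).
pose s := (a *: delta_mx 0 time_index : 'rV[R]_(N + (1 + N))) ::
  [seq q 0 j *: delta_mx 0 (momentum_index j) | j <- index_enum 'I_N].
have sumE : \sum_(v <- s) v = flat (0, a, q).
  by rewrite flat_direction /s big_cons big_map.
have small : `|flat (0, a, q)| < del / 2.
  apply: le_lt_trans (flat_direction_norm a q) _.
  rewrite (ger0_norm a0) /q normrN normrZ gtr0_norm//.
  move: bb; rewrite ltr_pdivlMr ?ltr_wpDl ?addr_ge0//.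
  by apply: le_lt_trans; have := ltW b_gt0; move: aCb; lra.
have endE : unflat (flat z0 + flat (0, a, q)) = (x0, t0 + a, p0 + q).
  by rewrite flat_translate flatK.
have in_del x : 0 <= x <= 1 -> ball (flat z0) (del / 2) (flat z0 + x *: flat (0, a, q)).
  move=> /andP[x0' x1']; rewrite -ball_normE /= opprD addrA subrr sub0r normrN normrZ.
  by rewrite ger0_norm//; apply: le_lt_trans small; rewrite ler_piMl.
have ballS w : ball (flat z0) (del / 2) w -> ball (flat z0) del w.
  by apply: le_ball; lra.
have f0 : f (flat z0) = c.
  by rewrite /f /cl clamp_id ?flatK//; exact: ballxx.
have f1 : f (flat z0 + flat (0, a, q)) = H x0 (t0 + a) (p0 - b *: (d + p0)).
  rewrite /f /cl clamp_id ?endE//; apply: ballS.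
  by have := in_del 1; rewrite scale1r; apply; rewrite ler01 lexx.
rewrite -f0 -f1 -sumE.
pose A S P := @flat R N @` (superlevel T H S `\` P).
(* The exceptional set is the union of those of the three structural inequalities. *)
apply: (@ae_directional_bound _ _ f s (Lip * (a + b * `|d + p0|)) _ del
  (A c0 [set z | has_partials (H z.1.1 z.1.2) z.2 /\
          phi (H z.1.1 z.1.2 z.2) <= HpH H z.1.1 z.1.2 z.2] `|`
   A c0 [set z | has_partials (H z.1.1 z.1.2) z.2 /\
      enorm (grad (H z.1.1 z.1.2) z.2) <= kappa * HpH H z.1.1 z.1.2 z.2] `|`
   A c1 [set z | [/\ has_partials (H z.1.1 z.1.2) z.2,
          derivable (fun s => H z.1.1 s z.2) z.1.2 1 &
          `|Ht H z.1.1 z.1.2 z.2|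
            <= psi c0 phi (H z.1.1 z.1.2 z.2) * HpH H z.1.1 z.1.2 z.2]]) (flat z0)).
- exact: fc.
- move=> v; rewrite in_cons => /predU1P[->|/mapP[j _ ->]] w x.
    rewrite scalerA; apply: le_trans (f_time _ _) _.
    rewrite normrM (ger0_norm a0) -[leRHS]mulrA; apply: ler_wpM2l => //.
    by rewrite mulrC ler_wpM2r// lerDl mulr_ge0// ltW.
  rewrite scalerA; apply: le_trans (f_mom _ _ _) _.
  rewrite normrM -[leRHS]mulrA; apply: ler_wpM2l => //.
  rewrite mulrC ler_wpM2r//; apply: le_trans (coord_norm_le q j) _.
  by rewrite /q normrN normrZ gtr0_norm// lerDr.
- apply: affine_nullU; [apply: affine_nullU|]; exact: lebesgue_null_affine_null.
- exact: del0.
- move=> w wB nA e1 e10.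
  have clw : cl w = w by exact: clamp_id.
  have nA' S P : ~ A S P w -> superlevel T H S (unflat w) -> P (unflat w).
    move=> nASP SH; apply: contrapT => nP; apply: nASP.
    by exists (unflat w); [split|rewrite unflatK].
  have zB : ball z0 e (unflat w) by rewrite -clw; exact: clB.
  have [nA01 nA2] : ~ (A c0 [set z | has_partials (H z.1.1 z.1.2) z.2 /\
          phi (H z.1.1 z.1.2 z.2) <= HpH H z.1.1 z.1.2 z.2] `|`
   A c0 [set z | has_partials (H z.1.1 z.1.2) z.2 /\
      enorm (grad (H z.1.1 z.1.2) z.2) <= kappa * HpH H z.1.1 z.1.2 z.2]) w /\
   ~ (A c1 [set z | [/\ has_partials (H z.1.1 z.1.2) z.2,
          derivable (fun s => H z.1.1 s z.2) z.1.2 1 &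
          `|Ht H z.1.1 z.1.2 z.2|
            <= psi c0 phi (H z.1.1 z.1.2 z.2) * HpH H z.1.1 z.1.2 z.2]]) w.
    by split=> ?; apply: nA; [left|right].
  have [[? ?] [h0 h1] [hc hphi] [hC hp] _] := eP _ zB.
  have sl0 : superlevel T H c0 (unflat w) by split; [exact: (domB _ zB)|exact: ltW].
  have sl1 : superlevel T H c1 (unflat w) by split; [exact: (domB _ zB)|exact: ltW].
  have [_ Dphi] := nA' _ _ (fun x => nA01 (or_introl x)) sl0.
  have [_ Gk] := nA' _ _ (fun x => nA01 (or_intror x)) sl0.
  have [part dert Htb] := nA' _ _ nA2 sl1.
  have loc (v : 'rV[R]_(N + (1 + N))) :
      \forall m \near \oo, ball (flat z0) del (w + m.+1%:R^-1 *: v).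
    have wv : w + m.+1%:R^-1 *: v @[m --> \oo] --> w.
      have wv0 : w + m.+1%:R^-1 *: v @[m --> \oo] --> w + 0 *: v.
        apply: cvgD; first exact: cvg_cst.
        by apply: cvgZr_tmp; exact: cvg_harmonic.
      by move: wv0; rewrite scale0r addr0.
    apply: wv; apply: open_nbhs_nbhs; split => //; exact: ball_open.
  have fw : f w = Hz (unflat w) by rewrite /f clw.
  have fE y : ball (flat z0) del y -> f y = Hz (unflat y).
    by move=> yB; rewrite /f /cl clamp_id.
  pose x1 := (unflat w).1.1; pose t1 := (unflat w).1.2; pose p1 := (unflat w).2.
  have cvt : m.+1%:R * (f (w + m.+1%:R^-1 *: (a *: delta_mx 0 time_index)) - f w)
      @[m --> \oo] --> a * Ht H x1 t1 p1.
    rewrite /Ht derive1E.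
    apply: cvg_trans (@derive_seq R _ _ _ _ a dert); apply: near_eq_cvg.
    near=> m; rewrite fw fE; last by near: m; exact: loc.
    rewrite (scalerA m.+1%:R^-1 a (delta_mx _ _)) unflat_time.
    by rewrite /Hz /= [a *: 1]/GRing.scale/= mulr1.
  have cvp j : m.+1%:R * (f (w + m.+1%:R^-1 *: (q 0 j *: delta_mx 0 (momentum_index j))) - f w)
      @[m --> \oo] --> q 0 j * 'D_(delta_mx 0 j) (H x1 t1) p1.
    apply: cvg_trans (@derive_seq R _ _ _ _ (q 0 j) (part j)); apply: near_eq_cvg.
    near=> m; rewrite fw fE; last by near: m; exact: loc.
    rewrite (scalerA m.+1%:R^-1 (q 0 j) (delta_mx _ (momentum_index j))).
    by rewrite unflat_momentum /Hz /= scalerA.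
  have cvs : \sum_(v <- s) m.+1%:R * (f (w + m.+1%:R^-1 *: v) - f w) @[m --> \oo] -->
      a * Ht H x1 t1 p1 + dotv (grad (H x1 t1) p1) q.
    have -> : dotv (grad (H x1 t1) p1) q =
        \sum_j q 0 j * 'D_(delta_mx 0 j) (H x1 t1) p1.
      by apply: eq_bigr => j _; rewrite mxE mulrC.
    rewrite /s; under eq_fun do rewrite big_cons big_map.
    by apply: cvgD; [exact: cvt|exact: sum_cvg].
  have lim_le : a * Ht H x1 t1 p1 + dotv (grad (H x1 t1) p1) q <=
      - b * (c + phi c / 4 - eta).
    apply: (@decrease_rate_le (HpH H x1 t1 p1) (H x1 t1 p1) c (phi c) b a C kappa
      eta (psi c0 phi (H x1 t1 p1)) _ _ p1) => //.
    - by apply: le_trans Dphi; apply: phi0; exact: ltW.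
    - by apply: psi_le_half => //; exact: le_lt_trans psic1 h1.
    - exact: ltW.
    - by apply: ltW; apply: le_lt_trans c00 h0.
    - exact: ltW.
    - exact: ltW.
    - exact: lt_le_trans hphi Dphi.
  near=> m; apply: ltW; near: m.
  by apply: (cvgr_lt _ cvs); rewrite f0; move: lim_le e10; lra.
- by rewrite sumE; exact: in_del.
Unshelve. all: by end_near.
Qed.

End hamiltonian_decrease.

(** * Growth of phi and a barrier *)

Section phi_unbounded.
Context {R : realType}.
Notation leb := (@lebesgue_measure R).

(** If [phi <= M] then each of the infinitely many intervals [x, 2 x] with [x >= A]
    contributes at least [1 / (2 M)] to the integral of [1 / (s phi (s))]. *)
Lemma phi_unbounded (c0 : R) (phi : R -> R) (M : R) : 0 <= c0 ->
  admissible_phi c0 phi -> exists2 s, c0 < s & M < phi s.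
Proof.
move=> c00 [phic phim phi0 [A cA intA]].
apply: contrapT => nM.
have phiM s : c0 < s -> phi s <= M.
  by move=> cs; rewrite leNgt; apply/negP => Ms; apply: nM; exists s.
have phi_gt0 s : c0 < s -> 0 < phi s.
  move=> cs; apply: le_lt_trans (phi0 c0 (lexx _)) _.
  by apply: phim => //; rewrite in_itv/= ?lexx// ltW.
have M0 : 0 < M by apply: lt_le_trans (phi_gt0 A cA) (phiM A cA).
pose f (s : R) : \bar R := ((s * phi s)^-1)%:E.
have mf x : A <= x -> measurable_fun (`]x, +oo[%classic : set R) f.
  move=> Ax; apply/measurable_EFinP.
  apply: open_continuous_measurable_fun; first exact: interval_open.
  move=> s; rewrite inE/= in_itv/= andbT => xs.
  have cs : c0 < s by apply: lt_trans xs; apply: lt_le_trans Ax.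
  have s0 : 0 < s by exact: le_lt_trans cs.
  apply: cvgV; first by rewrite mulf_neq0// gt_eqF// phi_gt0.
  by apply: cvgM; [exact: cvg_id|exact: phi_continuous_at phic cs].
have f0 x s : A <= x -> (`]x, +oo[%classic : set R) s -> (0 <= f s)%E.
  move=> Ax /=; rewrite in_itv/= andbT => xs; rewrite lee_fin invr_ge0.
  have cs : c0 < s by apply: lt_trans xs; apply: lt_le_trans Ax.
  by rewrite mulr_ge0// ?ltW ?phi_gt0//; exact: le_lt_trans cs.
(* The contribution of one dyadic interval. *)
have step x : A <= x ->
    ((2 * M)^-1%:E + \int[leb]_(s in `](2 * x)%R, +oo[) f s <=
    \int[leb]_(s in `]x, +oo[) f s)%E.
  move=> Ax.
  have x0 : 0 < x by apply: lt_le_trans Ax; exact: le_lt_trans cA.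
  have x2 : x <= 2 * x by lra.
  have U : (`]x, +oo[%classic : set R) = `]x, 2 * x]%classic `|` `]2 * x, +oo[%classic.
    by rewrite -itv_bndbnd_setU// bnd_simp.
  have sub1 : `]x, 2 * x]%classic `<=` (`]x, +oo[%classic : set R).
    by rewrite U; exact: subsetUl.
  rewrite U ge0_integral_setU//; last 3 first.
  - by rewrite -U; exact: mf.
  - by rewrite -U => s; exact: f0.
  - apply/disj_setPS => s [] /=; rewrite !in_itv/= andbT => /andP[_ h1] h2.
    by move: h1; rewrite leNgt h2.
  rewrite leeD2r//.
  apply: (@le_trans _ _ (\int[leb]_(s in `]x, (2 * x)%R]) (cst (2 * x * M)^-1%:E) s)%E).
    rewrite integral_cst//.
    rewrite (_ : _ `]x, 2 * x]%classic = x%:E); last first.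
      apply: (etrans (lebesgue_measure_itv `]x, 2 * x])) => /=.
      by rewrite lte_fin ifT; [rewrite -EFinB; congr EFin; lra|lra].
    rewrite -EFinM lee_fin le_eqVlt; apply/orP; left; apply/eqP.
    by field; rewrite !gt_eqF.
  apply: ge0_le_integral => //=.
  - by move=> s _; rewrite lee_fin invr_ge0 !mulr_ge0// ltW.
  - exact: measurable_funS (mf _ Ax).
  - move=> s; rewrite /= in_itv/= => /andP[xs s2]; rewrite lee_fin.
    have cs : c0 < s by apply: lt_trans xs; apply: lt_le_trans Ax.
    have s0 : 0 < s by exact: le_lt_trans cs.
    rewrite lef_pV2 ?posrE ?mulr_gt0 ?phi_gt0//.
    by apply: ler_pM => //; rewrite ?(ltW s0) ?phiM// ltW// phi_gt0.
have step_n n : ((n%:R * (2 * M)^-1)%:E <= \int[leb]_(s in `]A, +oo[) f s)%E.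
  have A0 : 0 < A by exact: le_lt_trans cA.
  apply: (@le_trans _ _ ((n%:R * (2 * M)^-1)%:E + \int[leb]_(s in `](2 ^+ n * A)%R, +oo[) f s)%E).
    rewrite leeDl// integral_ge0// => s; apply: f0.
    by rewrite ler_peMl ?(ltW A0)// exprn_ege1// ler1n.
  elim: n => [|n IH]; first by rewrite mul0r add0e expr0 mul1r.
  apply: le_trans IH; rewrite -natr1 mulrDl mul1r EFinD -addeA leeD2l//.
  rewrite exprS -mulrA; apply: step.
  by rewrite ler_peMl ?(ltW A0)// exprn_ege1// ler1n.
have intE : (\int[leb]_(s in `]A, +oo[) f s)%E \is a fin_num.
  by rewrite ge0_fin_numE// integral_ge0// => s; exact: f0.
have M2 : 0 < (2 * M)^-1 by rewrite invr_gt0 mulr_gt0.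
pose I := fine (\int[leb]_(s in `]A, +oo[) f s)%E.
have [n] : exists n : nat, I / (2 * M)^-1 < n%:R.
  by exists (Num.truncn (I / (2 * M)^-1)).+1; exact: truncnS_gt.
rewrite ltr_pdivrMr// => In.
by have := step_n n; rewrite -(fineK intE) lee_fin leNgt In.
Qed.

(** A continuous function that decreases at rate at least [m] as long as it stays in
    [lo, up] lies below [max lo (K - m * x)]: the last point up to which this holds
    cannot be less than 1. *)
Lemma barrier_le (G : R -> R) (lo K m up : R) :
  (forall x, 0 <= x <= 1 -> {for x, continuous G}) ->
  G 0 <= K -> K <= up -> lo <= up -> 0 <= m ->
  (forall x, 0 <= x < 1 -> lo <= G x <= up ->
    exists2 h1, 0 < h1 & forall h, 0 < h < h1 -> G (x + h) <= G x - m * h) ->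
  G 1 <= Num.max lo (K - m).
Proof.
move=> Gc G0 Kup loup m0 Gdec.
pose B x := Num.max lo (K - m * x).
have Bc : continuous B.
  apply: fun_continuous_max; first exact: fun_continuous_cst.
  apply: fun_continuousB; first exact: fun_continuous_cst.
  by apply: fun_continuousZ => x; exact: cvg_id.
pose S : set R := [set x | 0 <= x <= 1 /\ G x <= B x].
have S0 : S 0.
  by split; rewrite ?lexx ?ler01// /B mulr0 subr0 le_max G0 orbT.
have Sub : has_ubound S by exists 1 => x [/andP[]].
have hS : has_sup S by split => //; exists 0.
pose s := sup S.
have s01 : 0 <= s <= 1.
  apply/andP; split; first exact: ub_le_sup.
  by apply: ge_sup; [exists 0|move=> x [/andP[]]].
have Ss : S s.
  split => //; rewrite leNgt; apply/negP => ks.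
  have gc : G x - B x @[x --> s] --> G s - B s.
    by apply: cvgB; [exact: (Gc s s01)|exact: Bc].
  have : \forall x \near s, 0 < G x - B x.
    by apply: (cvgr_gt _ gc); rewrite subr_gt0.
  case/nbhs_ballP => d /= d0 dP.
  have [x Sx sx] := sup_adherent d0 hS.
  have xs : x <= s by exact: ub_le_sup.
  have := dP x; rewrite /ball/= ger0_norm ?subr_ge0// => /(_ _).
  rewrite ltrBlDl -ltrBlDr => /(_ sx).
  by have [_] := Sx; lra.
have [s1|s1] := ltP s 1; last first.
  have [_] := Ss; have -> : s = 1 by apply/le_anti; rewrite s1 andbT; case/andP: s01.
  by rewrite /B mulr1.
have [/andP[s0 _] ks] := Ss.
have notS h : 0 < h -> s + h <= 1 -> G (s + h) <= B (s + h) -> False.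
  move=> h0 sh1 GB.
  have : s + h <= s.
    by apply: ub_le_sup => //; split => //; rewrite sh1 andbT addr_ge0// ltW.
  by lra.
(* Strictly below [lo], continuity alone allows a further step. *)
have [Glo|Glo] := ltP (G s) lo.
  have : \forall x \near s, G x < lo by exact: (cvgr_lt _ (Gc s s01)).
  case/nbhs_ballP => d /= d0 dP.
  pose h := Num.min (1 - s) (d / 2).
  have h0 : 0 < h by rewrite lt_min subr_gt0 s1 divr_gt0.
  have hd : h <= d / 2 by rewrite ge_min lexx orbT.
  have h1 : h <= 1 - s by rewrite ge_min lexx.
  exfalso; apply: (notS h) => //; first by lra.
  rewrite /B le_max; apply/orP; left; apply: ltW; apply: dP.
  by rewrite /ball/= opprD addrA subrr sub0r normrN gtr0_norm//; lra.
have Gup : lo <= G s <= up.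
  rewrite Glo/=; apply: le_trans ks _; rewrite /B ge_max loup/=.
  by apply: le_trans Kup; rewrite gerBl mulr_ge0.
have [|h1 h10 h1P] := Gdec s _ Gup; first by rewrite s0.
pose h := Num.min (1 - s) (h1 / 2).
have h0 : 0 < h by rewrite lt_min subr_gt0 s1 divr_gt0.
have hd : h <= h1 / 2 by rewrite ge_min lexx orbT.
have hs : h <= 1 - s by rewrite ge_min lexx.
exfalso; apply: (notS h) => //; first by lra.
have hh1 : 0 < h < h1 by rewrite h0; lra.
apply: le_trans (h1P h hh1) _; rewrite /B le_max.
have mh : 0 <= m * h by rewrite mulr_ge0// ltW.
move: ks; rewrite /B le_max => /orP[ks|ks]; apply/orP; [left|right]; first by lra.
by rewrite mulrDr; lra.
Qed.

End phi_unbounded.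

(** * The scaled Hamiltonian along a path *)

Section scaled_hamiltonian.
Context {R : realType} {N : nat}.
Variables (T : \bar R) (H : 'rV[R]_N -> R -> 'rV[R]_N -> R).
Variables (c0 : R) (phi : R -> R) (c1 : R).

(** The inequality that contradicts the viscosity inequalities in [time_estimate].
    With [mu z = 1 + z * D], follow [H] from [(s, p)] at [z = 0] to the final point at
    [z = 1] along time [s + z * (t - s)] and momentum [(mu z)^-1 * (p + d) - d]. A
    step along this path is a time shift together with a contraction of the
    momentum towards [- d] by a fraction proportional to [D], which is the
    situation of [hamiltonian_decrease]; the ratio [C] of the two steps is
    admissible because [16 * (t - s) * E <= D]. The contraction yields a decrease
    of [H] by [H] itself, which offsets the growth of [mu] in [mu * H], plus a
    gain [phi (H) / 4]. Hence [mu * H] decreases at rate at least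
    [D * (sigma + 1)] while [H >= hmin], and [barrier_le] applies. *)
Lemma scaled_hamiltonian_lt (kappa : R) (y p d : 'rV[R]_N)
    (s t D E e sigma hmin : R) :
  H0 T H c0 phi -> H1 T H c0 phi c1 -> kappa_bound T H c0 kappa ->
  0 < s -> s < t -> (t%:E < T)%E -> kappa * enorm d <= 2^-1 ->
  c0 < hmin -> c1 < hmin -> 0 <= sigma -> 4 * (sigma + 2) <= phi hmin ->
  0 < D -> 16 * (t - s) * E <= D -> 0 < E -> e <= E -> e < D ->
  (1 + D) * hmin < E - D * sigma -> H y s p <= E + e ->
  (1 + D) * H y t ((1 + D)^-1 *: (p + d) - d) < E - D * sigma.
Proof.
move=> hH0 hH1 hk s0 st tT kd hc0 hc1 sig0 phih D0 DE E0 eE eD muE Hs.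
have [Hc c00 _ [[_ phim _ _] _] _] := hH0.
have hmin0 : 0 < hmin by exact: le_lt_trans hc0.
pose mu z := 1 + z * D.
pose P z : 'rV[R]_N * R * 'rV[R]_N := ((y, s + z * (t - s)), (mu z)^-1 *: (p + d) - d).
pose h z := H (P z).1.1 (P z).1.2 (P z).2.
pose G z := mu z * h z.
have mu_ge1 z : 0 <= z -> 1 <= mu z by move=> z0; rewrite lerDl mulr_ge0// ltW.
have muc : continuous mu.
  by move=> z; apply: cvgD; [exact: cvg_cst|apply: cvgM; [exact: cvg_id|exact: cvg_cst]].
have Pslab z : 0 <= z <= 1 -> 0 < (P z).1.2 /\ ((P z).1.2%:E < T)%E.
  move=> /andP[z0 z1] /=; have zt : 0 <= z * (t - s) by rewrite mulr_ge0// subr_ge0 ltW.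
  split; first by lra.
  apply: le_lt_trans tT; rewrite lee_fin.
  have : z * (t - s) <= t - s by rewrite ler_piMl// subr_ge0 ltW.
  by lra.
have Gc z : 0 <= z <= 1 -> {for z, continuous G}.
  move=> z01; have [P1 P2] := Pslab z z01; have /andP[z0 z1] := z01.
  apply: cvgM; first exact: muc.
  apply: (@continuous_comp _ _ _ P (fun w => H w.1.1 w.1.2 w.2)); last first.
    exact: (hamiltonian_continuous Hc P1 P2).
  have c2 : s + x * (t - s) @[x --> z] --> s + z * (t - s).
    by apply: cvgD; [exact: cvg_cst|apply: cvgM; [exact: cvg_id|exact: cvg_cst]].
  have c3 : (mu x)^-1 *: (p + d) - d @[x --> z] --> (mu z)^-1 *: (p + d) - d.
    apply: cvgB; last exact: cvg_cst.
    apply: cvgZr_tmp; apply: cvgV; last exact: muc.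
    by rewrite gt_eqF// (lt_le_trans ltr01)// mu_ge1.
  exact: (cvg_pair (cvg_pair (cvg_cst y) c2) c3).
have h0E : h 0 = H y s p.
  by rewrite /h /P /= /mu !mul0r !addr0 invr1 scale1r addrK.
have G1E : G 1 = (1 + D) * H y t ((1 + D)^-1 *: (p + d) - d).
  by rewrite /G /h /P /mu /= !mul1r addrCA subrr addr0.
rewrite -G1E.
pose lo := (1 + D) * hmin.
have D1 : 0 < 1 + D by lra.
have Dsig : 0 <= D * sigma by rewrite mulr_ge0// ltW.
apply: (@le_lt_trans _ _ (Num.max lo (E + e - D * (sigma + 1)))); last first.
  by rewrite gt_max; apply/andP; split => //; rewrite mulrDr; lra.
apply: (@barrier_le _ G lo (E + e) (D * (sigma + 1)) (2 * E)) => //.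
- by rewrite /G h0E /mu mul0r addr0 mul1r.
- by lra.
- by move: muE; rewrite /lo; lra.
- by rewrite mulr_ge0// ?ltW//; lra.
move=> z /andP[z0 z1] /andP[Glo Gup].
have z01 : 0 <= z <= 1 by rewrite z0 ltW.
have mu0 : 0 < mu z by apply: lt_le_trans (mu_ge1 z z0).
have hh : hmin <= h z.
  rewrite -(ler_pM2l mu0); apply: le_trans Glo; rewrite /lo ler_pM2r// /mu.
  by rewrite lerD2l ler_piMl// ltW.
(* The ratio of the time step to the contraction of the momentum. *)
pose C := 2 * (t - s) * mu z / D.
have C0 : 0 <= C.
  by rewrite /C divr_ge0 ?mulr_ge0// ?subr_ge0 ltW.
have Ch : C * h z < 2^-1.
  have -> : C * h z = 2 * (t - s) * G z / D by rewrite /C /G; field; rewrite gt_eqF.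
  rewrite ltr_pdivrMr//.
  have : (t - s) * G z <= (t - s) * (2 * E) by rewrite ler_wpM2l// subr_ge0 ltW.
  by lra.
have [P1 P2] := Pslab z z01.
have [b0 b00 b0P] := @hamiltonian_decrease R N T H c0 phi c1 kappa y _ _ d C 1
  hH0 hH1 hk P1 P2 (lt_le_trans hc0 hh) (lt_le_trans hc1 hh) kd C0 Ch ltr01.
exists (Num.min D^-1 (b0 / D)).
  by rewrite lt_min invr_gt0 D0 divr_gt0.
move=> x /andP[x0]; rewrite lt_min => /andP[xD xb].
have xD1 : x * D < 1 by rewrite -ltr_pdivlMr// div1r.
have xD0 : 0 < x * D by rewrite mulr_gt0.
have xDb : x * D < b0 by rewrite -ltr_pdivlMr.
have muz1 := mu_ge1 z z0.
have m0 : 0 < mu z + x * D by lra.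
(* The contraction of [p + d] from [mu z] to [mu (z + x)] is [1 - b]. *)
pose b := x * D / (mu z + x * D).
have b_gt0 : 0 < b by rewrite divr_gt0.
have bb0 : b < b0.
  apply: le_lt_trans xDb; rewrite /b ler_pdivrMr// ler_peMr ?(ltW xD0)//.
  by move: muz1; lra.
have xts : 0 <= x * (t - s) by rewrite mulr_ge0 ?(ltW x0)// subr_ge0 ltW.
have muxE : mu (z + x) = mu z + x * D by rewrite /mu; ring.
have := b0P (x * (t - s)) b.
rewrite b_gt0 bb0 xts /= => /(_ isT).
have -> : x * (t - s) <= C * b.
  rewrite /C /b mulrA.
  have -> : 2 * (t - s) * mu z / D * (x * D) / (mu z + x * D) =
     x * (t - s) * (2 * mu z / (mu z + x * D)).
    by field; rewrite !gt_eqF.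
  by rewrite ler_peMr// ler_pdivlMr// mul1r; lra.
move=> /(_ isT).
have -> : H y (s + z * (t - s) + x * (t - s))
    ((mu z)^-1 *: (p + d) - d - b *: (d + ((mu z)^-1 *: (p + d) - d))) = h (z + x).
  rewrite /h /P /= muxE; congr (H _ _ _); first by rewrite mulrDl addrA.
  rewrite [d + (_ - d)]addrCA subrr addr0 scalerA addrAC -scalerBl; congr (_ *: _ - _).
  by rewrite /b; field; rewrite !gt_eqF.
rewrite -/(h z) => hx.
have phz : phi hmin <= phi (h z).
  move: hh; rewrite le_eqVlt => /predU1P[->//|hh]; apply: ltW; apply: phim => //.
  - by rewrite in_itv/= andbT ltW.
  - by rewrite in_itv/= andbT ltW// (lt_trans hc0).
rewrite {1}/G muxE.
have : (mu z + x * D) * h (z + x) <=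
    (mu z + x * D) * (h z - b * (h z + phi (h z) / 4 - 1)).
  by rewrite ler_pM2l//; move: hx; rewrite -/(h z); lra.
move=> /le_trans; apply.
have -> : (mu z + x * D) * (h z - b * (h z + phi (h z) / 4 - 1)) =
    G z - x * D * (phi (h z) / 4 - 1).
  by rewrite /b /G; field; rewrite gt_eqF.
have : x * D * (sigma + 1) <= x * D * (phi (h z) / 4 - 1).
  by apply: ler_wpM2l; [exact: ltW|lra].
by lra.
Qed.

End scaled_hamiltonian.

(** * Quadratic test functions *)

Section quadratic_tests.
Context {R : realType} {N : nat}.
Local Notation spacetime := ('rV[R]_N * R)%type.

Lemma is_derive_quadratic (V : normedModType R) (g : V -> R) (w v : V) (a b : R) :
  (forall h : R, g (h *: v + w) - g w = h * a + h ^+ 2 * b) -> is_derive w v g a.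
Proof.
move=> gE.
have gcvg : h^-1 *: (g (h *: v + w) - g w) @[h --> 0^'] --> a.
  have lim : a + h * b @[h --> (0 : R)^'] --> a.
    have c : a + h * b @[h --> (0 : R)] --> a + 0 * b.
      by apply: cvgD; [exact: cvg_cst|apply: cvgM; [exact: cvg_id|exact: cvg_cst]].
    by apply: cvg_within_filter; move: c; rewrite mul0r addr0.
  apply: cvg_trans lim; apply: near_eq_cvg.
  near=> h; have h0 : h != 0 by near: h; exact: nbhs_dnbhs_neq.
  by rewrite gE [_ *: (_ + _)]/GRing.scale/=; field.
split; first by apply/cvg_ex; exists a.
by apply/cvg_lim.
Unshelve. all: by end_near.
Qed.

Lemma differentiable_fst (y : spacetime) : differentiable (@fst 'rV[R]_N R) y.
Proof.
have fl : linear (@fst 'rV[R]_N R) by [].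
pose flM := GRing.isLinear.Build _ _ _ _ _ fl.
pose f : {linear _ -> _} := HB.pack (@fst 'rV[R]_N R) flM.
by apply: (@linear_differentiable _ _ _ f) => z; exact: cvg_fst.
Qed.

Lemma differentiable_snd (y : spacetime) : differentiable (@snd 'rV[R]_N R) y.
Proof.
have fl : linear (@snd 'rV[R]_N R) by [].
pose flM := GRing.isLinear.Build _ _ _ _ _ fl.
pose f : {linear _ -> _} := HB.pack (@snd 'rV[R]_N R) flM.
by apply: (@linear_differentiable _ _ _ f) => z; exact: cvg_snd.
Qed.

Definition sqdist (y w : spacetime) : R :=
  dotv (w.1 - y.1) (w.1 - y.1) + (w.2 - y.2) ^+ 2.

(** Test functions of this form have [(q, tau)] as space-time gradient at [y]; a
    one-sided bound by one of them says that [(q, tau)] is a superjet or a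
    subjet. *)
Definition quadratic (y : spacetime) (q : 'rV[R]_N) (tau C : R) (w : spacetime) : R :=
  dotv q (w.1 - y.1) + tau * (w.2 - y.2) + C * sqdist y w.

Lemma quadratic_differentiable y q tau C w : differentiable (quadratic y q tau C) w.
Proof.
have cst (c : R) : differentiable (fun _ : spacetime => c) w.
  exact: (@differentiable_cst _ _ _ c).
have coord j : differentiable (fun w : spacetime => w.1 0 j - y.1 0 j) w.
  apply: differentiableB; last exact: cst.
  apply: (@differentiable_comp _ _ _ _ fst (fun w : 'rV[R]_N => w 0 j)).
    exact: differentiable_fst.
  exact: differentiable_coord.
have time : differentiable (fun w : spacetime => w.2 - y.2) w.
  by apply: differentiableB; [exact: differentiable_snd|exact: cst].
have -> : quadratic y q tau C = (\sum_(j < N) (fun w : spacetime => q 0 j * (w.1 0 j - y.1 0 j)))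
   + (fun w => tau * (w.2 - y.2)) +
   (fun w => C * ((\sum_(j < N) (fun w : spacetime => (w.1 0 j - y.1 0 j) * (w.1 0 j - y.1 0 j))) w
     + (w.2 - y.2) * (w.2 - y.2))).
  apply/funext => z; rewrite /quadratic /sqdist /dotv /= !fctE !fct_sumE.
  congr (_ + _ + _ * (_ + _)).
  - by apply: eq_bigr => j _; rewrite !mxE.
  - by apply: eq_bigr => j _; rewrite !mxE.
apply: differentiableD; first apply: differentiableD.
- by apply: differentiable_sum => j; apply: differentiableM; [exact: cst|exact: coord].
- by apply: differentiableM; [exact: cst|exact: time].
- apply: differentiableM; first exact: cst.
  apply: differentiableD; last by apply: differentiableM; exact: time.
  by apply: differentiable_sum => j; apply: differentiableM; exact: coord.
Qed.

Lemma quadratic_derive y q tau C w v :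
  'D_v (quadratic y q tau C) w =
  dotv q v.1 + tau * v.2 + C * (2 * dotv (w.1 - y.1) v.1 + 2 * (w.2 - y.2) * v.2).
Proof.
apply: (@derive_val _ _ _ w v _ _ (@is_derive_quadratic _ _ w v _
  (C * (dotv v.1 v.1 + v.2 ^+ 2)) _)) => h.
rewrite /quadratic /sqdist /= !dotvE.
rewrite (dotvC v.1 w.1) (dotvC y.1 v.1) (dotvC y.1 w.1) (dotvC v.1 y.1).
by rewrite [h *: v.2]/GRing.scale/=; ring.
Qed.

Lemma quadratic_C1 (Q : set spacetime) y q tau C : C1_on Q (quadratic y q tau C).
Proof.
move=> w _; split; first exact: quadratic_differentiable.
move=> v.
rewrite (_ : (fun w => 'D_v (quadratic y q tau C) w) = (fun w =>
    dotv q v.1 + tau * v.2 + quadratic y ((2 * C) *: v.1) (2 * C * v.2) 0 w)); last first.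
  apply/funext => z; rewrite quadratic_derive /quadratic !dotvE.
  by rewrite (dotvC v.1 z.1) (dotvC v.1 y.1); ring.
have qc := differentiable_continuous
  (quadratic_differentiable y ((2 * C) *: v.1) (2 * C * v.2) 0 w).
exact: (cvgD (cvg_cst _) qc).
Qed.

Lemma dotv_delta (q : 'rV[R]_N) j : dotv q (delta_mx 0 j) = q 0 j.
Proof.
rewrite /dotv (bigD1 j)//= !mxE !eqxx mulr1 big1 ?addr0// => i ij.
by rewrite !mxE (negbTE ij) mulr0.
Qed.

Lemma quadratic_center y q tau C : quadratic y q tau C y = 0.
Proof. by rewrite /quadratic /sqdist !subrr !dotv0; ring. Qed.

Lemma quadratic_HJ (H : 'rV[R]_N -> R -> 'rV[R]_N -> R) y q tau C :
  HJ H (quadratic y q tau C) y = tau + H y.1 y.2 q.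
Proof.
rewrite /HJ; congr (_ + H _ _ _).
  rewrite derive1E.
  apply: (@derive_val _ _ _ y.2 1 _ _ (@is_derive_quadratic _ _ y.2 1 _ C _)) => h.
  rewrite /quadratic /sqdist /= !subrr !dotv0 [h *: 1]/GRing.scale/= mulr1 addrK; ring.
apply/rowP => j; rewrite mxE.
apply: (@derive_val _ _ _ y.1 (delta_mx 0 j) _ _ (@is_derive_quadratic _ _ y.1 _ _
  (C * dotv (delta_mx 0 j) (delta_mx 0 j)) _)) => h.
rewrite /quadratic /sqdist /= !subrr addrK !dotvE (dotv_delta q); ring.
Qed.

Variables (T : \bar R) (H : 'rV[R]_N -> R -> 'rV[R]_N -> R).

Lemma subsolution_test (u : spacetime -> R) y q tau C :
  viscosity_subsolution T H u -> cylinder T y ->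
  (\forall w \near y, u w <= u y + quadratic y q tau C w) ->
  tau + H y.1 y.2 q <= 0.
Proof.
move=> usub yT uq; rewrite -(quadratic_HJ H y q tau C).
apply: usub => //; first exact: quadratic_C1.
by apply: filterS uq => w; rewrite quadratic_center; lra.
Qed.

Lemma supersolution_test (u : spacetime -> R) y q tau C :
  viscosity_supersolution T H u -> cylinder T y ->
  (\forall w \near y, u y + quadratic y q tau C w <= u w) ->
  0 <= tau + H y.1 y.2 q.
Proof.
move=> usup yT uq; rewrite -(quadratic_HJ H y q tau C).
apply: usup => //; first exact: quadratic_C1.
by apply: filterS uq => w; rewrite quadratic_center; lra.
Qed.

End quadratic_tests.

(** * The penalization and its minima *)

Section penalization.
Context {R : realType} {N : nat}.
Local Notation spacetime := ('rV[R]_N * R)%type.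

Lemma expR_le_quadratic (z : R) : z <= 2^-1 -> expR z <= 1 + z + 2 * z ^+ 2.
Proof.
move=> z2; have z1 : 0 < 1 - z by lra.
have h1 : 1 - z <= expR (- z) by exact: expR_ge1Dx.
rewrite expRN in h1.
have e0 := expR_gt0 z.
have h2 : (1 - z) * expR z <= 1.
  apply: (@le_trans _ _ ((expR z)^-1 * expR z)).
    by apply: ler_wpM2r; [exact: ltW|exact: h1].
  by rewrite mulVf// gt_eqF.
have h3 : 1 <= (1 - z) * (1 + z + 2 * z ^+ 2).
  have -> : (1 - z) * (1 + z + 2 * z ^+ 2) = 1 + z ^+ 2 * (1 - 2 * z) by ring.
  by rewrite lerDl mulr_ge0 ?sqr_ge0//; lra.
by rewrite -(ler_pM2l z1); exact: le_trans h2 h3.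
Qed.

Definition pos_part_sq (v : R) : R := Num.max 0 v ^+ 2.

Lemma pos_part_sq_ge0 v : 0 <= pos_part_sq v.
Proof. exact: sqr_ge0. Qed.

Lemma pos_part_sq_le v w : v <= w -> pos_part_sq v <= pos_part_sq w.
Proof.
move=> vw; have m0 (x : R) : 0 <= Num.max 0 x by rewrite le_max lexx.
rewrite /pos_part_sq lerXn2r ?nnegrE//.
by rewrite ge_max !le_max lexx vw orbT.
Qed.

Lemma pos_part_sq_expansion v w :
  pos_part_sq (v + w) <= pos_part_sq v + 2 * Num.max 0 v * w + w ^+ 2.
Proof.
have sq := sqr_ge0 (v + w).
rewrite /pos_part_sq; have [v0|v0] := leP 0 v; have [vw0|vw0] := leP 0 (v + w).
- by rewrite (_ : (v + w) ^+ 2 = v ^+ 2 + 2 * v * w + w ^+ 2)//; ring.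
- rewrite (_ : v ^+ 2 + 2 * v * w + w ^+ 2 = (v + w) ^+ 2); last by ring.
  by rewrite expr0n.
- rewrite expr0n mulr0 mul0r !add0r lerXn2r ?nnegrE//; last by lra.
  lra.
- by rewrite expr0n mulr0 mul0r !add0r sqr_ge0.
Qed.

Lemma sqdist_ge0 (y w : spacetime) : 0 <= sqdist y w.
Proof. by rewrite /sqdist addr_ge0 ?dotv_ge0// sqr_ge0. Qed.

Lemma sqdist_near (y : spacetime) (e : R) : 0 < e ->
  \forall w \near y, sqdist y w < e.
Proof.
move=> e0.
have qc : {for y, continuous (quadratic y 0 0 1)}.
  exact: differentiable_continuous (quadratic_differentiable _ _ _ _ _).
have qE w : quadratic y 0 0 1 w = sqdist y w.
  by rewrite /quadratic dot0v mul0r !add0r mul1r.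
have : \forall w \near y, quadratic y 0 0 1 w < e.
  by apply: (cvgr_lt _ qc); rewrite quadratic_center.
by apply: filterS => w; rewrite qE.
Qed.

(** The square of an affine increment of size [O(|w - y|)], kept explicit because the
    constant of the test function in [penalized_subjet] is built from it. *)
Lemma linear_form_sq (y w : spacetime) (g : 'rV[R]_N) (gam beta c : R) :
  0 <= beta -> 0 <= c -> sqdist y w <= 1 ->
  (dotv g (w.1 - y.1) + gam * (w.2 - y.2) +
    (beta * dotv (w.1 - y.1) (w.1 - y.1) + c * (w.2 - y.2) ^+ 2)) ^+ 2 <=
  3 * (dotv g g + gam ^+ 2 + (beta + c) ^+ 2) * sqdist y w.
Proof.
move=> b0 c0; rewrite /sqdist; set Y := w.1 - y.1; set t := w.2 - y.2 => N1.
have Y0 := dotv_ge0 Y; have t0 := sqr_ge0 t.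
set A := dotv g Y; set B := gam * t; set C := _ + c * _.
have h3 : (A + B + C) ^+ 2 <= 3 * (A ^+ 2 + B ^+ 2 + C ^+ 2).
  rewrite -subr_ge0 (_ : _ - _ = (A - B) ^+ 2 + (B - C) ^+ 2 + (A - C) ^+ 2); last by ring.
  by rewrite !addr_ge0// sqr_ge0.
apply: le_trans h3 _; rewrite -[leRHS]mulrA ler_wpM2l//.
have hA : A ^+ 2 <= dotv g g * dotv Y Y.
  rewrite -!sqr_enorm -exprMn -real_normK ?num_real//.
  by rewrite lerXn2r ?nnegrE ?mulr_ge0 ?enorm_ge0// cauchy_schwarz.
have C0 : 0 <= C by rewrite addr_ge0// mulr_ge0.
have hC1 : C <= (beta + c) * (dotv Y Y + t ^+ 2).
  rewrite -subr_ge0 (_ : _ - _ = beta * t ^+ 2 + c * dotv Y Y); last by rewrite /C; ring.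
  by rewrite addr_ge0// mulr_ge0.
have hC : C ^+ 2 <= (beta + c) ^+ 2 * (dotv Y Y + t ^+ 2).
  apply: (@le_trans _ _ (((beta + c) * (dotv Y Y + t ^+ 2)) ^+ 2)).
    by rewrite lerXn2r ?nnegrE// mulr_ge0 ?addr_ge0.
  by rewrite exprMn ler_wpM2l ?sqr_ge0// expr2 ler_piMl// addr_ge0.
have hB : B ^+ 2 = gam ^+ 2 * t ^+ 2 by rewrite exprMn.
have g0 := mulr_ge0 (sqr_ge0 gam) Y0; have d0 := mulr_ge0 (dotv_ge0 g) t0.
by move: hC; rewrite hB; lra.
Qed.

Variables (L M A m beta c : R) (xs : 'rV[R]_N) (ts : R).
Hypotheses (L0 : 0 <= L) (A0 : 0 <= A) (beta0 : 0 <= beta) (c0 : 0 <= c).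

(** The height of [u] above its lower bound [m], increased away from [(xs, ts)] so that
    the sublevel sets of [level] lie close to that point. *)
Definition level (u : spacetime -> R) (w : spacetime) : R :=
  u w - m + (beta * dotv (w.1 - xs) (w.1 - xs) + c * (w.2 - ts) ^+ 2).

(** The factor 16 gives [slope' = 16 * slope], from which the smallness condition
    [16 * (t - s) * E <= D] of [scaled_hamiltonian_lt] arises. *)
Definition slope (v : R) : R := L * expR (16 * v).

(** Vanishes on [level <= M] and exceeds the oscillation of [u] on
    [level >= M + 1] when [A] does. *)
Definition cutoff (v : R) : R := A * pos_part_sq (v - M).

Definition penalty (u : spacetime -> R) (s : R) (w : spacetime) : R :=
  (w.2 - s) * slope (level u w) + cutoff (level u w).

Lemma slope_ge0 v : 0 <= slope v.
Proof. by rewrite mulr_ge0// expR_ge0. Qed.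

Lemma slope_le v w : v <= w -> slope v <= slope w.
Proof. by move=> vw; rewrite ler_wpM2l// ler_expR ler_wpM2l. Qed.

Lemma cutoff_le v w : v <= w -> cutoff v <= cutoff w.
Proof. by move=> vw; rewrite ler_wpM2l// pos_part_sq_le// lerB. Qed.

Lemma slope_expansion v W : 16 * W <= 2^-1 ->
  slope (v + W) <= slope v * (1 + 16 * W + 512 * W ^+ 2).
Proof.
move=> W2; rewrite /slope mulrDr expRD mulrA ler_wpM2l ?slope_ge0//.
apply: le_trans (expR_le_quadratic W2) _.
by rewrite le_eqVlt; apply/orP; left; apply/eqP; ring.
Qed.

Lemma cutoff_expansion v W :
  cutoff (v + W) <= cutoff v + 2 * A * Num.max 0 (v - M) * W + A * W ^+ 2.
Proof.
rewrite /cutoff addrAC.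
have := ler_wpM2l A0 (pos_part_sq_expansion (v - M) W).
by move/le_trans; apply; rewrite le_eqVlt; apply/orP; left; apply/eqP; ring.
Qed.

(** Subjets of [u] at a minimum of [u + penalty + n * |x - .|^2]. Since the penalty
    depends on [u] through [level], whose gradient at [y] is that of [u] plus
    [(d, gam)], the first order condition reads
    [Du + D * (Du + d) = p] and [u_t + E + D * (u_t + gam) = 0],
    where [D] is the derivative of the penalty with respect to [level]; solving it
    gives the stated subjet. As [u] need not be differentiable, the lower bound is
    proved by contradiction: if [u w] were below the quadratic, [level u w] would be
    at most [level u y + W] with [W] explicit, and monotonicity of [slope] and
    [cutoff] would contradict minimality once [C] is negative enough to absorb the
    second order terms. *)
Lemma penalized_subjet (u : spacetime -> R) (y : spacetime) (x : 'rV[R]_N) (s n : R)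
    (D E : R) (d p : 'rV[R]_N) (gam : R) :
  0 <= n -> s < y.2 ->
  E = slope (level u y) ->
  D = (y.2 - s) * (16 * E) + 2 * A * Num.max 0 (level u y - M) ->
  d = (2 * beta) *: (y.1 - xs) -> gam = 2 * c * (y.2 - ts) ->
  p = (2 * n) *: (x - y.1) ->
  (\forall w \near y,
     u y + penalty u s y + n * dotv (x - y.1) (x - y.1) <=
     u w + penalty u s w + n * dotv (x - w.1) (x - w.1)) ->
  exists C, \forall w \near y,
    u y + quadratic y ((1 + D)^-1 *: (p + d) - d)
                      (- (E + D * gam) / (1 + D)) C w <= u w.
Proof.
move=> n0 sy EE DE dE gamE pE miny.
set q := _ - d; set tau := _ / (1 + D).
set theta := y.2 - s in DE; have th0 : 0 < theta by rewrite subr_gt0.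
have E0 : 0 <= E by rewrite EE slope_ge0.
have mx0 : 0 <= Num.max 0 (level u y - M) by rewrite le_max lexx.
have D0 : 0 <= D.
  by rewrite DE addr_ge0// !mulr_ge0// ltW.
have D1 : 0 < 1 + D by lra.
pose K2 := 3 * (dotv (q + d) (q + d) + (tau + gam) ^+ 2 + (beta + c) ^+ 2).
have K20 : 0 <= K2 by rewrite mulr_ge0// !addr_ge0 ?dotv_ge0 ?sqr_ge0.
pose K := D * (beta + c) + 8 * E * (1 + K2) + 512 * (theta + 1) * E * K2 + A * K2 + n.
have K0 : 0 <= K.
  have k1 : 0 <= D * (beta + c) by apply: mulr_ge0 => //; exact: addr_ge0.
  have k2 : 0 <= 8 * E * (1 + K2).
    by apply: mulr_ge0; [exact: mulr_ge0|lra].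
  have k3 : 0 <= 512 * (theta + 1) * E * K2.
    apply: mulr_ge0; [apply: mulr_ge0; [apply: mulr_ge0; [exact: ler0n|]|]|].
    - by apply: addr_ge0; [exact: ltW|exact: ler01].
    - exact: E0.
    - exact: K20.
  have k4 := mulr_ge0 A0 K20.
  by rewrite /K; lra.
exists (- K).
have r1 : 0 < Num.min 1 (theta ^+ 2) by rewrite lt_min ltr01 exprn_gt0.
have r2 : 0 < (1024 * (K2 + 1))^-1 by rewrite invr_gt0; lra.
have near1 := sqdist_near y r1; have near2 := sqdist_near y r2.
near=> w.
have N1 : sqdist y w < Num.min 1 (theta ^+ 2) by near: w.
have N2 : sqdist y w < (1024 * (K2 + 1))^-1 by near: w.
have minw : u y + penalty u s y + n * dotv (x - y.1) (x - y.1) <=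
     u w + penalty u s w + n * dotv (x - w.1) (x - w.1) by near: w.
move: N1; rewrite lt_min => /andP[N1 Nth].
rewrite leNgt; apply/negP => bad.
pose Y := w.1 - y.1; pose t := w.2 - y.2.
have NE : sqdist y w = dotv Y Y + t ^+ 2 by [].
have Y0 := dotv_ge0 Y; have t20 := sqr_ge0 t.
have NS0 := sqdist_ge0 y w.
pose l := dotv q Y + tau * t.
pose W := dotv (q + d) Y + (tau + gam) * t + (beta * dotv Y Y + c * t ^+ 2).
have W2 : W ^+ 2 <= K2 * sqdist y w.
  by have := @linear_form_sq y w (q + d) (tau + gam) beta c beta0 c0 (ltW N1).
have wtE : level u w = level u y + (u w - u y) + (W - l).
  rewrite /level /W /l dE gamE.
  have -> : w.1 - xs = (y.1 - xs) + Y.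
    by rewrite /Y; apply/rowP => j; rewrite !mxE; ring.
  have -> : w.2 - ts = (y.2 - ts) + t by rewrite /t; ring.
  by rewrite (dotvDl (y.1 - xs)) !(dotvDr _ (y.1 - xs)) (dotvC Y (y.1 - xs))
    (dotvDl q) (dotvZl _ (y.1 - xs)); ring.
have badr : u w - u y < l - K * sqdist y w.
  by move: bad; rewrite /quadratic -/Y -/t /l; clear - L0 A0 beta0 c0 M m xs ts N; lra.
have KN0 : 0 <= K * sqdist y w by rewrite mulr_ge0.
have lvl : level u w <= level u y + W.
  by rewrite wtE; move: badr KN0; clear - L0 A0 beta0 c0 M m xs ts N; lra.
have tth : - theta <= t.
  rewrite lerNl; apply: le_trans (ler_norm _) _; rewrite normrN.
  rewrite -ler_sqr ?nnegrE// ?ltW// real_normK ?num_real//.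
  by move: Nth Y0; rewrite NE; clear - L0 A0 beta0 c0 M m xs ts N; lra.
have t1 : t <= 1.
  apply: le_trans (ler_norm _) _.
  rewrite -ler_sqr ?nnegrE// real_normK ?num_real// expr1n.
  by move: N1 Y0; rewrite NE; clear - L0 A0 beta0 c0 M m xs ts N; lra.
have W16 : 16 * W <= 2^-1.
  have : W ^+ 2 <= (32^-1) ^+ 2.
    apply: le_trans W2 _; apply: (@le_trans _ _ (K2 * (1024 * (K2 + 1))^-1)).
      by rewrite ler_wpM2l// ltW.
    rewrite ler_pdivrMr; last by move: K20; clear - L0 A0 beta0 c0 M m xs ts N; lra.
    by rewrite (_ : (32^-1) ^+ 2 = 1024^-1 :> R); [move: K20; clear - L0 A0 beta0 c0 M m xs ts N; lra|field].
  move=> h; have : W <= 32^-1.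
    apply: le_trans (ler_norm _) _.
    by rewrite -ler_sqr ?nnegrE ?invr_ge0// real_normK ?num_real.
  by clear - L0 A0 beta0 c0 M m xs ts N; lra.
have sl : slope (level u w) <= E * (1 + 16 * W + 512 * W ^+ 2).
  by apply: le_trans (slope_le lvl) _; rewrite EE; exact: slope_expansion.
have co : cutoff (level u w) <= cutoff (level u y) +
    2 * A * Num.max 0 (level u y - M) * W + A * W ^+ 2.
  by apply: le_trans (cutoff_le lvl) _; exact: cutoff_expansion.
have tht : 0 <= theta + t by rewrite -(opprK theta) addrC subr_ge0.
have thw : w.2 - s = theta + t by rewrite /theta /t; ring.
have sl2 : (theta + t) * slope (level u w) <=
    (theta + t) * (E * (1 + 16 * W + 512 * W ^+ 2)).
  by rewrite ler_wpM2l.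
have quadn : n * dotv (x - w.1) (x - w.1) =
    n * dotv (x - y.1) (x - y.1) - dotv p Y + n * dotv Y Y.
  have -> : x - w.1 = (x - y.1) - Y.
    by rewrite /Y; apply/rowP => j; rewrite !mxE; ring.
  by rewrite pE (dotvBl (x - y.1)) !(dotvBr _ (x - y.1)) (dotvC Y (x - y.1)) (dotvZl _ (x - y.1)); ring.
have ident : l + t * E + D * (W - (beta * dotv Y Y + c * t ^+ 2)) - dotv p Y = 0.
  rewrite /W /l /q /tau.
  rewrite !(dotvBl _ d) subrK !dotvZl !dotvDl.
  by field; rewrite gt_eqF.
have tW : t * W <= (t ^+ 2 + W ^+ 2) / 2.
  have := sqr_ge0 (t - W); rewrite (_ : (t - W) ^+ 2 = t ^+ 2 + W ^+ 2 - 2 * (t * W)); last by ring.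
  by clear - L0 A0 beta0 c0 M m xs ts N; lra.
have b1 : D * (beta * dotv Y Y + c * t ^+ 2) <= D * (beta + c) * sqdist y w.
  rewrite -mulrA ler_wpM2l// NE -subr_ge0.
  rewrite (_ : _ - _ = beta * t ^+ 2 + c * dotv Y Y); last by ring.
  by rewrite addr_ge0// mulr_ge0.
have b2 : 16 * E * (t * W) <= 8 * E * (1 + K2) * sqdist y w.
  apply: (@le_trans _ _ (16 * E * ((t ^+ 2 + W ^+ 2) / 2))).
    by rewrite ler_wpM2l// mulr_ge0.
  rewrite (_ : 16 * E * ((t ^+ 2 + W ^+ 2) / 2) = 8 * E * (t ^+ 2 + W ^+ 2)); last by field.
  rewrite -[leRHS]mulrA ler_wpM2l ?mulr_ge0//.
  by move: W2 Y0; rewrite mulrDl mul1r {2}NE; clear - L0 A0 beta0 c0 M m xs ts N; lra.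
have b3 : 512 * (theta + t) * E * W ^+ 2 <= 512 * (theta + 1) * E * K2 * sqdist y w.
  rewrite -[leRHS]mulrA; apply: ler_pM; last exact: W2.
  - apply: mulr_ge0; last exact: E0.
    by apply: mulr_ge0; [exact: ler0n|exact: tht].
  - exact: sqr_ge0.
  - apply: ler_wpM2r; first exact: E0.
    by apply: ler_wpM2l; [exact: ler0n|rewrite lerD2l].
have b4 : A * W ^+ 2 <= A * K2 * sqdist y w by rewrite -mulrA ler_wpM2l.
have b5 : n * dotv Y Y <= n * sqdist y w by rewrite ler_wpM2l// NE lerDl.
move: minw; rewrite /penalty -/theta thw quadn -EE.
have KE : K * sqdist y w = D * (beta + c) * sqdist y w + 8 * E * (1 + K2) * sqdist y w +
  512 * (theta + 1) * E * K2 * sqdist y w + A * K2 * sqdist y w + n * sqdist y w.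
  by rewrite /K; ring.
have DW : D * W = theta * E * (16 * W) + 2 * A * Num.max 0 (level u y - M) * W.
  by rewrite DE; ring.
have slE : (theta + t) * (E * (1 + 16 * W + 512 * W ^+ 2)) = theta * E + t * E
   + theta * E * (16 * W) + 16 * E * (t * W) + 512 * (theta + t) * E * W ^+ 2 by ring.
have DWq : D * (W - (beta * dotv Y Y + c * t ^+ 2)) = D * W -
  D * (beta * dotv Y Y + c * t ^+ 2) by ring.
rewrite leNgt => /negP; apply.
move: sl2 co ident badr b1 b2 b3 b4 b5; rewrite slE DWq KE DW.
set v1 := D * (beta * _ + _). set v2 := _ * slope (level u w).
set v3 := 16 * E * _. set v4 := 512 * _ * E * W ^+ 2. set v5 := A * W ^+ 2.
set v6 := n * dotv Y Y.
clear - L0 A0 beta0 c0 M m xs ts N; lra.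
Unshelve. all: by end_near.
Qed.

End penalization.

(** * Compact boxes *)

Section compactness.
Context {R : realType}.

Lemma compact_unif_continuous (V : normedModType R) (f : V -> R) (K : set V) (e : R) :
  compact K -> (forall a, K a -> {for a, continuous f}) -> 0 < e ->
  exists2 d, 0 < d & forall a b, K a -> `|a - b| < d -> `|f a - f b| < e.
Proof.
move=> cK fc e0.
have e20 : 0 < e / 2 by rewrite divr_gt0.
have /compact_near_coveringP := cK.
move=> /(_ _ (0^'+ : set_system R)
  (fun (d : R) (a : V) => forall b, `|a - b| < d -> `|f a - f b| < e) _).
case.
- move=> a Ka.
  have : \forall b \near a, `|f a - f b| < e / 2.
    exact: (@cvgr_dist_lt _ _ _ (nbhs a) _ f (f a) (fc a Ka) _ e20).
  case/nbhs_ballP => d /= d0 dP.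
  have d20 : 0 < d / 2 by rewrite divr_gt0.
  exists (ball a (d / 2), [set r : R | r < d / 2]) => /=.
    split; first exact: nbhsx_ballx.
    exact: nbhs_right_lt.
  move=> [b r] /= [ab rd] b' bb'.
  have fab : `|f a - f b| < e / 2 by apply: dP; apply: le_ball ab; lra.
  have fab' : `|f a - f b'| < e / 2.
    apply: dP; rewrite (splitr d); apply: ball_triangle ab _.
    by rewrite -ball_normE /=; exact: lt_trans bb' rd.
  move: fab fab'; rewrite !ltr_norml => /andP[? ?] /andP[? ?].
  by apply/andP; split; lra.
- move=> d /= d0 dP; exists (d / 2); first by rewrite divr_gt0.
  move=> a b Ka; apply: (dP (d / 2)) => //=.
    rewrite sub0r normrN gtr0_norm ?divr_gt0//; lra.
  by rewrite divr_gt0.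
Qed.

Lemma segment_box_compact n (a b : 'rV[R]_n) :
  compact [set v : 'rV[R]_n | forall j, a 0 j <= v 0 j <= b 0 j].
Proof.
have := @rV_compact R n (fun j => `[a 0 j, b 0 j]%classic) (fun j => @segment_compact R _ _).
congr compact; apply/seteqP; split => v /= h j; have := h j; by rewrite in_itv.
Qed.

Lemma compact_prod_set (U V : topologicalType) (A : set U) (B : set V) :
  compact A -> compact B -> compact [set w : U * V | A w.1 /\ B w.2].
Proof. exact: compact_setX. Qed.

End compactness.

Section boxes.
Context {R : realType} {N : nat}.
Local Notation spacetime := ('rV[R]_N * R)%type.

Definition box (y : spacetime) (r tau : R) : set spacetime :=
  [set w : spacetime | (forall j, y.1 0 j - r <= w.1 0 j <= y.1 0 j + r) /\
           y.2 - tau <= w.2 <= y.2 + tau].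

Lemma box_compact y r tau : compact (box y r tau).
Proof.
have := compact_prod_set
  (@segment_box_compact R N (\row_j (y.1 0 j - r)) (\row_j (y.1 0 j + r)))
  (@segment_compact R (y.2 - tau) (y.2 + tau)).
congr compact; apply/seteqP; split => w /= [h1 h2].
  split; last by move: h2; rewrite in_itv.
  by move=> j; have := h1 j; rewrite !mxE.
by split; [move=> j; rewrite !mxE|rewrite in_itv].
Qed.

Lemma box_nbhs y r tau w : `|w.1 - y.1| < r -> `|w.2 - y.2| < tau ->
  \forall z \near w, box y r tau z.
Proof.
move=> w1 w2; apply/nbhs_ballP.
pose e := Num.min (r - `|w.1 - y.1|) (tau - `|w.2 - y.2|).
have e0 : 0 < e by rewrite lt_min !subr_gt0 w1.
have er : e <= r - `|w.1 - y.1| by rewrite ge_min lexx.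
have et : e <= tau - `|w.2 - y.2| by rewrite ge_min lexx orbT.
exists e => //= z [z1 z2].
rewrite -ball_normE /= in z1; have {}z2 : `|w.2 - z.2| < e := z2.
split; last first.
  have : `|z.2 - y.2| <= tau.
    apply: le_trans (ler_distD w.2 _ _) _; rewrite (distrC z.2); lra.
  by rewrite ler_norml => /andP[? ?]; apply/andP; split; lra.
move=> j.
have : `|(z.1 - y.1) 0 j| <= r.
  apply: le_trans (coord_norm_le _ j) _.
  apply: le_trans (ler_distD w.1 _ _) _; rewrite (distrC z.1); lra.
by rewrite !mxE ler_norml => /andP[? ?]; apply/andP; split; lra.
Qed.

(** Coercivity in the form in which it is used: momenta in a sublevel of [H] over a
    compact set are bounded. *)
Lemma coercive_bound (T : \bar R) (H : 'rV[R]_N -> R -> 'rV[R]_N -> R)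
    (K : set spacetime) (M : R) :
  H2 T H -> compact K -> K `<=` cylinder T ->
  exists2 r, 0 < r & forall y p, K y -> H y.1 y.2 p <= M -> enorm p < r.
Proof.
move=> h2 cK KT.
have [|r rP] := h2 K cK _ (M + 1).
  by move=> y /KT[y0 yT]; split => //; exact: ltW.
exists (Num.max r 1); first by rewrite lt_max ltr01 orbT.
move=> y p Ky HM; rewrite ltNge ge_max; apply/negP => /andP[rp _].
by have := rP y p Ky rp; lra.
Qed.

Lemma cylinder_open (T : \bar R) : open (@cylinder R N T).
Proof.
rewrite (_ : cylinder T = snd @^-1` [set t | 0 < t] `&`
  snd @^-1` [set t | (t%:E < T)%E])//.
apply: openI; (apply: open_comp; first by move=> *; exact: cvg_snd).
  exact: open_gt.
exact: open_lt_ereal.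
Qed.

Lemma cylinder_continuous (T : \bar R) (u : spacetime -> R) y :
  {within cylinder T, continuous u} -> cylinder T y -> {for y, continuous u}.
Proof.
rewrite continuous_open_subspace; last exact: cylinder_open.
by move=> uc yT; apply: uc; rewrite inE.
Qed.

End boxes.

(** * Doubling of the space variable *)

Section doubling.
Context {R : realType} {N : nat}.
Local Notation spacetime := ('rV[R]_N * R)%type.

Lemma level_continuous (m beta c : R) (xs : 'rV[R]_N) (ts : R) (u : spacetime -> R) w :
  {for w, continuous u} -> {for w, continuous (level m beta c xs ts u)}.
Proof.
move=> uc.
have qc : {for w, continuous (quadratic (xs, ts) 0 0 beta)}.
  exact: differentiable_continuous (quadratic_differentiable _ _ _ _ _).
have tc : (z.2 - ts) ^+ 2 @[z --> w] --> (w.2 - ts) ^+ 2.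
  have t1 : z.2 - ts @[z --> w] --> w.2 - ts by apply: cvgB; [exact: cvg_snd|exact: cvg_cst].
  exact: (cvgM t1 t1).
have lE z : level m beta c xs ts u z =
    u z - m + (quadratic (xs, ts) 0 0 beta z + (c - beta) * (z.2 - ts) ^+ 2).
  by rewrite /level /quadratic /sqdist /= dot0v; ring.
rewrite /prop_for /continuous_at lE (funext lE).
apply: cvgD; first by apply: cvgB; [exact: uc|exact: cvg_cst].
by apply: cvgD; [exact: qc|apply: cvgM; [exact: cvg_cst|exact: tc]].
Qed.

Lemma slope_continuous (L : R) : continuous (slope L).
Proof.
move=> v; apply: cvgM; first exact: cvg_cst.
apply: continuous_cvg; first exact: continuous_expR.
by apply: cvgM; [exact: cvg_cst|exact: cvg_id].
Qed.

Lemma cutoff_continuous (M A : R) : continuous (cutoff M A).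
Proof.
have mc : continuous (fun v : R => Num.max 0 (v - M)).
  apply: fun_continuous_max; first exact: fun_continuous_cst.
  by apply: fun_continuousB; [move=> v; exact: cvg_id|exact: fun_continuous_cst].
move=> v; apply: cvgM; first exact: cvg_cst.
exact: (cvgM (mc v) (mc v)).
Qed.

Variables (L M A m beta c n : R) (xs : 'rV[R]_N) (ts : R).
Variable u : spacetime -> R.

(** Only the space variable is doubled by a penalty: the two times stay independent,
    and their difference carries the estimate. *)
Definition doubled (ab : spacetime * spacetime) : R :=
  u ab.1 - (u ab.2 + penalty L M A m beta c xs ts u ab.1.2 ab.2
            + n * dotv (ab.1.1 - ab.2.1) (ab.1.1 - ab.2.1)).

Lemma doubled_continuous a b :
  {for a, continuous u} -> {for b, continuous u} -> {for (a, b), continuous doubled}.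
Proof.
move=> ua ub.
have f1 : z.1 @[z --> ((a, b) : spacetime * spacetime)] --> a by exact: cvg_fst.
have f2 : z.2 @[z --> ((a, b) : spacetime * spacetime)] --> b by exact: cvg_snd.
have t1 : z.1.2 @[z --> ((a, b) : spacetime * spacetime)] --> a.2.
  by apply: cvg_comp f1 _; exact: cvg_snd.
have t2 : z.2.2 @[z --> ((a, b) : spacetime * spacetime)] --> b.2.
  by apply: cvg_comp f2 _; exact: cvg_snd.
have x1 : z.1.1 @[z --> ((a, b) : spacetime * spacetime)] --> a.1.
  by apply: cvg_comp f1 _; exact: cvg_fst.
have x2 : z.2.1 @[z --> ((a, b) : spacetime * spacetime)] --> b.1.
  by apply: cvg_comp f2 _; exact: cvg_fst.
have l2 : level m beta c xs ts u z.2 @[z --> ((a, b) : spacetime * spacetime)] -->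
    level m beta c xs ts u b.
  by apply: cvg_comp f2 _; exact: level_continuous.
have xx : enorm (z.1.1 - z.2.1) @[z --> ((a, b) : spacetime * spacetime)] -->
    enorm (a.1 - b.1).
  by apply: cvg_comp (cvgB x1 x2) _; exact: enorm_continuous.
have dE (z : spacetime * spacetime) : doubled z = u z.1 - (u z.2 +
   ((z.2.2 - z.1.2) * slope L (level m beta c xs ts u z.2) +
    cutoff M A (level m beta c xs ts u z.2)) +
   n * (enorm (z.1.1 - z.2.1) * enorm (z.1.1 - z.2.1))).
  by rewrite /doubled /penalty -sqr_enorm expr2.
rewrite /prop_for /continuous_at dE (funext dE).
apply: cvgB; first by apply: cvg_comp f1 _; exact: ua.
apply: cvgD; last by apply: cvgM; [exact: cvg_cst|exact: (cvgM xx xx)].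
apply: cvgD; first by apply: cvg_comp f2 _; exact: ub.
apply: cvgD; last by apply: cvg_comp l2 _; exact: cutoff_continuous.
by apply: cvgM; [exact: (cvgB t2 t1)|apply: cvg_comp l2 _; exact: slope_continuous].
Qed.

Lemma doubled_max (K : set spacetime) :
  K !=set0 -> compact K -> (forall a, K a -> {for a, continuous u}) ->
  exists a b, [/\ K a, K b, a.2 <= b.2 &
    forall a' b', K a' -> K b' -> a'.2 <= b'.2 -> doubled (a', b') <= doubled (a, b)].
Proof.
move=> [k Kk] cK uc.
pose KK := [set ab : spacetime * spacetime | K ab.1 /\ K ab.2] `&`
  (fun ab : spacetime * spacetime => ab.2.2 - ab.1.2) @^-1` [set x | 0 <= x].
have cKK : compact KK.
  apply: compact_closedI; first exact: compact_prod_set.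
  apply: closed_comp; last exact: closed_ge.
  move=> ab _; apply: cvgB.
    by apply: (@continuous_comp _ _ _ snd snd); exact: cvg_snd.
  by apply: (@continuous_comp _ _ _ fst snd); [exact: cvg_fst|exact: cvg_snd].
have KK0 : KK !=set0 by exists (k, k); split => //=; rewrite subrr.
have dc : {within KK, continuous doubled}.
  apply: continuous_in_subspaceT => ab; rewrite inE => -[[Ka Kb] _].
  by case: ab Ka Kb => a b /= Ka Kb; apply: doubled_continuous; exact: uc.
have [[a b]] := compact_EVT_max KK0 cKK dc.
rewrite inE => -[[/= Ka Kb]]; rewrite subr_ge0 => ab maxab.
exists a, b; split => // a' b' Ka' Kb' ab'; apply: maxab; rewrite inE.
by split => //=; rewrite subr_ge0.
Qed.

End doubling.

(** * One-sided Lipschitz estimate in time *)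

Section time_estimate.
Context {R : realType} {N : nat}.
Local Notation spacetime := ('rV[R]_N * R)%type.
Variables (T : \bar R) (H : 'rV[R]_N -> R -> 'rV[R]_N -> R).
Variables (c0 : R) (phi : R -> R) (c1 : R).
Hypotheses (hH0 : H0 T H c0 phi) (hH1 : H1 T H c0 phi c1) (hH2 : H2 T H).
Variables (u : spacetime -> R) (m : R).
Hypothesis u_cont : forall y, cylinder T y -> {for y, continuous u}.
Hypothesis u_ge : forall y, cylinder T y -> m <= u y.
Hypothesis u_sol : viscosity_solution T H u.

(** The sub- and supersolution inequalities at an interior maximum of [doubled] with
    distinct times. In [a] the function [u] is touched from above by a quadratic; in
    [b] the minimum is that of [penalized_subjet]. *)
Lemma doubled_inequalities (L M A beta c n : R) (z a b : spacetime) (rho tau : R)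
    (D E : R) (d p : 'rV[R]_N) (gam : R) :
  0 <= L -> 0 <= A -> 0 <= beta -> 0 <= c -> 0 <= n ->
  box z rho tau `<=` cylinder T ->
  (\forall w \near a, box z rho tau w) -> (\forall w \near b, box z rho tau w) ->
  a.2 < b.2 ->
  (forall a' b', box z rho tau a' -> box z rho tau b' -> a'.2 <= b'.2 ->
    doubled L M A m beta c n z.1 z.2 u (a', b') <=
    doubled L M A m beta c n z.1 z.2 u (a, b)) ->
  E = slope L (level m beta c z.1 z.2 u b) ->
  D = (b.2 - a.2) * (16 * E) +
      2 * A * Num.max 0 (level m beta c z.1 z.2 u b - M) ->
  d = (2 * beta) *: (b.1 - z.1) -> gam = 2 * c * (b.2 - z.2) ->
  p = (2 * n) *: (a.1 - b.1) ->
  H a.1 a.2 p <= E /\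
  E + D * gam <= (1 + D) * H b.1 b.2 ((1 + D)^-1 *: (p + d) - d).
Proof.
move=> L0 A0 beta0 c_ge0 n0 KT neara nearb ab maxab EE DE dE gamE pE.
have Ka : box z rho tau a by exact: nbhs_singleton neara.
have Kb : box z rho tau b by exact: nbhs_singleton nearb.
have [usub usup] := u_sol.
split.
  have test : \forall w \near a, u w <= u a + quadratic a p (- E) n w.
    have lt_b : \forall w \near a, w.2 < b.2.
      exact: (@cvgr_lt _ _ _ _ snd a.2 cvg_snd b.2 ab).
    near=> w.
    have Kw : box z rho tau w by near: w.
    have wb : w.2 < b.2 by near: w.
    have := maxab w b Kw Kb (ltW wb).
    rewrite /doubled /penalty /= -EE /quadratic /sqdist pE.
    set Y := w.1 - a.1.
    have -> : w.1 - b.1 = (a.1 - b.1) + Y.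
      by rewrite /Y; apply/rowP => j; rewrite !mxE; ring.
    rewrite (dotvDl (a.1 - b.1)) !(dotvDr _ (a.1 - b.1)) (dotvC Y (a.1 - b.1)) dotvZl.
    have := mulr_ge0 n0 (sqr_ge0 (w.2 - a.2)).
    set v1 := n * (_ ^+ 2) => v10; rewrite (mulrDr n (dotv Y Y)) -/v1.
    move: v10; move: (cutoff _ _ _) (dotv (a.1 - b.1) (a.1 - b.1)) (dotv (a.1 - b.1) Y) (dotv Y Y).
    move: (u w) (u a) (u b) (w.2) (a.2) (b.2) v1.
    clear; move=> *; lra.
  by have := subsolution_test usub (KT _ Ka) test; lra.
have [|C test] := @penalized_subjet R N L M A m beta c z.1 z.2 L0 A0 beta0 c_ge0 u b a.1 a.2 n
  D E d p gam n0 ab EE DE dE gamE pE.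
  have gt_a : \forall w \near b, a.2 < w.2.
    exact: (@cvgr_gt _ _ _ _ snd b.2 cvg_snd a.2 ab).
  near=> w.
  have Kw : box z rho tau w by near: w.
  have wa : a.2 < w.2 by near: w.
  by have := maxab a w Ka Kw (ltW wa); rewrite /doubled /= lerD2l lerN2 -!addrA.
have := supersolution_test usup (KT _ Kb) test.
have E0 : 0 <= E by rewrite EE; exact: slope_ge0.
have D0 : 0 <= D.
  rewrite DE; apply: addr_ge0.
    apply: mulr_ge0; first by rewrite subr_ge0 ltW.
    by apply: mulr_ge0 => //; exact: ler0n.
  by apply: mulr_ge0; [exact: mulr_ge0|rewrite le_max lexx].
have D1 : 0 < 1 + D by lra.
rewrite -(pmulr_rge0 _ D1) mulrDr.
have -> : (1 + D) * (- (E + D * gam) / (1 + D)) = - (E + D * gam).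
  by field; rewrite gt_eqF.
by lra.
Unshelve. all: by end_near.
Qed.

Lemma phi_large (M : R) : exists2 h, c0 < h & c1 < h /\ M <= phi h.
Proof.
have [_ c00 _ [hphi _] _] := hH0.
have [s cs Ms] := phi_unbounded M c00 hphi.
have [_ phim _ _] := hphi.
pose h := Num.max s (c1 + 1).
have sh : s <= h by rewrite le_max lexx.
have ch : c0 < h by exact: lt_le_trans sh.
exists h => //; split.
  have : c1 + 1 <= h by rewrite le_max lexx orbT.
  by apply: lt_le_trans; rewrite ltrDl.
apply: le_trans (ltW Ms) _.
move: sh; rewrite le_eqVlt => /predU1P[->//|sh]; apply: ltW; apply: phim => //.
  by rewrite in_itv/= andbT ltW.
by rewrite in_itv/= andbT ltW.
Qed.

(** The quantity to bound is [u (x, s) - u (x, t)] for [s <= t], by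
    [(t - s) * slope (level)]. If this fails at a point of low level, [doubled] has
    a positive maximum [(a, b)] with [n] large. The cutoff and the quadratic terms
    of [level] keep [a] and [b] in the interior, and continuity of [u] keeps their
    times apart, so [doubled_inequalities] holds. The first inequality bounds
    [H] at [a], hence by coercivity the momentum, so the space variable of [a] can
    be replaced by that of [b] at a small cost, and the second inequality is then
    excluded by [scaled_hamiltonian_lt]. The bound is one-sided in time; the
    equation provides the rest in [superjet_bound]. *)
Lemma time_estimate (z : spacetime) : cylinder T z ->
  exists2 W, nbhs z W & exists2 L, 0 <= L &
    forall x s t, W (x, s) -> W (x, t) -> s <= t -> u (x, s) - u (x, t) <= L * (t - s).
Proof.
move=> zT.
have [Hc c00 _ _ [kappa kappa0 aek]] := hH0.
have hk : kappa_bound T H c0 kappa by [].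
have [e e0 eT] : exists2 e, 0 < e & ball z e `<=` cylinder T.
  have /nbhs_ballP[e e0 eT] : nbhs z (cylinder T).
    by apply: open_nbhs_nbhs; split => //; exact: cylinder_open.
  by exists e.
pose r := e / 4.
have r0 : 0 < r by rewrite divr_gt0.
have slab t : `|t - z.2| <= 2 * r -> 0 < t /\ (t%:E < T)%E.
  move=> tr; apply: (eT (z.1, t)); split; first exact: ballxx.
  by rewrite /ball/= distrC; apply: le_lt_trans tr _; rewrite /r; lra.
(* [z] has level [M - 1]. The choices of [beta] and [c] give level at least [M + 1] when
   [enorm (y - x) >= rho] or [`|t - t'| >= r], and [rho] is so large that the gradient
   [d] of the quadratic term satisfies [kappa * enorm d <= 2^-1]. *)
pose M := u z - m + 1.
have M1 : 1 <= M by rewrite lerDr subr_ge0 u_ge.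
have Mp : 0 < M + 1 by lra.
pose rho := 4 * kappa * (M + 1).
have rho0 : 0 < rho by rewrite !mulr_gt0.
pose beta := (M + 1) / rho ^+ 2.
pose c := (M + 1) / r ^+ 2.
have beta0 : 0 < beta by rewrite divr_gt0// exprn_gt0.
have c_gt0 : 0 < c by rewrite divr_gt0// exprn_gt0.
have betarho : beta * rho ^+ 2 = M + 1.
  by rewrite /beta; field; rewrite gt_eqF.
have cr : c * r ^+ 2 = M + 1 by rewrite /c; field; rewrite gt_eqF.
have kbr : kappa * (2 * beta * rho) = 2^-1.
  by rewrite /beta /rho; field; rewrite !gt_eqF.
(* A bound for the time derivative of the quadratic term. *)
pose sigma := 2 * c * r.
have sigma0 : 0 <= sigma.
  by apply: mulr_ge0; [apply: mulr_ge0; [exact: ler0n|exact: ltW]|exact: ltW].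
have [hmin hc0 [hc1 phih]] := phi_large (4 * (sigma + 2)).
have hmin0 : 0 < hmin by exact: le_lt_trans hc0.
pose K := box z (2 * rho) (2 * r).
have KT : K `<=` cylinder T.
  move=> w [_ /andP[w1 w2]]; apply: slab; rewrite ler_norml.
  by apply/andP; split; lra.
have cK : compact K by exact: box_compact.
have Kz : K z.
  by split; [move=> j|]; apply/andP; split; move: r0 rho0; clear - hH0 hH1 hH2 u_cont u_ge u_sol; lra.
have uK w : K w -> {for w, continuous u} by move=> /KT; exact: u_cont.
have [osc osc1 uosc] : exists2 osc, 1 <= osc & forall a b, K a -> K b -> u a - u b <= osc.
  have cuK : {within K, continuous u}.
    by apply: continuous_in_subspaceT => w; rewrite inE => /uK.
  have K0 : K !=set0 by exists z.
  have [w1 Kw1 max1] := compact_EVT_max K0 cK cuK.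
  have [w2 Kw2 min2] := compact_EVT_min K0 cK cuK.
  have l12 := max1 _ Kw2.
  exists (u w1 - u w2 + 1); first by rewrite lerDr subr_ge0.
  move=> a b Ka Kb.
  have h1 : u a <= u w1 by apply: max1; rewrite inE.
  have h2 : u w2 <= u b by apply: min2; rewrite inE.
  by move: h1 h2; clear - hH0 hH1 hH2 u_cont u_ge u_sol; lra.
have osc0 : 0 < osc by lra.
pose A := osc + 1.
(* At a positive maximum [(t - s) * E <= osc], whence [D <= Dmax]. *)
pose Dmax := 16 * osc + 2 * A.
have A0 : 0 < A by rewrite /A; lra.
have Dmax0 : 0 <= Dmax by rewrite /Dmax; lra.
(* The first summand forces the times of the maximum to be closer than [r]; the others
   are the lower barrier of [scaled_hamiltonian_lt]. *)
pose L := osc / r + (1 + Dmax) * hmin + Dmax * sigma + 1.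
have Losc : osc / r < L.
  have h1 : 0 <= (1 + Dmax) * hmin by rewrite mulr_ge0// ?ltW//; lra.
  have h2 : 0 <= Dmax * sigma by exact: mulr_ge0.
  by rewrite /L; move: h1 h2; clear - hH0 hH1 hH2 u_cont u_ge u_sol; lra.
have L0 : 0 < L by apply: le_lt_trans Losc; rewrite divr_ge0// ltW.
have Lhmin : (1 + Dmax) * hmin + Dmax * sigma < L.
  have h1 : 0 <= osc / r by rewrite divr_ge0// ltW.
  by rewrite /L; move: h1; clear - hH0 hH1 hH2 u_cont u_ge u_sol; lra.
pose lev := level m beta c z.1 z.2 u.
have lev_ge0 w : K w -> 0 <= lev w.
  move=> Kw; rewrite /lev /level addr_ge0//.
    by rewrite subr_ge0 u_ge//; exact: KT.
  by rewrite addr_ge0// mulr_ge0 ?sqr_ge0 ?dotv_ge0// ltW.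
have key x0 s0 t0 : K (x0, s0) -> K (x0, t0) -> s0 <= t0 -> lev (x0, t0) <= M ->
    u (x0, s0) - u (x0, t0) <= (t0 - s0) * slope L (lev (x0, t0)).
  move=> Ka0 Kb0 st0 levM.
  rewrite leNgt; apply/negP => bad.
  pose delta := u (x0, s0) - u (x0, t0) - (t0 - s0) * slope L (lev (x0, t0)).
  have delta0 : 0 < delta by rewrite subr_gt0.
  have [d1 d10 d1P] := compact_unif_continuous cK uK delta0.
  pose Emax := slope L (M + 1).
  have [R0 R00 R0P] := coercive_bound Emax hH2 cK KT.
  pose Hz (w : spacetime * 'rV[R]_N) := H w.1.1 w.1.2 w.2.
  pose K1 := [set w : spacetime * 'rV[R]_N | K w.1 /\
    forall j, (\row_j (- R0)) 0 j <= w.2 0 j <= (\row_(j < N) R0) 0 j].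
  have cK1 : compact K1.
    exact: (@compact_prod_set spacetime 'rV[R]_N K _ cK
      (@segment_box_compact R N (\row_j (- R0)) (\row_j R0))).
  have HzK1 w : K1 w -> {for w, continuous Hz}.
    by move=> [/KT[w0 wT] _]; exact: hamiltonian_continuous.
  pose e1 := Num.min L (d1 * L).
  have e10 : 0 < e1 by rewrite lt_min L0 mulr_gt0.
  have [d2 d20 d2P] := compact_unif_continuous cK1 HzK1 e10.
  pose k0 := Num.min d1 (Num.min d2 rho).
  have k00 : 0 < k0 by rewrite !lt_min d10 d20.
  have k0d1 : k0 <= d1 by rewrite ge_min lexx.
  have k0d2 : k0 <= d2 by rewrite !ge_min lexx orbT.
  have k0rho : k0 <= rho by rewrite !ge_min lexx !orbT.
  (* [k0] is a common modulus of continuity for [u] and [H]; this [n] makes the space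
     variables of the maximum closer than [k0]. *)
  pose n := (osc + 1) / k0 ^+ 2.
  have n0 : 0 < n by rewrite divr_gt0 ?exprn_gt0// addr_gt0.
  have [a [b [Ka Kb ab maxab]]] :=
    @doubled_max R N L M A m beta c n z.1 z.2 u K (ex_intro _ z Kz) cK uK.
  have base : delta <= doubled L M A m beta c n z.1 z.2 u (a, b).
    apply: le_trans (maxab (x0, s0) (x0, t0) Ka0 Kb0 st0).
    rewrite /doubled /penalty /= subrr dotv0 mulr0 addr0.
    have -> : cutoff M A (level m beta c z.1 z.2 u (x0, t0)) = 0.
      rewrite /cutoff /pos_part_sq max_l; first by rewrite expr0n mulr0.
      by rewrite subr_le0; exact: levM.
    by rewrite addr0 opprD addrA.
  pose v := lev b; pose E := slope L v; pose th := b.2 - a.2.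
  have v0 : 0 <= v by exact: lev_ge0.
  have LE : L <= E.
    have := @slope_le R L (ltW L0) 0 v v0; apply: le_trans.
    by rewrite /slope mulr0 expR0 mulr1.
  have E0 : 0 < E by exact: lt_le_trans LE.
  have th0 : 0 <= th by rewrite subr_ge0.
  pose nq := n * dotv (a.1 - b.1) (a.1 - b.1).
  have sum_le : delta + th * E + cutoff M A v + nq <= u a - u b.
    move: base; rewrite /doubled /penalty /= -/lev -/v -/E -/th -/nq.
    by move: (cutoff M A v) (th * E) nq; clear - hH0 hH1 hH2 u_cont u_ge u_sol; move=> *; lra.
  have thE0 : 0 <= th * E by rewrite mulr_ge0// ltW.
  have cut0 : 0 <= cutoff M A v by rewrite mulr_ge0 ?pos_part_sq_ge0// ltW.
  have nq0 : 0 <= nq by rewrite mulr_ge0 ?dotv_ge0// ltW.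
  have ab_osc := uosc _ _ Ka Kb.
  have [du [thE_le [cut_lt nq_lt]]] : delta <= u a - u b /\
      th * E <= osc /\ cutoff M A v < osc /\ nq < osc.
    move: sum_le thE0 cut0 nq0 ab_osc delta0.
    move: (cutoff M A v) (th * E) nq; clear - hH0 hH1 hH2 u_cont u_ge u_sol.
    by move=> *; do !split; lra.
  have vM : v < M + 1.
    rewrite ltNge; apply/negP => Mv.
    have pp : 1 <= pos_part_sq (v - M).
      rewrite /pos_part_sq exprn_ege1// le_max; apply/orP; right.
      by move: Mv; clear - hH0 hH1 hH2 u_cont u_ge u_sol; lra.
    have : A * 1 <= cutoff M A v by rewrite /cutoff ler_wpM2l// ltW.
    by move: cut_lt; rewrite /A; move: (cutoff _ _ v); clear - hH0 hH1 hH2 u_cont u_ge u_sol; move=> *; lra.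
  pose mx := Num.max 0 (v - M).
  have mx0 : 0 <= mx by rewrite le_max lexx.
  have mx1 : mx <= 1 by rewrite ge_max ler01 /= lerBlDl ltW.
  have [Yrho tr] : enorm (b.1 - z.1) < rho /\ `|b.2 - z.2| < r.
    have ub : m <= u b by apply: u_ge; exact: KT.
    have y0 := dotv_ge0 (b.1 - z.1); have t20 := sqr_ge0 (b.2 - z.2).
    have by0 := mulr_ge0 (ltW beta0) y0; have ct0 := mulr_ge0 (ltW c_gt0) t20.
    have wM : beta * dotv (b.1 - z.1) (b.1 - z.1) + c * (b.2 - z.2) ^+ 2 < M + 1.
      by move: vM ub; rewrite /v /lev /level; clear - hH0 hH1 hH2 u_cont u_ge u_sol; lra.
    split.
      rewrite -ltr_sqr ?nnegrE ?enorm_ge0// ?ltW// sqr_enorm.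
      by rewrite -(ltr_pM2l beta0) betarho; move: wM ct0; clear - hH0 hH1 hH2 u_cont u_ge u_sol; lra.
    rewrite -ltr_sqr ?nnegrE// ?ltW// real_normK ?num_real//.
    by rewrite -(ltr_pM2l c_gt0) cr; move: wM by0; clear - hH0 hH1 hH2 u_cont u_ge u_sol; lra.
  have abk : enorm (a.1 - b.1) < k0.
    rewrite -ltr_sqr ?nnegrE ?enorm_ge0// ?ltW// sqr_enorm -(ltr_pM2l n0) -/nq.
    have -> : n * k0 ^+ 2 = osc + 1 by rewrite /n; field; rewrite gt_eqF.
    by apply: lt_trans nq_lt _; rewrite ltrDl.
  have thr : th < r.
    rewrite -(ltr_pM2r L0); apply: (@le_lt_trans _ _ osc).
      by apply: le_trans thE_le; exact: ler_wpM2l.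
    by move: Losc; rewrite ltr_pdivrMr// mulrC.
  (* Close times would make [u a - u b] smaller than the positive maximum. *)
  have thd1 : d1 <= th.
    rewrite leNgt; apply/negP => thd.
    have : `|u a - u b| < delta.
      apply: d1P => //; rewrite prod_normE /= gt_max; apply/andP; split.
        by apply: le_lt_trans (norm_le_enorm _) _; exact: lt_le_trans k0d1.
      by rewrite distrC ger0_norm.
    by rewrite ltNge; apply/negP; rewrite negbK; exact: le_trans du (ler_norm _).
  have th_gt0 : 0 < th by exact: lt_le_trans thd1.
  have ab_lt : a.2 < b.2 by rewrite -subr_gt0.
  have rr : r < 2 * r by rewrite ltr_pMl// ltr1n.
  have rhorho : rho < 2 * rho by rewrite ltr_pMl// ltr1n.
  have nearb : \forall w \near b, K w.
    apply: box_nbhs; last exact: lt_trans rr.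
    by apply: le_lt_trans (norm_le_enorm _) _; exact: lt_trans rhorho.
  have neara : \forall w \near a, K w.
    apply: box_nbhs.
      have -> : a.1 - z.1 = (a.1 - b.1) + (b.1 - z.1) by rewrite addrA subrK.
      apply: le_lt_trans (ler_normD _ _) _.
      have h1 := le_lt_trans (norm_le_enorm _) abk.
      have h2 := le_lt_trans (norm_le_enorm _) Yrho.
      by move: h1 h2 k0rho; clear - hH0 hH1 hH2 u_cont u_ge u_sol; lra.
    have -> : a.2 - z.2 = (b.2 - z.2) - th by rewrite /th; ring.
    apply: le_lt_trans (ler_normB _ _) _; rewrite (ger0_norm th0).
    by move: tr thr; clear - hH0 hH1 hH2 u_cont u_ge u_sol; lra.
  pose D := th * (16 * E) + 2 * A * mx.
  pose d := (2 * beta) *: (b.1 - z.1); pose gam := 2 * c * (b.2 - z.2).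
  pose p := (2 * n) *: (a.1 - b.1).
  have [i1 i2] := @doubled_inequalities L M A beta c n z a b (2 * rho) (2 * r) D E d p gam
    (ltW L0) (ltW A0) (ltW beta0) (ltW c_gt0) (ltW n0) KT neara nearb ab_lt maxab
    erefl erefl erefl erefl erefl.
  have [a20 aT] := KT _ Ka; have [b20 bT] := KT _ Kb.
  have pR0 : enorm p < R0.
    apply: (R0P a p Ka); apply: le_trans i1 _.
    by apply: slope_le; exact: ltW.
  have HE : H b.1 a.2 p <= E + e1.
    have K1q q : enorm q < R0 -> K1 (a, q).
      move=> qR; split => //= j; rewrite !mxE -ler_norml.
      by apply: le_trans (coord_le_enorm _ _) _; exact: ltW.
    have K1a := K1q p pR0.
    have := d2P (a, p) ((b.1, a.2), p) K1a.
    rewrite !prod_normE /= !subrr !normr0 gt_max d20 andbT gt_max d20 andbT.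
    have -> : `|a.1 - b.1| < d2.
      by apply: le_lt_trans (norm_le_enorm _) _; exact: lt_le_trans k0d2.
    move=> /(_ isT); rewrite /Hz /= ltr_norml => /andP[h1 _].
    by move: i1 h1; clear - hH0 hH1 hH2 u_cont u_ge u_sol; lra.
  have D16 : 16 * (b.2 - a.2) * E <= D.
    rewrite /D -/th (_ : 16 * th * E = th * (16 * E)); last by ring.
    by rewrite lerDl; apply: mulr_ge0 => //; apply: mulr_ge0; [exact: ler0n|exact: ltW].
  have D0 : 0 < D.
    apply: lt_le_trans D16; apply: mulr_gt0; last exact: E0.
    by apply: mulr_gt0; [rewrite ltr0n|rewrite subr_gt0].
  have DDmax : D <= Dmax.
    have h1 : A * mx <= A * 1 by rewrite ler_wpM2l// ltW.
    rewrite /D /Dmax; move: thE_le h1; clear - hH0 hH1 hH2 u_cont u_ge u_sol; lra.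
  have e1D : e1 < D.
    apply: (@le_lt_trans _ _ (d1 * L)); first by rewrite ge_min lexx orbT.
    apply: (@le_lt_trans _ _ (th * E)).
      by apply: ler_pM => //; exact: ltW.
    apply: lt_le_trans D16; rewrite -/th -mulrA -subr_gt0.
    rewrite (_ : 16 * (th * E) - th * E = 15 * (th * E)); last by ring.
    by apply: mulr_gt0; [rewrite ltr0n|exact: mulr_gt0].
  have hD : (1 + D) * hmin < E - D * sigma.
    have h1 : D * hmin <= Dmax * hmin by rewrite ler_wpM2r// ltW.
    have h2 : D * sigma <= Dmax * sigma by rewrite ler_wpM2r.
    by move: h1 h2 Lhmin LE; clear - hH0 hH1 hH2 u_cont u_ge u_sol; lra.
  have kd : kappa * enorm d <= 2^-1.
    rewrite -kbr /d enormZ ger0_norm; last by rewrite mulr_ge0// ltW.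
    rewrite ler_wpM2l ?(ltW kappa0)//; apply: ler_wpM2l; last exact: ltW.
    by rewrite mulr_ge0// ltW.
  have e1E : e1 <= E by apply: le_trans LE; rewrite ge_min lexx.
  have := @scaled_hamiltonian_lt R N T H c0 phi c1 kappa b.1 p d a.2 b.2 D E e1 sigma hmin
    hH0 hH1 hk a20 ab_lt bT kd hc0 hc1 sigma0 phih D0 D16 E0 e1E e1D hD HE.
  have gs : - sigma <= gam.
    have : c * (z.2 - b.2) <= c * r.
      apply: ler_wpM2l; first exact: ltW.
      by apply: le_trans (ler_norm _) _; rewrite distrC ltW.
    by rewrite /gam /sigma; clear - hH0 hH1 hH2 u_cont u_ge u_sol; lra.
  have := ler_wpM2l (ltW D0) gs.
  move: i2; move: (H b.1 b.2 _); clear - hH0 hH1 hH2 u_cont u_ge u_sol; move=> *; lra.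
have Wz : nbhs z (K `&` [set w | lev w < M]).
  apply: filterI.
    apply: box_nbhs; rewrite subrr normr0; first exact: mulr_gt0.
    exact: mulr_gt0.
  have levc := @level_continuous R N m beta c z.1 z.2 u z (u_cont zT).
  have levM : lev z < M.
    by rewrite /lev /level !subrr dotv0 expr0n /= !mulr0 !addr0 /M ltrDl.
  exact: (@cvgr_lt R spacetime (nbhs z) _ lev (lev z) levc M levM).
exists (K `&` [set w | lev w < M]) => //; exists (slope L M).
  by apply: slope_ge0; exact: ltW.
move=> x s t [Ks _] [Kt /ltW levM] st.
apply: le_trans (key x s t Ks Kt st levM) _.
rewrite mulrC; apply: ler_wpM2r; first by rewrite subr_ge0.
by apply: slope_le => //; exact: ltW.
Qed.

End time_estimate.

(** * Lipschitz continuity from bounded superjets *)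

Section lipschitz_from_superjets.
Context {R : realType} {N : nat}.
Local Notation spacetime := ('rV[R]_N * R)%type.

Lemma sqdist_continuous (y : spacetime) : continuous (sqdist y).
Proof.
move=> w; have qc : {for w, continuous (quadratic y 0 0 1)}.
  exact: differentiable_continuous (quadratic_differentiable _ _ _ _ _).
have qE z : sqdist y z = quadratic y 0 0 1 z.
  by rewrite /quadratic dot0v; ring.
by rewrite /continuous_at (funext qE).
Qed.

Lemma sqdist_expand (z y w : spacetime) : sqdist z w =
  sqdist z y + 2 * (dotv (y.1 - z.1) (w.1 - y.1) + (y.2 - z.2) * (w.2 - y.2)) + sqdist y w.
Proof.
rewrite /sqdist.
have -> : w.1 - z.1 = (y.1 - z.1) + (w.1 - y.1).
  by rewrite [RHS]addrC addrA subrK.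
rewrite (dotvDl (y.1 - z.1)) !(dotvDr _ (y.1 - z.1)) (dotvC (w.1 - y.1) (y.1 - z.1)).
ring.
Qed.

Lemma enorm_sqdist (z w : spacetime) : enorm (w.1 - z.1) <= Num.sqrt (sqdist z w).
Proof.
by rewrite /enorm ler_sqrt ?sqdist_ge0// /sqdist lerDl sqr_ge0.
Qed.

Lemma time_sqdist (z w : spacetime) : `|w.2 - z.2| <= Num.sqrt (sqdist z w).
Proof.
by rewrite -sqrtr_sqr ler_sqrt ?sqdist_ge0// /sqdist lerDr dotv_ge0.
Qed.

Lemma sqrt_sqdist_le (z w : spacetime) :
  Num.sqrt (sqdist z w) <= (N%:R + 1) * `|w - z|.
Proof.
have h0 : 0 <= (N%:R + 1) * `|w - z| by rewrite mulr_ge0// addr_ge0.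
rewrite -ler_sqr ?nnegrE ?sqrtr_ge0// sqr_sqrtr ?sqdist_ge0//.
have h1 : enorm (w.1 - z.1) <= N%:R * `|w - z|.
  apply: le_trans (enorm_le_norm _) _; rewrite ler_wpM2l//.
  by rewrite prod_normE /= le_max lexx.
have h2 : `|w.2 - z.2| <= `|w - z| by rewrite prod_normE /= le_max lexx orbT.
rewrite /sqdist -sqr_enorm -[X in _ + X]real_normK ?num_real//.
apply: (@le_trans _ _ ((enorm (w.1 - z.1) + `|w.2 - z.2|) ^+ 2)).
  rewrite sqrrD; have := mulr_ge0 (enorm_ge0 (w.1 - z.1)) (normr_ge0 (w.2 - z.2)); lra.
rewrite ler_sqr ?nnegrE ?addr_ge0 ?enorm_ge0// mulrDl mul1r; lra.
Qed.

(** The tangent line to the square root at [b] lies above the graph; it turns a cone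
    into a quadratic test function away from its apex. *)
Lemma sqrt_le_chord (a b : R) : 0 <= a -> 0 < b ->
  Num.sqrt a <= Num.sqrt b + (a - b) / (2 * Num.sqrt b).
Proof.
move=> a0 b0.
have sb0 : 0 < Num.sqrt b by rewrite sqrtr_gt0.
rewrite -{2}(sqr_sqrtr a0) -{2}(sqr_sqrtr (ltW b0)).
move: (Num.sqrt a) (Num.sqrt b) sb0 => s t t0.
rewrite -subr_ge0 (_ : _ - s = (s - t) ^+ 2 / (2 * t)).
  by rewrite divr_ge0 ?sqr_ge0// mulr_ge0// ltW.
by field; rewrite gt_eqF.
Qed.

(** At a maximum [y <> a] of [u - K * |. - a|] the cone provides a superjet of Euclidean
    norm exactly [K], which is too large; so the maximum is at the apex. The
    oscillation bound places the maximum in the interior of the box. *)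
Lemma cone_bound (u : spacetime -> R) (z : spacetime) (r B K osc : R) :
  0 <= B -> 0 < K -> (2 * B ^+ 2 < K ^+ 2) -> osc < K * r ->
  (forall y, box z (2 * r) (2 * r) y -> {for y, continuous u}) ->
  (forall a b, box z (2 * r) (2 * r) a -> box z (2 * r) (2 * r) b -> u a - u b <= osc) ->
  (forall y q tau C, (\forall w \near y, box z (2 * r) (2 * r) w) ->
     (\forall w \near y, u w <= u y + quadratic y q tau C w) ->
     enorm q <= B /\ `|tau| <= B) ->
  forall a b, ball z r a -> ball z r b -> u b - u a <= K * Num.sqrt (sqdist a b).
Proof.
move=> B0 K0 KB oscK uc uosc jets a b [a1 a2] [b1 b2].
rewrite -ball_normE /= in a1; have {}a2 : `|z.2 - a.2| < r := a2.
rewrite -ball_normE /= in b1; have {}b2 : `|z.2 - b.2| < r := b2.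
have r0 : 0 < r by exact: le_lt_trans (normr_ge0 _) b2.
have r2 : r < 2 * r by lra.
pose Q := box z (2 * r) (2 * r).
have Qa : Q a.
  by apply: nbhs_singleton; apply: box_nbhs; rewrite distrC; exact: lt_trans r2.
have Qb : Q b.
  by apply: nbhs_singleton; apply: box_nbhs; rewrite distrC; exact: lt_trans r2.
(* The cone with apex [a]. *)
pose g w := u w - K * Num.sqrt (sqdist a w).
have gc : {within Q, continuous g}.
  apply: continuous_in_subspaceT => w; rewrite inE => Qw.
  apply: cvgB; first exact: uc.
  apply: cvgM; first exact: cvg_cst.
  by apply: continuous_cvg; [exact: sqrt_continuous|exact: sqdist_continuous].
have [y] := compact_EVT_max (ex_intro Q a Qa) (@box_compact _ _ _ _ _) gc.
rewrite inE => Qy maxy.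
have sqa : Num.sqrt (sqdist a a) = 0.
  by rewrite /sqdist !subrr dotv0 expr0n /= addr0 sqrtr0.
have ga : g a <= g y by apply: maxy; rewrite inE.
have gb : g b <= g y by apply: maxy; rewrite inE.
rewrite /g sqa mulr0 subr0 in ga; rewrite /g in gb.
have [y0|yN] := eqVneq (sqdist a y) 0.
  have y1 : y.1 = a.1.
    apply/eqP; rewrite -subr_eq0; apply/eqP; apply: dotv_eq0; apply/eqP.
    rewrite eq_le dotv_ge0 andbT -y0 /sqdist lerDl sqr_ge0//.
  have y2 : y.2 = a.2.
    apply/eqP; rewrite -subr_eq0 -sqrf_eq0 eq_le sqr_ge0 andbT -y0 /sqdist.
    by rewrite lerDr dotv_ge0.
  have ya : y = a by case: (y) (a) y1 y2 => ? ? [? ?] /= -> ->.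
  by move: gb; rewrite ya sqa mulr0; lra.
have Ny : 0 < sqdist a y by rewrite lt_neqAle eq_sym yN sqdist_ge0.
pose s := Num.sqrt (sqdist a y).
have s0 : 0 < s by rewrite sqrtr_gt0.
have sr : s < r.
  rewrite -(ltr_pM2l K0); apply: le_lt_trans oscK.
  by have := uosc _ _ Qy Qa; move: ga; rewrite -/s; lra.
have neary : \forall w \near y, Q w.
  apply: box_nbhs.
    have -> : y.1 - z.1 = (y.1 - a.1) - (z.1 - a.1) by rewrite opprB addrA subrK.
    apply: le_lt_trans (ler_normB _ _) _.
    have := le_trans (norm_le_enorm _) (enorm_sqdist a y).
    by rewrite -/s; lra.
  have -> : y.2 - z.2 = (y.2 - a.2) - (z.2 - a.2) by ring.
  apply: le_lt_trans (ler_normB _ _) _.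
  by have := time_sqdist a y; rewrite -/s; lra.
have ss : s ^+ 2 = sqdist a y by rewrite sqr_sqrtr// sqdist_ge0.
have [||q_le tau_le] :=
    jets y ((K / s) *: (y.1 - a.1)) (K / s * (y.2 - a.2)) (K / (2 * s)).
- exact: neary.
- apply: filterS neary => w Qw.
  have gw : g w <= g y by apply: maxy; rewrite inE.
  rewrite /g in gw.
  have := ler_wpM2l (ltW K0) (sqrt_le_chord (sqdist_ge0 a w) Ny).
  rewrite {2}(sqdist_expand a y w) -/s /quadratic dotvZl.
  have -> : K * (s + (sqdist a y + 2 * (dotv (y.1 - a.1) (w.1 - y.1) +
      (y.2 - a.2) * (w.2 - y.2)) + sqdist y w - sqdist a y) / (2 * s)) =
    K * s + (K / s * dotv (y.1 - a.1) (w.1 - y.1) +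
      K / s * (y.2 - a.2) * (w.2 - y.2) + K / (2 * s) * sqdist y w).
    by field; rewrite gt_eqF.
  by move: gw; rewrite -/s; lra.
have qq : enorm ((K / s) *: (y.1 - a.1)) ^+ 2 <= B ^+ 2.
  by rewrite ler_sqr ?nnegrE ?enorm_ge0.
have tt : (K / s * (y.2 - a.2)) ^+ 2 <= B ^+ 2.
  by rewrite -[leLHS]real_normK ?num_real// ler_sqr ?nnegrE.
have KE : enorm ((K / s) *: (y.1 - a.1)) ^+ 2 + (K / s * (y.2 - a.2)) ^+ 2 = K ^+ 2.
  rewrite sqr_enorm dotvZl dotvZr.
  transitivity ((K / s) ^+ 2 * sqdist a y); first by rewrite /sqdist; ring.
  by rewrite -ss; field; rewrite gt_eqF.
by move: qq tt KE KB; lra.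
Qed.

End lipschitz_from_superjets.

Section local_lipschitz.
Context {R : realType} {N : nat}.
Local Notation spacetime := ('rV[R]_N * R)%type.
Variables (T : \bar R) (H : 'rV[R]_N -> R -> 'rV[R]_N -> R).
Variables (c0 : R) (phi : R -> R) (c1 : R).
Hypotheses (hH0 : H0 T H c0 phi) (hH1 : H1 T H c0 phi c1) (hH2 : H2 T H).
Variables (u : spacetime -> R) (m : R).
Hypothesis u_cont : forall y, cylinder T y -> {for y, continuous u}.
Hypothesis u_ge : forall y, cylinder T y -> m <= u y.
Hypothesis u_sol : viscosity_solution T H u.

(** [time_estimate] compares [u] with its values at later times and gives [tau >= - L].
    The subsolution inequality then reads [H (y, q) <= - tau <= L], so coercivity
    bounds [q], and finally [tau <= - H (y, q)] is bounded because [H] is bounded on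
    compact sets. *)
Lemma superjet_bound (z : spacetime) : cylinder T z ->
  exists2 r, 0 < r & box z r r `<=` cylinder T /\
  exists2 B, 0 <= B & forall y q tau C, (\forall w \near y, box z r r w) ->
    (\forall w \near y, u w <= u y + quadratic y q tau C w) ->
    enorm q <= B /\ `|tau| <= B.
Proof.
move=> zT.
have [W zW [L L0 uL]] := time_estimate hH0 hH1 hH2 u_cont u_ge u_sol zT.
have : nbhs z (W `&` cylinder T).
  apply: filterI => //; apply: open_nbhs_nbhs; split => //; exact: cylinder_open.
move=> /nbhs_ballP[e /= e0 eW].
pose r := e / 2.
have r0 : 0 < r by rewrite divr_gt0.
have re : r < e by rewrite /r; lra.
have KW : box z r r `<=` W `&` cylinder T.
  move=> w [w1 /andP[w2 w3]]; apply: eW; split.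
    split => // i j; rewrite ord1; have /andP[? ?] := w1 j.
    by rewrite /ball /= ltr_norml; apply/andP; split; lra.
  by rewrite /ball /= ltr_norml; apply/andP; split; lra.
have KT : box z r r `<=` cylinder T by move=> w /KW[].
have cK : compact (box z r r) := @box_compact _ _ _ _ _.
exists r => //; split => //.
have [R0 R00 R0P] := coercive_bound L hH2 cK KT.
pose Hz (w : spacetime * 'rV[R]_N) := H w.1.1 w.1.2 w.2.
pose K1 := [set w : spacetime * 'rV[R]_N | box z r r w.1 /\
    forall j, (\row_j (- R0)) 0 j <= w.2 0 j <= (\row_(j < N) R0) 0 j].
have cK1 : compact K1.
  exact: (@compact_prod_set spacetime 'rV[R]_N (box z r r) _ cK
    (@segment_box_compact R N (\row_j (- R0)) (\row_j R0))).
have K1q y q : box z r r y -> enorm q < R0 -> K1 (y, q).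
  move=> Ky qR; split => //= j; rewrite !mxE -ler_norml.
  by apply: le_trans (coord_le_enorm _ _) _; exact: ltW.
have HzK1 : {within K1, continuous Hz}.
  apply: continuous_in_subspaceT => w; rewrite inE => -[/KT[w0 wT] _].
  by have [Hc _ _ _ _] := hH0; exact: hamiltonian_continuous.
have K1z : K1 !=set0.
  exists (z, 0); apply: K1q; last by rewrite enorm0.
  by apply: nbhs_singleton; apply: box_nbhs; rewrite subrr normr0.
have [wmin _ minP] := compact_EVT_min K1z cK1 HzK1.
exists (Num.max R0 (Num.max L (- Hz wmin))); first by rewrite le_max (ltW R00).
move=> y q tau C neary jet.
have Ky : box z r r y by exact: nbhs_singleton neary.
have tau_ge : - L <= tau.
  have shift P : (\forall w \near y, P w) -> \forall h \near (0 : R), P (y.1, y.2 + h).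
    move=> /nbhs_ballP[d /= d0 dP]; apply/nbhs_ballP; exists d => //= h.
    rewrite -ball_normE /= sub0r normrN => hd; apply: dP; split; first exact: ballxx.
    by rewrite /ball /= opprD addrA subrr sub0r normrN.
  rewrite leNgt; apply/negP => tauL.
  have hC : \forall h \near (0 : R), h * C < - L - tau.
    have c : h * C @[h --> (0 : R)] --> 0 * C.
      by apply: cvgM; [exact: cvg_id|exact: cvg_cst].
    by apply: (cvgr_lt _ c); rewrite mul0r; lra.
  have /nbhs_ballP[d /= d0 dP] : nbhs (0 : R)
      [set h : R | box z r r (y.1, y.2 + h) /\
        (u (y.1, y.2 + h) <= u y + quadratic y q tau C (y.1, y.2 + h) /\ h * C < - L - tau)].
    by apply: filterI; [exact: (shift _ neary)|apply: filterI; [exact: (shift _ jet)|]].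
  pose h := d / 2.
  have h0 : 0 < h by rewrite divr_gt0.
  have [|Kh [jh Ch]] := dP h.
    by rewrite -ball_normE /= sub0r normrN gtr0_norm// /h; lra.
  have y_h : y.2 <= y.2 + h by rewrite lerDl ltW.
  have Wy : W (y.1, y.2) by rewrite -surjective_pairing; have [] := KW _ Ky.
  have Wh : W (y.1, y.2 + h) by have [] := KW _ Kh.
  have := uL y.1 _ _ Wy Wh y_h.
  have hE : y.2 + h - y.2 = h by ring.
  rewrite -surjective_pairing hE => uh.
  move: jh; rewrite /quadratic /sqdist /= subrr !dotv0 hE !add0r => jh.
  have : 0 <= h * (L + tau + h * C) by lra.
  by rewrite pmulr_rge0//; lra.
have HL : tau + H y.1 y.2 q <= 0.
  by have [usub _] := u_sol; exact: subsolution_test usub (KT _ Ky) jet.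
have qR : enorm q < R0 by apply: (R0P y q Ky); lra.
have Hmin : Hz wmin <= H y.1 y.2 q by apply: (minP (y, q)); rewrite inE; exact: K1q.
split; first by rewrite le_max (ltW qR).
rewrite ler_norml; apply/andP; split.
  have : L <= Num.max R0 (Num.max L (- Hz wmin)) by rewrite !le_max lexx orbT.
  by lra.
have : - Hz wmin <= Num.max R0 (Num.max L (- Hz wmin)) by rewrite !le_max lexx !orbT.
by lra.
Qed.

Lemma local_lipschitz_estimate (z : spacetime) : cylinder T z ->
  exists2 r, 0 < r & exists2 K, 0 <= K &
    forall a b, ball z r a -> ball z r b -> `|u a - u b| <= K * `|a - b|.
Proof.
move=> zT.
have [r r0 [rT [B B0 jets]]] := superjet_bound zT.
pose h := r / 2.
have h0 : 0 < h by rewrite divr_gt0.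
have rE : r = 2 * h by rewrite /h; lra.
have uc y : box z r r y -> {for y, continuous u} by move=> /rT; exact: u_cont.
have cu : {within box z r r, continuous u}.
  by apply: continuous_in_subspaceT => w; rewrite inE => /uc.
have Kz : box z r r !=set0.
  by exists z; apply: nbhs_singleton; apply: box_nbhs; rewrite subrr normr0.
have [w1 _ max1] := compact_EVT_max Kz (@box_compact _ _ _ _ _) cu.
have [w2 _ min2] := compact_EVT_min Kz (@box_compact _ _ _ _ _) cu.
pose osc := `|u w1 - u w2|.
have uosc a b : box z r r a -> box z r r b -> u a - u b <= osc.
  move=> Ka Kb; apply: le_trans (ler_norm _).
  have := max1 a; have := min2 b; rewrite !inE => /(_ Kb) h1 /(_ Ka) h2; lra.
pose K := 2 * B + osc / h + 1.
have oh : 0 <= osc / h by rewrite divr_ge0 ?normr_ge0 ?(ltW h0).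
have K1 : 0 < K by rewrite /K; lra.
have KB : 2 * B ^+ 2 < K ^+ 2.
  have : (2 * B) ^+ 2 < K ^+ 2.
    by rewrite ltr_sqr ?nnegrE ?(ltW K1)//; rewrite /K; lra.
  by rewrite exprMn; have := sqr_ge0 B; lra.
have Kosc : osc < K * h by rewrite -ltr_pdivrMr// /K; lra.
have KN : 0 <= K * (N%:R + 1) by rewrite mulr_ge0 ?(ltW K1)// addr_ge0.
rewrite rE in uc uosc jets.
exists h => //; exists (K * (N%:R + 1)) => //.
have half a b : ball z h a -> ball z h b -> u b - u a <= K * (N%:R + 1) * `|b - a|.
  move=> za zb; apply: le_trans (cone_bound B0 K1 KB Kosc uc uosc jets za zb) _.
  by rewrite -mulrA ler_wpM2l ?(ltW K1)//; exact: sqrt_sqdist_le.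
move=> a b za zb; rewrite ler_norml; apply/andP; split; last exact: half zb za.
by rewrite lerNl opprB distrC; exact: half za zb.
Qed.

End local_lipschitz.

Theorem mainTheorem2 (R : realType) (N : nat) (N_ge1 : (1 <= N)%N)
    (T : \bar R) (T_gt0 : (0 < T)%E)
    (H : 'rV[R]_N -> R -> 'rV[R]_N -> R)
    (c0 : R) (phi : R -> R) (c1 : R)
    (hH0 : H0 T H c0 phi)
    (hH1 : H1 T H c0 phi c1)
    (hH2 : H2 T H)
    (u : 'rV[R]_N * R -> R)
    (u_cont : {within cylinder T, continuous u})
    (u_lb : has_lbound (u @` cylinder T))
    (u_sol : viscosity_solution T H u) :
  locally_lipschitz_on (cylinder (Order.min (t_star c0 phi c1) T)) u.
Proof.
have [m m_lb] := u_lb.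
have u_ge y : cylinder T y -> m <= u y by move=> yT; apply: m_lb; exists y.
move=> z [z0]; rewrite lt_min => /andP[_ zT].
have [r r0 [K K0 uK]] := local_lipschitz_estimate hH0 hH1 hH2
  (fun y => @cylinder_continuous R N T u y u_cont) u_ge u_sol (conj z0 zT).
exists (ball z r); first exact: nbhsx_ballx.
rewrite /lipschitz_on; near=> M => -[a b] /= [[za _] [zb _]] /=.
by apply: le_trans (uK a b za zb) _; rewrite ler_wpM2r.
Unshelve. all: by end_near.
Qed.
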